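(* Let $t\ge1$, $n\ge1$ and $J\subseteq[n-1]$. Then (1) $\alpha_n^{(t)}(J)=\sum_{\lambda\vdash n}\Phi_t(s_\lambda)\cdot\big|\{\text{SYT }\tau\text{ of shape }\lambda:\ \mathrm{Des}(\tau)\subseteq J\}\big|$; (2) $\beta_n^{(t)}(J)=\sum_{\lambda\vdash n}\Phi_t(s_\lambda)\cdot\big|\{\text{SYT }\tau\text{ of shape }\lambda:\ \mathrm{Des}(\tau)=J\}\big|$.
   Context: $B_n^{(t)}$ is the poset of $t$-tuples $(A_1,\ldots,A_t)$ of subsets of $[n]$ with $|A_1|=\cdots=|A_t|$, ordered componentwise by inclusion and graded by the common cardinality, with $\mathfrak{S}_n^{\times t}$ acting coordinatewise. For $J\subseteq[n-1]$, $B_n^{(t)}(J)$ is the subposet of elements of rank in $J$ together with bottom and top. $\alpha_n^{(t)}(J)$ is the product Frobenius characteristic of the permutation module of $\mathfrak{S}_n^{\times t}$ on the maximal chains of $B_n^{(t)}(J)$, and $\beta_n^{(t)}(J)$ that of the top reduced rational homology $\tilde H_{|J|-1}$ of (the order complex of the proper part of) $B_n^{(t)}(J)$. The product Frobenius characteristic of $\sum a_{\boldsymbol\mu}\chi^{\mu^1}\otimes\cdots\otimes\chi^{\mu^t}$ is $\sum a_{\boldsymbol\mu}\prod_js_{\mu^j}(X^j)$ for disjoint variable sets $X^1,\ldots,X^t$ ($\chi^\mu$ irreducible character, $s_\mu$ Schur function). $\Phi_t:\Lambda(x)\to\bigotimes_j\Lambda(X^j)$ is the algebra homomorphism with $\Phi_t(h_m)=\prod_jh_m(X^j)$.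 SYT means standard Young tableau; the descent set $\mathrm{Des}(\tau)$ of an SYT $\tau$ is the set of entries $i$ such that $i+1$ lies in a row strictly below the row of $i$. *)

(* Defs.v *)
From HB Require Import structures.
From mathcomp Require Import all_boot all_order all_fingroup all_algebra.
From mathcomp Require Import mxrepresentation.
From mathcomp Require Import boolp.
From mathcomp.multinomials Require Import mpoly.

Set Implicit Arguments.
Unset Strict Implicit.
Unset Printing Implicit Defensive.

Import Order.TTheory GRing.Theory Num.Theory.
Local Open Scope ring_scope.

(* Permutation modules over the rationals.  MathComp represents groups by     *)
(* right multiplication on row vectors, and composes permutations from left   *)
(* to right; all actions below are accordingly right actions.                 *)

Section PermutationModule.
Variables (gT : finGroupType) (X : finType) (to : {action gT &-> X}).
Variables (S : {set X}) (actsS : [acts [set: gT], on S | to]).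

Definition perm_module_mx (g : gT) : 'M[rat]_#|S| :=
  \matrix_(i, j) (to (enum_val i) g == enum_val j)%:R.

Lemma acts_in x g : (to x g \in S) = (x \in S).
Proof. exact: (acts_act actsS (in_setT g)). Qed.

Lemma sum_orbit_delta (F : X -> rat) x g : x \in S ->
  \sum_(k < #|S|) (to x g == enum_val k)%:R * F (enum_val k) = F (to x g).
Proof.
move=> Sx; have Sxg : to x g \in S by rewrite acts_in.
rewrite (bigD1 (enum_rank_in Sxg (to x g))) //= enum_rankK_in // eqxx mul1r.
rewrite big1 ?addr0 // => k /negP nk; case: eqP => [e|]; last by rewrite mul0r.
by case: nk; apply/eqP/enum_val_inj; rewrite enum_rankK_in.
Qed.

Lemma perm_module_mx_repr : mx_repr [set: gT] perm_module_mx.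
Proof.
split=> [|g h _ _]; apply/matrixP=> i j; rewrite !mxE.
  by rewrite act1 (inj_eq enum_val_inj).
under eq_bigr do rewrite !mxE.
by rewrite (sum_orbit_delta (fun x => (to x h == _)%:R)) ?enum_valP // actM.
Qed.

Definition perm_module := MxRepresentation perm_module_mx_repr.

End PermutationModule.

(* The linear map with kernel f from the module on S to the module on T.      *)
Definition kernel_mx (X Y : finType) (f : X -> Y -> rat)
    (S : {set X}) (T : {set Y}) : 'M[rat]_(#|S|, #|T|) :=
  \matrix_(i, j) f (enum_val i) (enum_val j).

Section EquivariantKernel.
Variables (gT : finGroupType) (X Y : finType).
Variables (toX : {action gT &-> X}) (toY : {action gT &-> Y}).
Variables (S : {set X}) (T : {set Y}) (f : X -> Y -> rat).
Hypotheses (actsS : [acts [set: gT], on S | toX]).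
Hypotheses (actsT : [acts [set: gT], on T | toY]).
Hypothesis f_inv : forall x y g, f (toX x g) (toY y g) = f x y.

Lemma kernel_mx_comm g :
  perm_module actsS g *m kernel_mx f S T =
  kernel_mx f S T *m perm_module actsT g.
Proof.
apply/matrixP=> i j; rewrite !mxE; under eq_bigr do rewrite !mxE.
rewrite (sum_orbit_delta actsS (fun x => f x _)) ?enum_valP //.
under eq_bigr => k _ do rewrite !mxE mulrC.
rewrite -[enum_val j in LHS](actKV toY g) f_inv.
rewrite -(sum_orbit_delta actsT (fun y => f _ y)) ?enum_valP //.
by apply: eq_bigr => k _; rewrite (can2_eq (actKV toY g) (actK toY g)) eq_sym.
Qed.

Lemma image_module : mxmodule (perm_module actsT) <<kernel_mx f S T>>%MS.
Proof.
apply/mxmoduleP=> g _; rewrite (eqmxMr _ (genmxE _)) genmxE -kernel_mx_comm.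
exact: submxMl.
Qed.

Lemma kernel_module : mxmodule (perm_module actsS) (kermx (kernel_mx f S T)).
Proof.
apply/mxmoduleP=> g _; apply/sub_kermxP.
by rewrite -mulmxA kernel_mx_comm mulmxA mulmx_ker mul0mx.
Qed.

End EquivariantKernel.

Definition character (gT : finGroupType) d
    (rG : mx_representation rat [set: gT] d) (g : gT) : rat := \tr (rG g).

Definition char_dot (gT : finGroupType) (chi psi : gT -> rat) : rat :=
  #|gT|%:R^-1 * \sum_g chi g * psi (g^-1)%g.

(* Chains, maximal chains and reduced homology of the order complex of a      *)
(* subset Q of a finite poset with a group acting by automorphisms.           *)

Section OrderComplex.
Variables (disp : Order.disp_t) (P : finPOrderType disp).

Definition is_chain (Q c : {set P}) : bool :=
  (c \subset Q) && [forall x in c, forall y in c, (x >=< y)%O].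

Definition max_chains (Q : {set P}) : {set {set P}} :=
  [set c | maxset (is_chain Q) c].

(* The faces of dimension m - 1; the only one for m = 0 is the empty face.    *)
Definition faces (Q : {set P}) (m : nat) : {set {set P}} :=
  [set c | is_chain Q c & #|c| == m].

(* The coefficient of c' in the boundary of c = {x_0 < ... < x_k}, i.e.,      *)
(* (-1)^i if c' is c with x_i removed.                                        *)
Definition boundary_coef (c c' : {set P}) : rat :=
  \sum_(x in c | c :\ x == c') (-1) ^+ #|[set y in c | (y < x)%O]|.

(* For m = 0 this is the zero map, as the empty chain has no element.         *)
Definition boundary (Q : {set P}) (m : nat) :
    'M[rat]_(#|faces Q m|, #|faces Q m.-1|) :=
  kernel_mx boundary_coef (faces Q m) (faces Q m.-1).

Variables (gT : finGroupType) (to : {action gT &-> P}) (Q : {set P}).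
Hypothesis to_mono : forall g, {mono to^~ g : x y / (x <= y)%O}.
Hypothesis actsQ : [acts [set: gT], on Q | to].

Lemma is_chain_act c g : is_chain Q (to^* c g)%act = is_chain Q c.
Proof.
have imp d h : is_chain Q d -> is_chain Q (to^* d h)%act.
  case/andP=> /subsetP dQ /'forall_in_'forall_in_idP ch; apply/andP; split.
    apply/subsetP=> _ /imsetP[x dx ->].
    by rewrite (acts_in actsQ) dQ.
  apply/'forall_in_'forall_in_idP=> _ /imsetP[x dx ->] _ /imsetP[y dy ->].
  by rewrite /Order.comparable !to_mono; apply: ch.
by apply/idP/idP=> [/(imp _ g^-1%g)|]; rewrite ?actK //; apply: imp.
Qed.

Lemma faces_acts m : [acts [set: gT], on faces Q m | to^*].
Proof.
by apply/actsP=> g _ c; rewrite !inE is_chain_act card_setact.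
Qed.

Lemma max_chains_acts : [acts [set: gT], on max_chains Q | to^*].
Proof.
have imp c g : maxset (is_chain Q) c -> maxset (is_chain Q) (to^* c g)%act.
  case/maxsetP=> ch cmax; apply/maxsetP; rewrite is_chain_act.
  split=> // d chd scd; rewrite -[d](actKV to^* g); congr (to^* _ g)%act.
  apply: cmax; first by rewrite is_chain_act.
  by rewrite -[c](actK to^* g); apply: imsetS.
apply/actsP=> g _ c; rewrite !inE.
by apply/idP/idP=> [/imp-/(_ g^-1%g)|]; rewrite ?actK //; apply: imp.
Qed.

Lemma boundary_coef_inv c c' g :
  boundary_coef (to^* c g)%act (to^* c' g)%act = boundary_coef c c'.
Proof.
rewrite /boundary_coef (reindex_inj (act_inj to g)) /=.
have memE (d : {set P}) x : (to x g \in (to^* d g)%act) = (x \in d).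
  exact: mem_imset (act_inj to g).
apply: eq_big => [x|x _].
  rewrite memE; congr (_ && _).
  have -> : (to^* c g)%act :\ to x g = (to^* (c :\ x) g)%act.
    apply/setP=> y; rewrite -[y](actKV to g) memE !inE memE.
    by rewrite (inj_eq (act_inj to g)).
  by rewrite (inj_eq (act_inj to^* g)).
congr (_ ^+ _); rewrite -[RHS](card_setact to _ g); apply: eq_card => y.
rewrite -[y](actKV to g) [RHS](memE [set z in c | (z < x)%O]) !inE memE.
by rewrite (leW_mono (to_mono g)).
Qed.

(* The representation on the reduced rational homology in dimension m - 1:    *)
(* cycles modulo boundaries in the module of faces with m elements.           *)
Definition homology_repr (m : nat) :=
  section_repr
    (image_module (faces_acts m.+1) (faces_acts m) boundary_coef_inv)
    (kernel_module (faces_acts m) (faces_acts m.-1) boundary_coef_inv).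

Definition homology_char (m : nat) : gT -> rat := character (homology_repr m).

Definition max_chains_char : gT -> rat :=
  character (perm_module max_chains_acts).

End OrderComplex.

(* The poset of t-tuples of equicardinal subsets of 'I_n.                     *)

Section BooleanPower.
Variables t n : nat.

Record bool_pow := BoolPow {
  bp_val :> {ffun 'I_t -> {set 'I_n}};
  _ : [forall i, forall j, #|bp_val i| == #|bp_val j|]
}.

HB.instance Definition _ := [isSub for bp_val].
HB.instance Definition _ := [Finite of bool_pow by <:].

Implicit Types A B : bool_pow.

Lemma bp_card A i j : #|A i| = #|A j|.
Proof. by case: A => A /= /forallP/(_ i)/forallP/(_ j)/eqP. Qed.

Definition bp_le A B : bool := [forall i, A i \subset B i].

Lemma bp_le_refl : reflexive bp_le.
Proof. by move=> A; apply/forallP. Qed.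

Lemma bp_le_anti : antisymmetric bp_le.
Proof.
move=> A B /andP[/forallP AB /forallP BA]; apply/val_inj/ffunP=> i.
by apply/eqP; rewrite eqEsubset AB BA.
Qed.

Lemma bp_le_trans : transitive bp_le.
Proof.
move=> B A C /forallP AB /forallP BC.
by apply/forallP=> i; apply: subset_trans (AB i) (BC i).
Qed.

HB.instance Definition _ := Order.Le_isPOrder.Build (Order.Disp tt tt) bool_pow
  bp_le_refl bp_le_anti bp_le_trans.

Lemma bp_cst_subproof (D : {set 'I_n}) (A := [ffun _ : 'I_t => D]) :
  [forall i, forall j, #|A i| == #|A j|].
Proof. by apply/'forall_'forall_eqP=> i j; rewrite !ffunE. Qed.

Definition bp_cst D : bool_pow := BoolPow (bp_cst_subproof D).

Lemma bp_le0x A : (bp_cst set0 <= A)%O.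
Proof. by apply/forallP=> i; rewrite ffunE sub0set. Qed.

Lemma bp_lex1 A : (A <= bp_cst setT)%O.
Proof. by apply/forallP=> i; rewrite ffunE subsetT. Qed.

HB.instance Definition _ := Order.hasBottom.Build _ bool_pow bp_le0x.
HB.instance Definition _ := Order.hasTop.Build _ bool_pow bp_lex1.

(* The common cardinality, provided 0 < t.                                    *)
Definition bp_rank A : nat := \max_(i < t) #|A i|.

Definition bp_group := {dffun forall _ : 'I_t, 'S_n}.

Lemma bp_act_subproof A (g : bp_group)
    (gA := [ffun i : 'I_t => [set g i x | x in A i]]) :
  [forall i, forall j, #|gA i| == #|gA j|].
Proof.
apply/'forall_'forall_eqP=> i j; rewrite !ffunE !card_imset ?(bp_card A i j) //;
  exact: perm_inj.
Qed.

Definition bp_act A (g : bp_group) : bool_pow := BoolPow (bp_act_subproof A g).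

Lemma bp_act1 : bp_act^~ 1%g =1 id.
Proof.
move=> A; apply/val_inj/ffunP=> i; rewrite ffunE oneg_ffun.
by under eq_imset do rewrite perm1; rewrite imset_id.
Qed.

Lemma bp_actM A : act_morph bp_act A.
Proof.
move=> g h; apply/val_inj/ffunP=> i; rewrite !ffunE -imset_comp.
by apply: eq_imset => x; rewrite permM.
Qed.

Definition bp_action := TotalAction bp_act1 bp_actM.

Lemma bp_action_mono g : {mono bp_action^~ g : A B / (A <= B)%O}.
Proof.
move=> A B; apply: eq_forallb => i /=; rewrite !ffunE.
apply/idP/idP=> [/subsetP sAB|]; last exact: imsetS.
apply/subsetP=> x Ax; rewrite -(mem_imset _ _ (@perm_inj _ (g i))).
exact/sAB/imset_f.
Qed.

Variable J : {set 'I_n}.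

Definition bp_sel : {set bool_pow} :=
  [set A | [|| [exists j in J, bp_rank A == j], A == \bot%O | A == \top%O]].

Definition bp_proper : {set bool_pow} := bp_sel :\: [set \bot%O; \top%O].

Lemma bp_rank_act A g : bp_rank (bp_action A g) = bp_rank A.
Proof.
by apply: eq_bigr => i _; rewrite ffunE card_imset //; apply: perm_inj.
Qed.

Lemma bp_act_bot g : bp_action \bot%O g = \bot%O.
Proof.
by apply: le_anti; rewrite le0x andbT -(bp_action_mono g^-1%g) actK le0x.
Qed.

Lemma bp_act_top g : bp_action \top%O g = \top%O.
Proof.
by apply: le_anti; rewrite lex1 /= -(bp_action_mono g^-1%g) actK lex1.
Qed.

Lemma bp_act_eq_bot A g : (bp_action A g == \bot%O) = (A == \bot%O).
Proof. by rewrite -{1}(bp_act_bot g) (inj_eq (act_inj bp_action g)). Qed.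

Lemma bp_act_eq_top A g : (bp_action A g == \top%O) = (A == \top%O).
Proof. by rewrite -{1}(bp_act_top g) (inj_eq (act_inj bp_action g)). Qed.

Lemma bp_sel_acts : [acts [set: bp_group], on bp_sel | bp_action].
Proof.
apply/actsP=> g _ A; rewrite !inE bp_act_eq_bot bp_act_eq_top.
by congr (_ || _); apply: eq_existsb => j; rewrite bp_rank_act.
Qed.

Lemma bp_proper_acts : [acts [set: bp_group], on bp_proper | bp_action].
Proof.
apply/actsP=> g _ A; rewrite in_setD (acts_in bp_sel_acts) in_setD.
by congr (~~ _ && _); rewrite !inE bp_act_eq_bot bp_act_eq_top.
Qed.

End BooleanPower.

(* Partitions of n, padded with zeros to n parts.                             *)

Section Partitions.
Variable n : nat.

Record intpart := IntPart {
  part :> {ffun 'I_n -> 'I_n.+1};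
  _ : [forall i : 'I_n, forall j : 'I_n, (i <= j)%N ==> (part j <= part i)%N] &&
      (\sum_i part i == n)%N
}.

HB.instance Definition _ := [isSub for part].
HB.instance Definition _ := [Finite of intpart by <:].

(* The cell in row c.1 and column c.2, rows being numbered downwards.         *)
Definition cell (la : intpart) := {c : 'I_n * 'I_n | (c.2 < la c.1)%N}.

Variable la : intpart.
Definition row_of (c : cell la) : 'I_n := (val c).1.
Definition col_of (c : cell la) : 'I_n := (val c).2.

(* An SYT has entries 1, ..., n.                                              *)
Definition is_syt (T : {ffun cell la -> 'I_n.+1}) : bool :=
  [&& injectiveb T,
      [forall c, (0 < T c)%N],
      [forall c, forall c', (row_of c == row_of c') && (col_of c < col_of c')%N
                            ==> (T c < T c')%N] &
      [forall c, forall c', (col_of c == col_of c') && (row_of c < row_of c')%N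
                            ==> (T c < T c')%N]].

Definition Des (T : {ffun cell la -> 'I_n.+1}) : {set 'I_n} :=
  [set i : 'I_n | [exists c, exists c',
     [&& T c == i :> nat, T c' == i.+1 :> nat & (row_of c < row_of c')%N]]].

Definition is_ssyt N (T : {ffun cell la -> 'I_N}) : bool :=
  [forall c, forall c', (row_of c == row_of c') && (col_of c < col_of c')%N
                        ==> (T c <= T c')%N] &&
  [forall c, forall c', (col_of c == col_of c') && (row_of c < row_of c')%N
                        ==> (T c < T c')%N].

End Partitions.

(* Specht modules: the span of the polytabloids in the permutation module on  *)
(* tabloids.  A tableau is a bijective filling with 'I_n, not nec. standard;  *)
(* a tabloid is encoded by the map sending each entry to its row.             *)

Section Specht.
Variables (n : nat) (la : intpart n).

Definition filling := {ffun cell la -> 'I_n}.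
Definition row_map := {ffun 'I_n -> 'I_n}.

Definition filling_act (T : filling) (s : 'S_n) : filling :=
  [ffun c => s (T c)].

Lemma filling_act1 : filling_act^~ 1%g =1 id.
Proof. by move=> T; apply/ffunP=> c; rewrite ffunE perm1. Qed.

Lemma filling_actM T : act_morph filling_act T.
Proof. by move=> s u; apply/ffunP=> c; rewrite !ffunE permM. Qed.

Definition filling_action := TotalAction filling_act1 filling_actM.

Definition row_map_act (r : row_map) (s : 'S_n) : row_map :=
  [ffun k => r (s^-1%g k)].

Lemma row_map_act1 : row_map_act^~ 1%g =1 id.
Proof. by move=> r; apply/ffunP=> k; rewrite ffunE invg1 perm1. Qed.

Lemma row_map_actM r : act_morph row_map_act r.
Proof. by move=> s u; apply/ffunP=> k; rewrite !ffunE invMg permM. Qed.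

Definition row_map_action := TotalAction row_map_act1 row_map_actM.

Definition tableaux : {set filling} := [set T : filling | injectiveb T].

Definition tabloids : {set row_map} :=
  [set r : row_map | [forall i, #|[set k | r k == i]| == la i :> nat]].

Definition col_stab (T : filling) : {set 'S_n} :=
  [set s : 'S_n | [forall c, forall c',
                    (s (T c) == T c') ==> (col_of c == col_of c')]].

(* r is the tabloid of the tableau T.                                         *)
Definition tabloid_of (T : filling) (r : row_map) : bool :=
  [forall c, r (T c) == row_of c].

(* The coefficient of r in e_T = \sum_(s in col_stab T) sgn(s) {s T}.         *)
Definition polytabloid_coef (T : filling) (r : row_map) : rat :=
  \sum_(s in col_stab T | tabloid_of (filling_act T s) r) (-1) ^+ s.

Lemma tableaux_acts : [acts [set: 'S_n], on tableaux | filling_action].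
Proof.
apply/actsP=> s _ T; rewrite !inE; apply/injectiveP/injectiveP=> injT c c'.
  by move=> eqT; apply: injT; rewrite /= !ffunE eqT.
by rewrite /= !ffunE => /perm_inj/injT.
Qed.

Lemma tabloids_acts : [acts [set: 'S_n], on tabloids | row_map_action].
Proof.
apply/actsP=> s _ r; rewrite !inE; apply: eq_forallb => i.
congr (_ == _); rewrite -[RHS](card_imset _ (@perm_inj _ s)).
apply: eq_card => k; rewrite inE ffunE.
by rewrite -[k in RHS](permKV s) mem_imset ?inE //; apply: perm_inj.
Qed.

Lemma polytabloid_coef_inv T r (g : 'S_n) :
  polytabloid_coef (filling_action T g) (row_map_action r g) =
  polytabloid_coef T r.
Proof.
rewrite /polytabloid_coef (reindex_inj (conjg_inj g)) /=.
have conjE (s : 'S_n) k : (s ^ g)%g (g k) = g (s k).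
  by rewrite conjgE !permM permK.
apply: eq_big => [s|s _]; last by rewrite odd_permJ.
congr (_ && _).
  rewrite !inE; apply: eq_forallb => c; apply: eq_forallb => c'.
  by rewrite !ffunE conjE (inj_eq perm_inj).
by apply: eq_forallb => c; rewrite !ffunE conjE permK.
Qed.

Definition specht_repr :=
  submod_repr (image_module tableaux_acts tabloids_acts polytabloid_coef_inv).

(* The irreducible character chi^la of 'S_n.                                  *)
Definition specht_char : 'S_n -> rat := character specht_repr.

End Specht.

(* Families of polynomials in k N variables, N : nat, with pointwise          *)
(* operations: the ambient algebra of the ring of symmetric functions         *)
(* (k N = N) and of its t-th tensor power (k N = t * N, the t sets of N       *)
(* variables being pairwise disjoint).                                        *)

Definition polyfam (k : nat -> nat) := forall N, {mpoly rat[k N]}.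

Section PolyFamily.
Variable k : nat -> nat.
Local Notation fam := (polyfam k).
Implicit Types f g : fam.

HB.instance Definition _ := gen_eqMixin fam.
HB.instance Definition _ := gen_choiceMixin fam.

Let zero : fam := fun=> 0.
Let one : fam := fun=> 1.
Let opp f : fam := fun N => - f N.
Let add f g : fam := fun N => f N + g N.
Let mul f g : fam := fun N => f N * g N.
Let scale (c : rat) f : fam := fun N => c *: f N.

Let addA : associative add.
Proof. by move=> f g h; apply: functional_extensionality_dep => N; exact: addrA. Qed.
Let addC : commutative add.
Proof. by move=> f g; apply: functional_extensionality_dep => N; exact: addrC. Qed.
Let add0 : left_id zero add.
Proof. by move=> f; apply: functional_extensionality_dep => N; exact: add0r. Qed.
Let addN : left_inverse zero opp add.
Proof. by move=> f; apply: functional_extensionality_dep => N; exact: addNr. Qed.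

HB.instance Definition _ := GRing.isZmodule.Build fam addA addC add0 addN.

Let mulA : associative mul.
Proof. by move=> f g h; apply: functional_extensionality_dep => N; exact: mulrA. Qed.
Let mulC : commutative mul.
Proof. by move=> f g; apply: functional_extensionality_dep => N; exact: mulrC. Qed.
Let mul1 : left_id one mul.
Proof. by move=> f; apply: functional_extensionality_dep => N; exact: mul1r. Qed.
Let mulDl : left_distributive mul add.
Proof. by move=> f g h; apply: functional_extensionality_dep => N; exact: mulrDl. Qed.
Let one_neq0 : one != zero.
Proof. by apply/eqP => /(congr1 (@^~ 0%N))/eqP; rewrite oner_eq0. Qed.

HB.instance Definition _ :=
  GRing.Zmodule_isComNzRing.Build fam mulA mulC mul1 mulDl one_neq0.

Let scaleA (a b : rat) f : scale a (scale b f) = scale (a * b) f.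
Proof. by apply: functional_extensionality_dep => N; exact: scalerA. Qed.
Let scale1 : left_id 1 scale.
Proof. by move=> f; apply: functional_extensionality_dep => N; exact: scale1r. Qed.
Let scaleDr : right_distributive scale add.
Proof. by move=> a f g; apply: functional_extensionality_dep => N; exact: scalerDr. Qed.
Let scaleDl f : {morph scale^~ f : a b / a + b >-> add a b}.
Proof. by move=> a b; apply: functional_extensionality_dep => N; exact: scalerDl. Qed.

HB.instance Definition _ :=
  GRing.Zmodule_isLmodule.Build rat fam scaleA scale1 scaleDr scaleDl.

Let scaleAl (a : rat) f g : a *: (f * g) = (a *: f) * g.
Proof. by apply: functional_extensionality_dep => N; exact: scalerAl. Qed.

HB.instance Definition _ := GRing.Lmodule_isLalgebra.Build rat fam scaleAl.
HB.instance Definition _ := GRing.Lalgebra_isComAlgebra.Build rat fam.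

End PolyFamily.

Notation fam1 := (polyfam id).
Notation famt t := (polyfam (muln t)).

(* A symmetric function is a family of symmetric polynomials of bounded       *)
(* degree, compatible with setting the last variable to zero (the inverse     *)
(* limit, in the category of graded rings, of the rings of symmetric          *)
(* polynomials in N variables).                                               *)
Definition is_symfun (f : fam1) : Prop :=
  [/\ forall N, f N \is symmetric,
      forall N, f N.+1 \mPo [tuple (if unlift ord_max i is Some j
                                    then 'X_j else 0) | i < N.+1] = f N &
      exists d, forall N, (msize (f N) <= d)%N].

Definition h_sym (m : nat) : fam1 :=
  fun N => \sum_(a : 'X_{1..N < m.+1} | mdeg a == m) 'X_[a].

Definition schur n (la : intpart n) : fam1 :=
  fun N => \sum_(T : {ffun cell la -> 'I_N} | is_ssyt T) \prod_c 'X_(T c).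

(* f(X^j)                                                                     *)
Definition in_vars (t : nat) (j : 'I_t) (f : fam1) : famt t :=
  fun N => f N \mPo [tuple 'X_(mxvec_index j i) | i < N].

(* The product Frobenius characteristic; the coefficient of a product of      *)
(* irreducible characters in chi is its scalar product with chi.              *)
Definition prod_frob (t n : nat) (chi : bp_group t n -> rat) : famt t :=
  \sum_(mu : {ffun 'I_t -> intpart n})
    char_dot chi (fun g => \prod_j specht_char (mu j) (g j)) *:
    \prod_j in_vars j (schur (mu j)).

Definition alpha (t n : nat) (J : {set 'I_n}) : famt t :=
  prod_frob (max_chains_char (@bp_action_mono t n) (bp_sel_acts t J)).

(* homology_char is indexed by the number of elements of the faces, so #|J|   *)
(* stands for dimension #|J| - 1.                                             *)
Definition beta (t n : nat) (J : {set 'I_n}) : famt t :=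
  prod_frob (homology_char (@bp_action_mono t n) (bp_proper_acts t J) #|J|).

(* Phi restricts to an algebra morphism on the ring of symmetric functions,   *)
(* with the prescribed values on its generators h_m; the values of Phi        *)
(* outside that ring are irrelevant.                                          *)
Definition is_Phi (t : nat) (Phi : fam1 -> famt t) : Prop :=
  [/\ Phi 1 = 1,
      forall f g, is_symfun f -> is_symfun g -> Phi (f + g) = Phi f + Phi g,
      forall f g, is_symfun f -> is_symfun g -> Phi (f * g) = Phi f * Phi g,
      forall (c : rat) f, is_symfun f -> Phi (c *: f) = c *: Phi f &
      forall m, Phi (h_sym m) = \prod_(j < t) in_vars j (h_sym m)].

(* Main.v *)
Require Import Defs.
From mathcomp Require Import all_boot all_order all_fingroup all_algebra.
From mathcomp Require Import mxrepresentation zify ring.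
From mathcomp.multinomials Require Import mpoly.

Set Implicit Arguments.
Unset Strict Implicit.
Unset Printing Implicit Defensive.

Import Order.TTheory GRing.Theory Num.Theory.
Local Open Scope ring_scope.

(* A chain of B_n^(t) with rank set I is a t-tuple of ordered set partitions   *)
(* of [n] with block sizes read off I, so the faces with rank set I afford the *)
(* t-fold outer power of a Young permutation character, whose product          *)
(* Frobenius characteristic is Phi_t(h_I) by Young's rule; expanding h_I in    *)
(* Schur functions and standardizing semistandard tableaux gives (1).          *)
(* Pieri's rule, hence h_c = sum_la K_(la,c) s_la, follows by induction on the *)
(* number of variables from a bijection between the two ways of completing a   *)
(* square of horizontal strips.  Young's rule then needs only that chi^la has  *)
(* norm 1 and scalar product 1 (resp. 0) with the permutation character of la  *)
(* (resp. of every shape not dominated by la): the inverse Kostka combination  *)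
(* of permutation characters has norm 1 too, by counting contingency tables,   *)
(* and scalar product 1 with chi^la, so that both coincide.                    *)
(* For (2), the rank-selected subposets are acyclic below the top dimension:   *)
(* a face has an inversion set, which can only shrink when vertices are        *)
(* deleted, and the faces with a given inversion set form a Boolean interval.  *)
(* The Hopf trace formula and inclusion-exclusion finish the proof.            *)

(** * Partitions and horizontal strips *)

(** Everything is computed with characters. A chain with rank set [I] is, in each coordinate
    independently, an ordered set partition of [[n]] whose block sizes are read off [I]. The faces
    with rank set [I] therefore carry the outer product of [t] copies of one Young permutation
    character ([card_fixed_rank_set], [bp_faces_char]). The product Frobenius characteristic factors
    over the coordinates, and Young's rule ([young_rule]) with the Schur expansion of products of
    [h_m] ([h_prod_schur]) turns it into the value of [Phi] at the product [h_I] of the [h_m] over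
    the block sizes ([prod_frob_perm_char]). Since the Kostka numbers at these block sizes count the
    standard tableaux with descents in [I] ([card_syt_Des_sub]), [prod_frob_blocks] gives (1) as
    soon as maximal chains are matched with faces of full rank set ([bp_max_chains_char]).

    For (2), exactness below the top dimension ([bp_exact]) makes the top homology character an
    alternating sum of the same characters over all [I \subset J] ([bp_homology_char]). Applying
    [prod_frob_blocks] to each term and inclusion-exclusion to the descent sets ([card_syt_Des_eq])
    leaves the tableaux with descent set exactly [J].

    Two blocks of algebra support this. On the symmetric function side, Schur polynomials and Kostka
    numbers are both weighted counts of chains of horizontal strips ([ssyt_strip_sum]), and [pieri]
    follows from the bijection [card_local_rule]. On the representation side, the
    column-antisymmetric functions on tabloids of shape [la] form a line ([antisym_polytabloid]), so
    equivariant kernels act on the Specht module by scalars ([kernel_eigen_exists]). This yields the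
    scalar products of [specht_char_facts], and these, together with [kostka_inverse] and the Gram
    matrix [perm_char_gram], determine the Specht character. *)

Lemma card_bij_in (X Y : finType) (A : {set X}) (B : {set Y})
    (f : X -> Y) (g : Y -> X) :
  (forall x, x \in A -> f x \in B /\ g (f x) = x) ->
  (forall y, y \in B -> g y \in A /\ f (g y) = y) -> #|A| = #|B|.
Proof.
move=> fP gP; rewrite -(card_in_imset (f := f)); last first.
  by move=> x y /fP[_ ex] /fP[_ ey] e; rewrite -ex -ey e.
apply: eq_card => y; apply/imsetP/idP => [[x /fP[fx _] ->] // | /gP[gy e]].
by exists (g y).
Qed.

Section HorizontalStrips.
Variable n : nat.

Definition rshape := {ffun 'I_n -> 'I_n.+1}.
Implicit Types p q la mu : rshape.

Definition row_len p (i : nat) : nat :=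
  oapp (fun j : 'I_n => p j : nat) 0%N (insub i).

Lemma row_lenE p (i : 'I_n) : row_len p i = p i.
Proof. by rewrite /row_len valK. Qed.

Lemma row_len_ge p i : (n <= i)%N -> row_len p i = 0%N.
Proof. by move=> le_ni; rewrite /row_len insubN // -leqNgt. Qed.

Lemma row_len_le p i : (row_len p i <= n)%N.
Proof. by rewrite /row_len; case: insub => //= j; rewrite -ltnS ltn_ord. Qed.

Lemma row_len_inj p q : (forall i, row_len p i = row_len q i) -> p = q.
Proof.
by move=> e; apply/ffunP=> i; apply: val_inj; rewrite /= -!row_lenE e.
Qed.

Definition area p : nat := (\sum_(i < n) p i)%N.

Lemma areaE p : area p = (\sum_(i < n) row_len p i)%N.
Proof. by apply: eq_bigr => i _; rewrite row_lenE. Qed.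

(** The skew shape [p / q] is a horizontal strip. The interlacing inequalities force both shapes to
    be weakly decreasing, hence to be partitions. *)
Definition hstrip q p : bool :=
  [forall i : 'I_n, (row_len p i.+1 <= q i <= p i)%N].

Lemma hstripP q p :
  reflect (forall i, row_len p i.+1 <= row_len q i <= row_len p i)%N
          (hstrip q p).
Proof.
apply: (iffP forallP) => [hs i|hs i]; last by rewrite -!row_lenE.
have [lt_in|le_ni] := ltnP i n; first by have := hs (Ordinal lt_in); rewrite
  -!row_lenE.
by rewrite !row_len_ge // leqW.
Qed.

Lemma hstrip_area q p : hstrip q p -> (area q <= area p)%N.
Proof.
by move=> /hstripP hs; rewrite !areaE; apply: leq_sum => i _; case/andP: (hs i).
Qed.

Lemma sum_shift (F : nat -> nat) k :
  (\sum_(i < k) F i.+1 + F 0 = \sum_(i < k) F i + F k)%N.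
Proof. by rewrite addnC -(big_ord_recl k (fun i => F i)) big_ord_recr. Qed.

(** * The local rule for squares of horizontal strips *)

Section LocalRule.
Variables (la mu : rshape) (s : nat).
Hypothesis le_sn : (s <= n)%N.

Let mx i := maxn (row_len la i) (row_len mu i).
Let mn i := minn (row_len la i) (row_len mu i).

Definition local_down (nu : rshape) : rshape :=
  [ffun i : 'I_n => inord (mx i.+1 + mn i - row_len nu i.+1)].
(** Row 0 of [nu] has no partner in [rho]; it receives the value that makes the total area equal to
    [s]. *)
Definition local_up (rho : rshape) : rshape :=
  [ffun i : 'I_n => inord (if nat_of_ord i is i'.+1 then mx i'.+1 + mn i' -
    row_len rho i'
                           else s + area rho - (area la + area mu) + mx 0)].

Lemma sum_minmax :
  (\sum_(i < n) mx i + \sum_(i < n) mn i = area la + area mu)%N.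
Proof.
rewrite !areaE -!big_split /=; apply: eq_bigr => i _.
by rewrite /mx /mn; lia.
Qed.

Lemma local_down_row nu i : hstrip la nu -> hstrip mu nu ->
  row_len (local_down nu) i = (mx i.+1 + mn i - row_len nu i.+1)%N.
Proof.
move=> /hstripP hl /hstripP hm.
have [lt_in|le_ni] := ltnP i n.
  rewrite -[i]/(nat_of_ord (Ordinal lt_in)) row_lenE ffunE inordK //=.
  have := hl i; have := hl i.+1; have := hm i; have := hm i.+1.
  have := row_len_le la i; rewrite /mx /mn; lia.
by rewrite /mx /mn !row_len_ge // leqW.
Qed.

(** Reflection would put [mn n.-1 - row_len rho n.-1] cells into a row of index [n], which a shape
    does not have; this says that there are none. Otherwise all [n] rows of [la] are nonempty, so
    [area la >= n >= s], while [rho] is strictly smaller than [mu], against the area condition. *)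
Lemma local_row_tight rho : hstrip rho la -> hstrip rho mu ->
  (area la + area mu <= s + area rho)%N -> (mn n.-1 <= row_len rho n.-1)%N.
Proof.
move=> /hstripP hl /hstripP hm le_s; rewrite leqNgt; apply/negP => lt_rho.
have n_gt0 : (0 < n)%N.
  by move: lt_rho; rewrite lt0n; apply: contraTneq => n0; rewrite /mn
    !row_len_ge ?n0.
have la_gt0 i : (i < n)%N -> (0 < row_len la i)%N.
  rewrite -{1}(prednK n_gt0) ltnS => le_i.
  have: (row_len la n.-1 <= row_len la i)%N.
    rewrite -(subnKC le_i); elim: (_ - _)%N => [|k IH]; first by rewrite addn0.
    by apply: leq_trans IH; rewrite addnS; have := hl (i + k)%N; lia.
  by apply: leq_trans; move: lt_rho; rewrite /mn; lia.
have le_n : (n <= area la)%N.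
  rewrite -{1}[n]card_ord -sum1_card areaE; apply: leq_sum => i _; exact:
    la_gt0.
have: (area rho < area mu)%N.
  have lt_n : (n.-1 < n)%N by rewrite prednK.
  rewrite !areaE (bigD1 (Ordinal lt_n)) //= [X in (_ < X)%N](bigD1 (Ordinal
    lt_n)) //=.
  rewrite -addSn leq_add //; first by move: lt_rho; rewrite /mn; lia.
  by apply: leq_sum => i _; case/andP: (hm i).
lia.
Qed.

Lemma local_up_row0 rho : (0 < n)%N ->
  (s + area rho - (area la + area mu) + mx 0 <= n)%N ->
  row_len (local_up rho) 0 = (s + area rho - (area la + area mu) + mx 0)%N.
Proof.
by move=> n_gt0 le_n; rewrite -[0%N]/(nat_of_ord (Ordinal n_gt0)) row_lenE
  ffunE inordK.
Qed.

Lemma local_up_rowS rho i : hstrip rho la -> hstrip rho mu ->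
  (area la + area mu <= s + area rho)%N ->
  row_len (local_up rho) i.+1 = (mx i.+1 + mn i - row_len rho i)%N.
Proof.
move=> hl hm le_s; have tight := local_row_tight hl hm le_s.
move/hstripP in hl; move/hstripP in hm.
have [lt_in|le_ni] := ltnP i.+1 n.
  rewrite -[i.+1]/(nat_of_ord (Ordinal lt_in)) row_lenE ffunE inordK //=.
  have := hl i; have := hl i.+1; have := hm i; have := hm i.+1.
  have := row_len_le la i; rewrite /mx /mn; lia.
rewrite row_len_ge //; have [lt_in|le_ni'] := ltnP i n.
  have ei : i = n.-1 by lia.
  by move: tight; rewrite -ei /mx /mn !(row_len_ge _ le_ni); lia.
by rewrite /mx /mn !row_len_ge.
Qed.

(** The reflection preserves [mx i.+1 + mn i] row by row. After summation, the excess of row 0 of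
    [nu] over [mx 0] is what remains of the area, which is why the local rule carries an inequality
    between areas. *)
Lemma local_down_area nu : hstrip la nu -> hstrip mu nu ->
  (area (local_down nu) + area nu + mx 0 = area la + area mu + row_len nu 0)%N.
Proof.
move=> hl hm; have E : (area (local_down nu) + \sum_(i < n) row_len nu i.+1 =
    \sum_(i < n) mx i.+1 + \sum_(i < n) mn i)%N.
  rewrite [area (local_down _)]areaE -!big_split; apply: eq_bigr => i _ /=.
  rewrite local_down_row //; move/hstripP in hl; move/hstripP in hm.
  have := hl i; have := hl i.+1; have := hm i; have := hm i.+1.
  rewrite /mx /mn; lia.
have := sum_minmax; have := sum_shift (row_len nu) n; have := sum_shift mx n.
have mxn : mx n = 0%N by rewrite /mx !row_len_ge.
rewrite mxn (row_len_ge nu (leqnn n)) -areaE; lia.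
Qed.

Lemma local_up_sum rho : hstrip rho la -> hstrip rho mu ->
  (area la + area mu <= s + area rho)%N ->
  (\sum_(i < n) row_len (local_up rho) i.+1 + area rho + mx 0 =
     area la + area mu)%N.
Proof.
move=> hl hm le_s; have E : (\sum_(i < n) row_len (local_up rho) i.+1 + area
  rho =
    \sum_(i < n) mx i.+1 + \sum_(i < n) mn i)%N.
  rewrite [area rho]areaE -!big_split; apply: eq_bigr => i _ /=.
  rewrite local_up_rowS //; move/hstripP in hl; move/hstripP in hm.
  have := hl i; have := hl i.+1; have := hm i; have := hm i.+1.
  rewrite /mx /mn; lia.
have := sum_minmax; have := sum_shift mx n.
have -> : mx n = 0%N by rewrite /mx !row_len_ge.
lia.
Qed.

(* The map nu |-> rho reflects nu_(i+1) and rho_i into each other in their     *)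
(* common range [max(la_(i+1), mu_(i+1)), min(la_i, mu_i)].                   *)
Lemma card_local_rule :
  #|[set nu | [&& hstrip la nu, hstrip mu nu & area nu == s]]| =
  #|[set rho | [&& hstrip rho la, hstrip rho mu &
                   area la + area mu <= s + area rho]%N]|.
Proof.
have [n0|n_gt0] := posnP n.
  have triv : all_equal_to ([ffun=> ord0] : rshape).
    by move=> p; apply: row_len_inj => i; rewrite !row_len_ge ?n0.
  have hs0 : hstrip [ffun=> ord0] [ffun=> ord0] by apply/hstripP => i; rewrite
    !row_len_ge ?n0.
  have a0 p : area p = 0%N by rewrite areaE big1 // => i _; have := ltn_ord i;
    lia.
  have s0 : s = 0%N by lia.
  by apply: eq_card => p; rewrite !inE !triv hs0 !a0 s0.
apply: (card_bij_in (f := local_down) (g := local_up)) => [nu|rho]; rewrite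
  !inE.
  case/and3P=> hl hm /eqP es; have := local_down_area hl hm; rewrite es => E.
  have hl' := hl; have hm' := hm; move/hstripP in hl'; move/hstripP in hm'.
  have hd1 : hstrip (local_down nu) la.
    apply/hstripP => i; rewrite local_down_row //.
    have := hl' i; have := hl' i.+1; have := hm' i; have := hm' i.+1.
    rewrite /mx /mn; lia.
  have hd2 : hstrip (local_down nu) mu.
    apply/hstripP => i; rewrite local_down_row //.
    have := hl' i; have := hl' i.+1; have := hm' i; have := hm' i.+1.
    rewrite /mx /mn; lia.
  have le_s : (area la + area mu <= s + area (local_down nu))%N.
    by have := hl' 0%N; have := hm' 0%N; move: E; rewrite /mx; lia.
  split; first by rewrite hd1 hd2.
  apply: row_len_inj => -[|i].
    by rewrite local_up_row0 //; have := row_len_le nu 0; lia.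
  rewrite local_up_rowS // local_down_row //.
  have := hl' i; have := hl' i.+1; have := hm' i; have := hm' i.+1.
  rewrite /mx /mn; lia.
case/and3P=> hl hm le_s; have E := local_up_sum hl hm le_s.
have hl' := hl; have hm' := hm; move/hstripP in hl'; move/hstripP in hm'.
have E0 : row_len (local_up rho) 0 = (s + area rho - (area la + area mu) + mx
  0)%N.
  by rewrite local_up_row0 //; lia.
have eA : area (local_up rho) = s.
  by have := sum_shift (row_len (local_up rho)) n; rewrite -areaE (row_len_ge _
    (leqnn n)); lia.
have hu1 : hstrip la (local_up rho).
  apply/hstripP => -[|i]; rewrite ?E0 !local_up_rowS //.
    by have := hl' 0%N; have := hm' 0%N; have := hl' 1%N; have := hm' 1%N;
      rewrite /mx /mn; lia.
  have := hl' i; have := hl' i.+1; have := hm' i; have := hm' i.+1.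
  rewrite /mx /mn; lia.
have hu2 : hstrip mu (local_up rho).
  apply/hstripP => -[|i]; rewrite ?E0 !local_up_rowS //.
    by have := hl' 0%N; have := hm' 0%N; have := hl' 1%N; have := hm' 1%N;
      rewrite /mx /mn; lia.
  have := hl' i; have := hl' i.+1; have := hm' i; have := hm' i.+1.
  rewrite /mx /mn; lia.
split; first by rewrite hu1 hu2 eA eqxx.
apply: row_len_inj => i; rewrite local_down_row // local_up_rowS //.
have := hl' i; have := hl' i.+1; have := hm' i; have := hm' i.+1.
rewrite /mx /mn; lia.
Qed.

End LocalRule.
End HorizontalStrips.

(** * Pieri's rule and products of complete symmetric functions *)

Section StripSums.
Variables (n : nat) (R : comNzRingType).
Implicit Types p q la mu nu rho : rshape n.

(** Weighted count of chains of horizontal strips from the empty shape to [p]. Powers of variables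
    as weights give Schur polynomials ([schur_sum]), indicators of prescribed step sizes give Kostka
    numbers ([kostka_sum]). *)
Fixpoint strip_sum (w : nat -> nat -> R) (k : nat) p : R :=
  if k is k'.+1 then
    \sum_(q | hstrip q p) strip_sum w k' q * w k' (area p - area q)%N
  else (p == [ffun=> ord0])%:R.

Lemma area0 : area [ffun=> ord0 : 'I_n.+1] = 0%N.
Proof. by rewrite /area big1 // => i _; rewrite ffunE. Qed.

Lemma area_eq0 p : (area p == 0%N) = (p == [ffun=> ord0]).
Proof.
apply/idP/eqP => [|->]; last by rewrite area0.
rewrite sum_nat_eq0 => /forallP p0; apply/ffunP => i; apply: val_inj.
by rewrite ffunE; apply/eqP; apply: (implyP (p0 i)).
Qed.

Section Pieri.
Variable x : nat -> R.

(* The generating series of the h_m, truncated; only meaningful for m <= n.   *)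
Definition hsum (N m : nat) : R :=
  (\prod_(i < N) \poly_(j < n.+1) (x i ^+ j))`_m.

Lemma hsum0 m : hsum 0 m = (m == 0%N)%:R.
Proof. by rewrite /hsum big_ord0 coef1. Qed.

Lemma hsumS N m : (m <= n)%N ->
  hsum N.+1 m = \sum_(k < m.+1) hsum N (m - k) * x N ^+ k.
Proof.
move=> le_mn; rewrite /hsum big_ord_recr coefMr /=; apply: eq_bigr => k _.
by rewrite coef_poly (leq_trans (ltn_ord k)).
Qed.

Definition schur_sum N p := strip_sum (fun k m => x k ^+ m) N p.

(** Induction on the number of variables. The last variable removes a strip from [la] down to [rho],
    and the induction hypothesis adds a strip from [rho] up to [mu]. By [card_local_rule] the common
    lower corners [rho] of [la] and [mu] are as many as the common upper corners [nu]. The bound by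
    [n] gives [nu] enough rows. *)
Lemma pieri N la m : (area la + m <= n)%N ->
  schur_sum N la * hsum N m =
  \sum_(nu | hstrip la nu && (area nu == area la + m)%N) schur_sum N nu.
Proof.
rewrite /schur_sum; elim: N la m => [|N IH] la m le_n.
  rewrite hsum0 /=; transitivity ((hstrip la [ffun=> ord0] && (area (n := n)
    [ffun=> ord0] == area la + m)%N)%:R : R).
    rewrite area0 [0%N == _]eq_sym addn_eq0 area_eq0 -natrM mulnb [in
      RHS]andb_idl //.
    case/andP=> /eqP -> _; apply/hstripP => i.
    by rewrite /row_len; case: insub => [?|]; case: insub => [?|] //=; rewrite
      !ffunE.
  rewrite big_mkcond (bigD1 [ffun=> ord0]) //= big1 ?addr0.
    by rewrite eqxx; case: ifP.
  by move=> nu /negbTE ->; case: ifP.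
set s := (area la + m)%N.
(* The total power of the last variable is [s - area mu] for every [rho]; the inequality says that
   the strip from [rho] to [mu] has at most [m] cells. *)
transitivity (\sum_(rho | hstrip rho la)
  \sum_(mu | hstrip rho mu && (area la + area mu <= s + area rho)%N)
     strip_sum (fun k m => x k ^+ m) N mu * x N ^+ (s - area mu)).
  have le_mn : (m <= n)%N by lia.
  rewrite hsumS //= mulr_suml; apply: eq_bigr => rho hr.
  have le_rho := hstrip_area hr.
  rewrite mulr_sumr.
  transitivity (\sum_(k < m.+1) \sum_(mu | hstrip rho mu && (area mu == area
    rho + (m - k))%N)
     strip_sum (fun k m => x k ^+ m) N mu * x N ^+ (s - area mu)).
    apply: eq_bigr => k _; rewrite mulrACA IH; last by lia.
    rewrite -exprD mulr_suml; apply: eq_bigr => mu /andP[_ /eqP emu].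
    by congr (_ * _ ^+ _); have := ltn_ord k; lia.
  rewrite (exchange_big_dep (fun mu => hstrip rho mu && (area la + area mu <= s
    + area rho)%N)) /=; last first.
    by move=> k mu _ /andP[-> /eqP e]; have := ltn_ord k; rewrite /s; lia.
  apply: eq_bigr => mu /andP[hm le_mu]; have le_rm := hstrip_area hm.
  rewrite (big_pred1 (inord (m + area rho - area mu))) // => k; rewrite hm /=.
  rewrite -val_eqE /= inordK; last by lia.
  by apply/eqP/eqP => e; have := ltn_ord k; lia.
transitivity (\sum_mu \sum_(nu | [&& hstrip la nu, hstrip mu nu & area nu == s])
    strip_sum (fun k m => x k ^+ m) N mu * x N ^+ (s - area mu)).
  rewrite [LHS](exchange_big_dep xpredT) //=.
  apply: eq_bigr => mu _.
  have C := @card_local_rule n la mu s le_n.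
  have -> : \sum_(nu | [&& hstrip la nu, hstrip mu nu & area nu == s])
      strip_sum (fun k m => x k ^+ m) N mu * x N ^+ (s - area mu) =
      (strip_sum (fun k m => x k ^+ m) N mu * x N ^+ (s - area mu)) *+
      #|[set nu | [&& hstrip la nu, hstrip mu nu & area nu == s]]|.
    by rewrite -sumr_const; apply: eq_bigl => nu; rewrite inE.
  by rewrite C -sumr_const; apply: eq_bigl => rho; rewrite !inE.
rewrite /= [RHS](exchange_big_dep xpredT) //=; apply: eq_bigr => mu _.
rewrite big_mkcond [RHS]big_mkcond /=; apply: eq_bigr => nu _.
by rewrite andbA [_ && (_ == s)]andbAC; case: ifP => // /andP[/andP[_ /eqP ->]].
Qed.

Section HProduct.
Variable c : nat -> nat.

Definition kostka_sum k p : R := strip_sum (fun i m => (m == c i)%:R) k p.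

Lemma kostka_sum_area k p :
  kostka_sum k p != 0 -> area p = (\sum_(i < k) c i)%N.
Proof.
rewrite /kostka_sum; elim: k p => [|k IH] p /=.
  by rewrite big_ord0; case: (p =P _) => [->|]; rewrite ?area0 ?eqxx.
move=> /eqP nz; apply/eqP/negPn/negP => ne; apply: nz; apply: big1 => q hq.
have [->|/IH e] := eqVneq (strip_sum (fun i m => (m == c i)%:R) k q) 0; first
  by rewrite mul0r.
case: eqP => [e'|]; last by rewrite mulr0.
by case/eqP: ne; rewrite big_ord_recr /= -e -e' subnKC // hstrip_area.
Qed.

(** Iterated Pieri: the strips added by the successive factors form the chains that [kostka_sum]
    counts. *)
Lemma hsum_prod N k : (\sum_(i < k) c i <= n)%N ->
  \prod_(i < k) hsum N (c i) = \sum_p kostka_sum k p * schur_sum N p.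
Proof.
elim: k => [|k IH] le_n.
  rewrite big_ord0 (bigD1 [ffun=> ord0]) //= [X in _ + X]big1 ?addr0; last
    first.
    by move=> p /negbTE ne; rewrite /kostka_sum /= ne mul0r.
  rewrite /kostka_sum /= eqxx mul1r /schur_sum; elim: N => [|N IH] /=; first by
    rewrite eqxx.
  rewrite (big_pred1 [ffun=> ord0]) => [|q]; first by rewrite -IH subnn mulr1.
  apply/idP/eqP => [/hstrip_area|->].
    by rewrite area0 leqn0 area_eq0 => /eqP.
  apply/hstripP => i.
  by rewrite /row_len; case: insub => [?|]; case: insub => [?|] //=; rewrite
    !ffunE.
rewrite big_ord_recr /= in le_n.
rewrite big_ord_recr IH /=; last by lia.
transitivity (\sum_q \sum_(nu | hstrip q nu && (area nu == area q + c k)%N)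
    kostka_sum k q * schur_sum N nu).
  rewrite mulr_suml; apply: eq_bigr => q _; rewrite -mulrA.
  have [->|/kostka_sum_area e] := eqVneq (kostka_sum k q) 0.
    by rewrite mul0r big1 // => nu _; rewrite mul0r.
  by rewrite pieri ?e // mulr_sumr.
rewrite [LHS](exchange_big_dep xpredT) //=; apply: eq_bigr => nu _.
rewrite /kostka_sum /= mulr_suml big_mkcondr; apply: eq_bigr => q hq /=.
have -> : (area nu == area q + c k)%N = (area nu - area q == c k)%N.
  by have := hstrip_area hq => le; apply/eqP/eqP; lia.
by case: eqP => _; rewrite ?mulr1 // mulr0 mul0r.
Qed.

End HProduct.
End Pieri.
End StripSums.

(** * Semistandard tableaux as chains of horizontal strips *)

Lemma card_ord_lt n m : (m <= n)%N -> #|[set j : 'I_n | (j < m)%N]| = m.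
Proof.
move=> le_mn; have inj_w : injective (widen_ord le_mn).
  by move=> a b /(congr1 val) /= /val_inj.
rewrite -[RHS]card_ord -cardsT -(card_imset _ inj_w).
apply: eq_card => j; rewrite inE; apply/idP/imsetP => [lt_jm|[i _ ->]]; last by
  case: i.
by exists (Ordinal lt_jm) => //; apply: val_inj.
Qed.

Lemma leq_ord_lt n a b : (a <= n)%N ->
  (forall j : 'I_n, (j < a)%N -> (j < b)%N) -> (a <= b)%N.
Proof.
move=> le_an lt_ab; case: a le_an lt_ab => // a lt_an lt_ab.
exact: (lt_ab (Ordinal lt_an)).
Qed.

Lemma down_set_lt n (D : {set 'I_n}) :
  (forall j j' : 'I_n, (j' <= j)%N -> j \in D -> j' \in D) ->
  forall j, (j \in D) = (j < #|D|)%N.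
Proof.
move=> down j; have le_n : (#|D| <= n)%N by rewrite -[X in (_ <= X)%N]card_ord
  max_card.
apply/idP/idP => [jD|].
  have lt_jn := ltn_ord j; rewrite -[j.+1](card_ord_lt lt_jn); apply:
    subset_leq_card.
  by apply/subsetP => i; rewrite inE ltnS => le_ij; apply: down jD.
apply: contraTT => jD; rewrite -leqNgt -[leqRHS](card_ord_lt (ltnW (ltn_ord
  j))).
apply: subset_leq_card; apply/subsetP => i iD; rewrite inE ltnNge.
by apply: contra jD => le_ji; apply: down iD.
Qed.

Section GridTableaux.
Variables (n N : nat) (R : comNzRingType) (w : nat -> nat -> R).
Implicit Types p q : rshape n.

(* Tableaux as fillings of the whole n x n grid, the value N standing for      *)
(* infinity, i.e., for an empty cell.                                         *)
Local Notation grid := {ffun 'I_n * 'I_n -> 'I_N.+1}.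
Implicit Type T : grid.

Definition grid_ssyt k T : bool :=
  [&& [forall c : 'I_n * 'I_n, (T c < k)%N || (T c == N :> nat)],
      [forall i : 'I_n, forall j : 'I_n, forall j' : 'I_n, (j <= j')%N ==> (T
        (i, j) <= T (i, j'))%N] &
      [forall i : 'I_n, forall i' : 'I_n, forall j : 'I_n, (i < i')%N ==>
         ((T (i, j) < T (i', j))%N || (T (i', j) == N :> nat))]].

Lemma grid_ssytP k T :
  reflect [/\ forall c : 'I_n * 'I_n, (T c < k)%N \/ T c = N :> nat,
              forall i j j' : 'I_n, (j <= j')%N -> (T (i, j) <= T (i, j'))%N &
              forall i i' j : 'I_n, (i < i')%N ->
                (T (i, j) < T (i', j))%N \/ T (i', j) = N :> nat]
          (grid_ssyt k T).
Proof.
apply: (iffP and3P) => [[/forallP h1 /forallP h2 /forallP h3]|[h1 h2 h3]];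
  split.
- by move=> c; case/orP: (h1 c) => [|/eqP]; [left|right].
- by move=> i j j' le; move/forallP: (h2 i) => /(_ j)/forallP/(_ j')/implyP->.
- move=> i i' j lt; move/forallP: (h3 i) => /(_ i')/forallP/(_ j)/implyP/(_ lt).
  by case/orP=> [|/eqP]; [left|right].
- by apply/forallP => c; case: (h1 c) => [->|->] //; rewrite eqxx orbT.
- by apply/forallP => i; apply/forallP => j; apply/forallP => j';
    apply/implyP/h2.
- apply/forallP => i; apply/forallP => i'; apply/forallP => j; apply/implyP =>
    lt.
  by case: (h3 i i' j lt) => [->|->] //; rewrite eqxx orbT.
Qed.

Definition has_shape p T : bool := [forall c : 'I_n * 'I_n, (T c < N)%N == (c.2
  < p c.1)%N].

Lemma has_shapeP p T :
  reflect (forall c : 'I_n * 'I_n, (T c < N)%N = (c.2 < p c.1)%N) (has_shape p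
    T).
Proof. exact: 'forall_eqP. Qed.

Definition sub_shape k T : rshape n :=
  [ffun i => inord #|[set j | (T (i, j) < k)%N]|].

Lemma sub_shape_lt k l T : grid_ssyt l T ->
  forall c : 'I_n * 'I_n, (c.2 < sub_shape k T c.1)%N = (T c < k)%N.
Proof.
move=> /grid_ssytP[_ rowT _] [i j]; rewrite ffunE inordK /=; last first.
  by rewrite ltnS -[leqRHS]card_ord max_card.
rewrite -down_set_lt ?inE // => j1 j2 le12; rewrite !inE.
exact/leq_ltn_trans/rowT.
Qed.

Lemma rshape_eq_lt p q :
  (forall c : 'I_n * 'I_n, (c.2 < p c.1)%N = (c.2 < q c.1)%N) -> p = q.
Proof.
move=> e; apply/ffunP => i; apply/val_inj/eqP; rewrite /= eqn_leq.
by apply/andP; split; apply: (@leq_ord_lt n) => [|j]; rewrite ?leq_ord //;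
   have := e (i, j) => /= ->.
Qed.

Definition grid_trunc k T : grid :=
  [ffun c => if (T c < k)%N then T c else ord_max].
Definition grid_extend k p T : grid :=
  [ffun c => if (T c < N)%N then T c
             else if (c.2 < p c.1)%N then inord k else ord_max].

Lemma hstrip_noninc q p i j : hstrip q p -> (i <= j)%N ->
  (row_len p j <= row_len p i)%N.
Proof.
move=> /hstripP hs /subnKC <-; elim: (_ - _)%N => [|k IH]; first by rewrite
  addn0.
by rewrite addnS; have := hs (i + k)%N; lia.
Qed.

(** The cell just above a cell of [p] holds a strictly smaller entry, hence one below [k]; so the
    cells with entry [k] contain no two in a column. *)
Lemma sub_shape_hstrip k p T : (k < N)%N -> grid_ssyt k.+1 T -> has_shape p T ->
  hstrip (sub_shape k T) p.
Proof.
move=> lt_kN sT /has_shapeP shT; have subT := sub_shape_lt k sT.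
case/grid_ssytP: sT => valT rowT colT; apply/forallP => i; apply/andP; split.
  apply: (@leq_ord_lt n) => [|j]; first exact: row_len_le.
  have [lt_i|le_i] := ltnP i.+1 n; last by rewrite row_len_ge.
  rewrite -[i.+1]/(nat_of_ord (Ordinal lt_i)) row_lenE.
  have := shT (Ordinal lt_i, j) => /= <-; have := subT (i, j) => /= -> lt_N.
  case: (colT i (Ordinal lt_i) j) => // [lt_T|eT]; last by rewrite eT ltnn in
    lt_N.
  case: (valT (Ordinal lt_i, j)) => [|eT]; last by rewrite eT ltnn in lt_N.
  by rewrite ltnS; apply: leq_trans.
apply: (@leq_ord_lt n) => [|j]; first by rewrite -ltnS.
by have := subT (i, j) => /= ->; have := shT (i, j) => /= <-; lia.
Qed.

Section Extend.
Variables (k : nat) (p q : rshape n).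
Hypotheses (lt_kN : (k < N)%N) (hqp : hstrip q p).

Lemma grid_extendP T : grid_ssyt k T -> has_shape q T ->
  [/\ grid_ssyt k.+1 (grid_extend k p T), has_shape p (grid_extend k p T),
      sub_shape k (grid_extend k p T) = q &
      grid_trunc k (grid_extend k p T) = T].
Proof.
move=> /grid_ssytP[valT rowT colT] /has_shapeP shT.
have le_qp i : (q i <= p i)%N by have /forallP/(_ i)/andP[] := hqp.
have kE : (inord k : 'I_N.+1) = k :> nat by rewrite inordK //; lia.
have extE (c : 'I_n * 'I_n) : grid_extend k p T c =
    (if (c.2 < q c.1)%N then nat_of_ord (T c) else if (c.2 < p c.1)%N then k
      else N) :> nat.
  by rewrite ffunE shT; case: ifP => // _; case: ifP.
have lt_k (c : 'I_n * 'I_n) : (c.2 < q c.1)%N -> (T c < k)%N.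
  by rewrite -shT; case: (valT c) => [//|->]; rewrite ltnn.
have sext : grid_ssyt k.+1 (grid_extend k p T).
  apply/grid_ssytP; split.
  - move=> c; rewrite extE; case: ifP => [/lt_k|_]; first by left; lia.
    by case: ifP; [left|right].
  - move=> i j j' le_j; rewrite !extE /=.
    case: (ltnP j (q i)) => lt_j; case: (ltnP j' (q i)) => lt_j'.
    + exact: rowT.
    + by have := lt_k (i, j) lt_j; case: ifP => *; lia.
    + by move: (leq_ltn_trans le_j lt_j'); rewrite ltnNge lt_j.
    + by case: (ltnP j (p i)); case: (ltnP j' (p i)) => *; lia.
  - move=> i i' j lt_i; rewrite !extE /=.
    have le_p : (p i' <= q i)%N.
      rewrite -!row_lenE (leq_trans (hstrip_noninc hqp lt_i)) //.
      by move/hstripP: hqp => /(_ i)/andP[].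
    have le_q := le_qp i'.
    case: (ltnP j (q i)) => lt_j; case: (ltnP j (q i')) => lt_j'.
    + case: (colT i i' j lt_i) => [|e]; [by left | right => //].
    + case: ifP => lt_p'; [left|by right]. exact: lt_k.
    + lia.
    + by case: (ltnP j (p i')) => lt_p'; [lia | right].
have shext : has_shape p (grid_extend k p T).
  apply/has_shapeP => c; rewrite extE; have := le_qp c.1.
  by case: ifP => [lt_q|_]; [have := lt_k c lt_q; lia | case: ifP; lia].
split=> //; last first.
  apply/ffunP => c; rewrite ffunE; apply: val_inj; rewrite (fun_if val) /=
    !extE.
  case: ifP => [lt|ge]; last first.
    have: ~~ (c.2 < q c.1)%N by apply/negP => h; move: ge; rewrite h lt_k.
    by move/negPf; rewrite -shT; case: (valT c) => [|->] //; lia.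
  by move: lt; case: ifP => // _; case: ifP; lia.
apply: rshape_eq_lt => c; rewrite (sub_shape_lt _ sext) extE.
by case: ifP => [/lt_k|] //; case: ifP; lia.
Qed.

Lemma grid_truncP T : grid_ssyt k.+1 T -> has_shape p T -> sub_shape k T = q ->
  [/\ grid_ssyt k (grid_trunc k T), has_shape q (grid_trunc k T) &
      grid_extend k p (grid_trunc k T) = T].
Proof.
move=> sT /has_shapeP shT eq; have subT := sub_shape_lt k sT; rewrite eq in
  subT.
case/grid_ssytP: sT => valT rowT colT.
have truncE (c : 'I_n * 'I_n) : grid_trunc k T c = (if (T c < k)%N then
  nat_of_ord (T c) else N) :> nat.
  by rewrite ffunE; case: ifP.
have kE : (inord k : 'I_N.+1) = k :> nat by rewrite inordK //; lia.
split.
- apply/grid_ssytP; split.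
  + by move=> c; rewrite truncE; case: ifP; [left|right].
  + move=> i j j' /(rowT i); rewrite !truncE; case: ifP; case: ifP; lia.
  + move=> i i' j /(colT _ _ j); rewrite !truncE.
    by case: ifP; case: ifP => // *; first [lia | by right].
- by apply/has_shapeP => c; rewrite truncE subT; case: ifP; lia.
- apply/ffunP => c; apply: val_inj; rewrite ffunE /= truncE.
  case: ifP => lt1; first by rewrite truncE; move: lt1; case: ifP; lia.
  have ge_T : (k <= T c)%N by move: lt1; case: (ltnP (T c) k) => //; have :=
    ltn_ord (T c); lia.
  rewrite -shT; case: (valT c) => eT; last by rewrite eT ltnn.
  by case: ifP => /=; rewrite ?kE; lia.
Qed.

Lemma card_rshape p' : #|[set c : 'I_n * 'I_n | (c.2 < (p' : rshape n) c.1)%N]|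
  = area p'.
Proof.
rewrite /area -sum1_card big_mkcond /=.
transitivity (\sum_(i < n) \sum_(j < n) (if (j < p' i)%N then 1 else 0))%N.
  by rewrite pair_big; apply: eq_bigr => c _; rewrite inE.
apply: eq_bigr => i _; rewrite -big_mkcond sum1dep_card card_ord_lt //.
by rewrite -ltnS.
Qed.

Lemma card_grid_extend T i : (i <= k)%N -> grid_ssyt k T -> has_shape q T ->
  #|[set c | grid_extend k p T c == i :> nat]| =
  if (i < k)%N then #|[set c | T c == i :> nat]| else (area p - area q)%N.
Proof.
move=> le_ik /grid_ssytP[valT _ _] /has_shapeP shT.
have kE : (inord k : 'I_N.+1) = k :> nat by rewrite inordK //; lia.
case: ifP => lt_i.
  apply: eq_card => c; rewrite !inE ffunE; case: ifP => // ge_T.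
  by case: ifP; rewrite /= ?kE; have := ltn_ord (T c); lia.
have -> : i = k by lia.
have sub_qp : [set c : 'I_n * 'I_n | (c.2 < q c.1)%N] \subset [set c : 'I_n *
  'I_n | (c.2 < p c.1)%N].
  apply/subsetP => c; rewrite !inE => /leq_trans; apply.
  by have /forallP/(_ c.1)/andP[] := hqp.
rewrite -!card_rshape -(setIidPr sub_qp) -cardsD.
apply: eq_card => c; rewrite !inE ffunE shT; case: ifP => lt_q /=.
  by have := shT c; case: (valT c); lia.
by case: ifP; rewrite /= ?kE; lia.
Qed.

End Extend.

(** Deleting the largest entry [k] leaves a tableau of shape [sub_shape k T], and [grid_extend] puts
    it back. The number of deleted cells is the difference of areas, so the recursion is that of
    [strip_sum]. *)
Lemma grid_ssyt_sum k p : (k <= N)%N ->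
  \sum_(T | grid_ssyt k T && has_shape p T)
     \prod_(i < k) w i #|[set c | T c == i :> nat]| = strip_sum w k p.
Proof.
elim: k p => [|k IH] p le_kN /=.
  under eq_bigr => T _ do rewrite big_ord0.
  transitivity (\sum_(T : grid | (T == [ffun=> ord_max]) && (p == [ffun=>
    ord0])) (1 : R)).
    apply: eq_bigl => T; apply/idP/idP.
      case/andP=> /grid_ssytP[valT _ _] /has_shapeP shT; apply/andP; split.
        by apply/eqP/ffunP=> c; apply: val_inj; rewrite ffunE /=; case: (valT
          c).
      apply/eqP; apply: rshape_eq_lt => c; rewrite -shT ffunE ltn0.
      by case: (valT c) => [|->] //; lia.
    case/andP=> /eqP-> /eqP ->; apply/andP; split.
      by apply/grid_ssytP; split=> *; rewrite !ffunE; [right | | right].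
    by apply/has_shapeP => c; rewrite !ffunE ltnn.
  by rewrite big_andbC; case: (p =P _) => _; rewrite ?big_pred1_eq
    ?big_pred0_eq.
rewrite (partition_big (sub_shape k) (fun q => hstrip q p)) /=; last first.
  by move=> T /andP[]; apply: sub_shape_hstrip.
apply: eq_bigr => q hqp; rewrite -(IH _ (ltnW le_kN)) mulr_suml.
rewrite (reindex_onto (grid_extend k p) (grid_trunc k)) /=; last first.
  by move=> T /andP[/andP[sT shT] /eqP eq]; case: (grid_truncP le_kN hqp sT shT
    eq).
apply: eq_big => [T|T].
  apply/idP/idP => [/andP[/andP[/andP[sT shT] /eqP eq] /eqP <-]|/andP[sT shT]].
    by case: (grid_truncP le_kN hqp sT shT eq) => -> ->.
  by case: (grid_extendP le_kN hqp sT shT) => -> -> -> ->; rewrite !eqxx.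
case/andP=> /andP[/andP[sT shT] /eqP eq] /eqP eT.
have [sT' shT' _] := grid_truncP le_kN hqp sT shT eq; rewrite eT in sT' shT'.
rewrite big_ord_recr /= (card_grid_extend le_kN hqp (leqnn k) sT' shT') ltnn.
congr (_ * _); apply: eq_bigr => i _.
by rewrite (card_grid_extend le_kN hqp (ltnW (ltn_ord i)) sT' shT') ltn_ord.
Qed.

Variable la : intpart n.

Definition grid_of (T : {ffun cell la -> 'I_N}) : grid :=
  [ffun c => oapp (fun c' : cell la => widen_ord (leqnSn N) (T c')) ord_max
    (insub c)].

Lemma grid_of_val (T : {ffun cell la -> 'I_N}) (c : cell la) : grid_of T (val
  c) = T c :> nat.
Proof. by rewrite ffunE valK. Qed.

Lemma grid_of_out (T : {ffun cell la -> 'I_N}) (c : 'I_n * 'I_n) : ~~ (c.2 < la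
  c.1)%N -> grid_of T c = N :> nat.
Proof. by move=> out; rewrite ffunE insubN. Qed.

Lemma grid_of_inj : injective grid_of.
Proof.
move=> T1 T2 e; apply/ffunP => c; apply: val_inj.
by rewrite /= -!grid_of_val e.
Qed.

Lemma part_noninc (i j : 'I_n) : (i <= j)%N -> (la j <= la i)%N.
Proof.
case: la => p /= /andP[/forallP/(_ i)/forallP/(_ j)/implyP h _]; exact: h.
Qed.

Lemma grid_ofP (T : {ffun cell la -> 'I_N}) :
  is_ssyt T = grid_ssyt N (grid_of T) && has_shape (part la) (grid_of T).
Proof.
have shT : has_shape (part la) (grid_of T).
  apply/has_shapeP => c; case: (boolP (c.2 < la c.1)%N) => [h|h].
    by have := grid_of_val T (exist _ c h) => /= ->; rewrite ltn_ord.
  by rewrite grid_of_out // ltnn.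
rewrite shT andbT; apply/idP/grid_ssytP.
  case/andP=> /forallP rowT /forallP colT; split.
  - move=> c; case: (boolP (c.2 < la c.1)%N) => h; [left|right].
      by have := grid_of_val T (exist _ c h) => /= ->.
    by rewrite grid_of_out.
  - move=> i j j'; rewrite leq_eqVlt => /orP[/eqP/val_inj-> //|lt_j].
    case: (boolP (j' < la i)%N) => h'; last first.
      by rewrite (grid_of_out T (c := (i, j')) h') -ltnS.
    have h : (j < la i)%N by lia.
    have := grid_of_val T (exist _ (i, j) h) => /= ->.
    have := grid_of_val T (exist _ (i, j') h') => /= ->.
    by move/forallP: (rowT (exist _ (i, j) h)) => /(_ (exist _ (i, j')
      h'))/implyP; apply; rewrite /row_of /col_of /= eqxx.
  - move=> i i' j lt_i; case: (boolP (j < la i')%N) => h'; [left | right]; last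
      first.
      by rewrite grid_of_out.
    have h : (j < la i)%N by have := part_noninc (ltnW lt_i); lia.
    have := grid_of_val T (exist _ (i, j) h) => /= ->.
    have := grid_of_val T (exist _ (i', j) h') => /= ->.
    by move/forallP: (colT (exist _ (i, j) h)) => /(_ (exist _ (i', j)
      h'))/implyP; apply; rewrite /row_of /col_of /= eqxx.
case=> _ rowT colT; apply/andP; split; apply/forallP => c; apply/forallP => c';
  apply/implyP => /andP[/eqP e lt].
  rewrite -!grid_of_val; move: e lt; rewrite /row_of /col_of.
  by case: (val c) (val c') => [i j] [i' j'] /= <- /ltnW; apply: rowT.
have ltN : (grid_of T (val c') < N)%N by rewrite grid_of_val.
rewrite -!grid_of_val; move: e lt ltN; rewrite /row_of /col_of.
case: (val c) (val c') => [i j] [i' j'] /= <- /colT-/(_ j)[] // ->.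
by rewrite ltnn.
Qed.

Lemma ssyt_strip_sum :
  \sum_(T : {ffun cell la -> 'I_N} | is_ssyt T)
     \prod_(i < N) w i #|[set c | T c == i]| = strip_sum w N (part la).
Proof.
rewrite -grid_ssyt_sum //.
transitivity (\sum_(T in grid_of @: [set T | is_ssyt T])
    \prod_(i < N) w i #|[set c | T c == i :> nat]|).
  rewrite big_imset /=; last by move=> T1 T2 _ _; apply: grid_of_inj.
  apply: eq_big => [T|T _]; first by rewrite inE.
  apply: eq_bigr => i _; congr w; rewrite -(card_imset _ val_inj).
  apply: eq_card => c; rewrite !inE; apply/imsetP/eqP => [[c' ]|e].
    by rewrite inE => /eqP <- ->; rewrite grid_of_val.
  case: (boolP (c.2 < la c.1)%N) => h.
    exists (exist _ c h) => //; rewrite inE -val_eqE /= -e.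
    by rewrite -grid_of_val.
  by move: e; rewrite grid_of_out //; have := ltn_ord i; lia.
apply: eq_bigl => T; apply/imsetP/idP => [[T0 ]|/andP[sT shT]].
  by rewrite inE grid_ofP => h ->.
have prf (c : cell la) : (T (val c) < N)%N.
  by move/has_shapeP: shT => ->; exact: (valP c).
pose T0 : {ffun cell la -> 'I_N} := [ffun c => Ordinal (prf c)].
have eT : T = grid_of T0.
  apply/ffunP => c; apply: val_inj; case: (boolP (c.2 < la c.1)%N) => h.
    by have := grid_of_val T0 (exist _ c h) => /= ->; rewrite ffunE.
  rewrite /= grid_of_out //; case/grid_ssytP: sT => valT _ _.
  by case: (valT c) => //; move/has_shapeP: shT => ->; rewrite (negbTE h).
by exists T0 => //; rewrite inE grid_ofP -eT sT.
Qed.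

End GridTableaux.

(** * Complete and Schur symmetric functions *)

(** Variables indexed by [nat], the form that [hsum] and [strip_sum] expect. *)
Definition mvar N (k : nat) : {mpoly rat[N]} :=
  oapp (fun i : 'I_N => 'X_i) 0 (insub k).

Lemma mvarE N (i : 'I_N) : mvar N i = 'X_i.
Proof. by rewrite /mvar valK. Qed.

Lemma fam_sumE (k : nat -> nat) (I : Type) (r : seq I) (P : pred I)
    (F : I -> polyfam k) N :
  (\sum_(i <- r | P i) F i) N = \sum_(i <- r | P i) F i N.
Proof. by apply: (big_morph (fun f : polyfam k => f N)). Qed.

Lemma fam_prodE (k : nat -> nat) (I : Type) (r : seq I) (P : pred I)
    (F : I -> polyfam k) N :
  (\prod_(i <- r | P i) F i) N = \prod_(i <- r | P i) F i N.
Proof. by apply: (big_morph (fun f : polyfam k => f N)). Qed.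

Lemma fam_mulrnE (k : nat -> nat) (f : polyfam k) m N : (f *+ m) N = f N *+ m.
Proof. by elim: m => [|m IH]; rewrite ?mulr0n // !mulrS -IH. Qed.

Lemma schurE n (la : intpart n) N :
  schur la N = schur_sum (mvar N) N (part la).
Proof.
rewrite /schur_sum -(ssyt_strip_sum N (fun k m => mvar N k ^+ m)).
apply: eq_bigr => T _; rewrite (partition_big T xpredT) //=.
apply: eq_bigr => i _; rewrite mvarE -prodr_const.
by apply: eq_big => c; rewrite ?inE // => /eqP ->.
Qed.

Definition kostka n (la : intpart n) (c : nat -> nat) : nat :=
  #|[set T : {ffun cell la -> 'I_n} |
      is_ssyt T & [forall i : 'I_n, #|[set x | T x == i]| == c i]]|.

Lemma kostkaE (R : comNzRingType) n (la : intpart n) c :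
  (kostka la c)%:R = kostka_sum R c n (part la).
Proof.
rewrite /kostka_sum -(ssyt_strip_sum n (fun i m => (m == c i)%:R)).
rewrite /kostka -sum1_card natr_sum big_mkcond [RHS]big_mkcond.
apply: eq_bigr => T _; rewrite inE; case: (is_ssyt T) => //=.
case: forallP => [h|h]; first by rewrite big1 // => i _; rewrite h.
have [i /negbTE ne] : exists i : 'I_n, #|[set x | T x == i]| != c i.
  by apply/existsP; rewrite -negb_forall; apply/negP => /forallP.
by rewrite (bigD1 i) //= ne mul0r.
Qed.

Lemma strip_sum_noninc n (R : comNzRingType) w k (p : rshape n) i j :
  strip_sum (R := R) w k p != 0 -> (i <= j)%N -> (row_len p j <= row_len p i)%N.
Proof.
case: k => [|k] /=.
  case: (p =P _) => [-> _ _|]; last by rewrite eqxx.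
  by rewrite /row_len; case: insub => [?|]; case: insub => [?|] //=; rewrite
    !ffunE.
move=> nz; case: (pickP (fun q => hstrip q p)) => [q hq|no]; first exact:
  hstrip_noninc hq.
by rewrite big_pred0 ?eqxx in nz.
Qed.

Lemma mcoeff_h_sym m N (a : 'X_{1..N}) : (h_sym m N)@_a = (mdeg a == m)%:R.
Proof.
rewrite /h_sym raddf_sum /=; under eq_bigr => b _ do rewrite mcoeffX.
case: eqP => [ea|ne]; last first.
  by rewrite big1 // => b /eqP eb; case: eqP => // eab; rewrite -eab eb in ne.
have lt_a : (mdeg a < m.+1)%N by rewrite ea.
rewrite (bigD1 (BMultinom lt_a)) /= ?ea // eqxx big1 ?addr0 // => b /andP[_ ne].
by case: eqP => // e; case/eqP: ne; apply: val_inj.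
Qed.

Lemma prod_mvar N (f : 'I_N -> nat) :
  \prod_(i < N) 'X_i ^+ f i = 'X_[[multinom f i | i < N]] :> {mpoly rat[N]}.
Proof. by rewrite mpolyXE_id; apply: eq_bigr => i _; rewrite mnmE. Qed.

Lemma h_sym_ffun b m N : (m <= b)%N ->
  h_sym m N = \sum_(f : {ffun 'I_N -> 'I_b.+1} | (\sum_i f i == m)%N)
                \prod_(i < N) 'X_i ^+ f i.
Proof.
move=> le_mb; apply/mpolyP => a; rewrite mcoeff_h_sym raddf_sum /=.
under eq_bigr => f _ do rewrite prod_mvar mcoeffX.
case: eqP => [ea|ne]; last first.
  rewrite big1 // => f /eqP ef; case: eqP => // e; case: ne.
  by rewrite -ef -e mdegE; apply: eq_bigr => i _; rewrite mnmE.
have le_a i : (a i < b.+1)%N.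
  rewrite ltnS (leq_trans _ le_mb) // -ea mdegE (bigD1 i) //=; exact: leq_addr.
rewrite (bigD1 [ffun i => inord (a i)]) /=; last first.
  by rewrite -ea mdegE; apply/eqP; apply: eq_bigr => i _; rewrite ffunE inordK.
rewrite big1 ?addr0; last first.
  move=> f /andP[_ ne]; case: eqP => // /mnmP e; case/eqP: ne.
  by apply/ffunP => i; apply: val_inj; rewrite ffunE /= inordK // -e mnmE.
by case: eqP => // ne; case: ne; apply/mnmP => i; rewrite mnmE ffunE inordK.
Qed.

Lemma h_symE b m N : (m <= b)%N -> h_sym m N = hsum b (mvar N) N m.
Proof.
move=> le_mb; rewrite (h_sym_ffun N le_mb) /hsum.
under [in RHS]eq_bigr => i _ do rewrite poly_def.
rewrite bigA_distr_bigA coef_sum big_mkcond /=; apply: eq_bigr => f _.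
have -> : \prod_(i < N) (mvar N i ^+ f i *: 'X^(f i)) =
   (\prod_(i < N) 'X_i ^+ f i) *: 'X^(\sum_i f i) :> {poly {mpoly rat[N]}}.
  elim/big_rec3: _ => [|i y1 y2 y3 _ ->]; first by rewrite scale1r.
  by rewrite mvarE exprD -scalerAl -scalerAr scalerA.
by rewrite coefZ coefXn eq_sym; case: eqP; rewrite ?mulr1 ?mulr0.
Qed.

(** This is [hsum_prod] in each number of variables. A shape with nonzero strip sum is weakly
    decreasing and has area [n], so only partitions of [n] survive. *)
Lemma h_prod_schur n (c : nat -> nat) : (\sum_(i < n) c i = n)%N ->
  \prod_(i < n) h_sym (c i) = \sum_(la : intpart n) schur la *+ kostka la c.
Proof.
move=> sum_c; apply: boolp.functional_extensionality_dep => N.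
rewrite fam_prodE fam_sumE.
have le_c (i : 'I_n) : (c i <= n)%N by rewrite -[leqRHS]sum_c (bigD1 i) //=
  leq_addr.
under eq_bigr => i _ do rewrite (h_symE N (le_c i)).
rewrite hsum_prod ?sum_c //.
pose Q (p : rshape n) := [forall i : 'I_n, forall j : 'I_n, (i <= j)%N ==> (p j
  <= p i)%N] &&
      (\sum_i p i == n)%N.
have QP p : kostka_sum (n := n) {mpoly rat[N]} c n p != 0 -> Q p.
  move=> nz; apply/andP; split; last by have /eqP := kostka_sum_area nz;
    rewrite sum_c.
  apply/forallP => i; apply/forallP => j; apply/implyP => le_ij; rewrite
    -!row_lenE.
  exact: strip_sum_noninc nz le_ij.
rewrite (bigID Q) /= [X in _ + X]big1 ?addr0; last first.
  by move=> p /(contraNeq (@QP p)) ->; rewrite mul0r.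
rewrite (reindex_omap (fun la : intpart n => part la) insub) /=; last first.
  by move=> p Qp; rewrite insubT.
apply: eq_big => [la|la _]; first by rewrite valK eqxx andbT; case: la.
by rewrite fam_mulrnE schurE -kostkaE mulr_natl.
Qed.

Definition margins n (c d : nat -> nat) :=
  [set M : {ffun 'I_n -> {ffun 'I_n -> 'I_n.+1}} |
     [forall i, (\sum_j M i j)%N == c i] && [forall j, (\sum_i M i j)%N == d
       j]].

Lemma mcoeff_schur n (la : intpart n) (d : nat -> nat) :
  (schur la n)@_[multinom d i | i < n] = (kostka la d)%:R.
Proof.
rewrite /schur raddf_sum /kostka -sum1_card natr_sum /= big_mkcond
  [RHS]big_mkcond.
apply: eq_bigr => T _; rewrite inE; case: (is_ssyt T) => //=.
have -> : \prod_c 'X_(T c) = 'X_[[multinom #|[set x | T x == i]| | i < n]] :>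
  {mpoly rat[n]}.
  rewrite -prod_mvar (partition_big T xpredT) //=; apply: eq_bigr => i _.
  by rewrite -prodr_const; apply: eq_big => c; rewrite ?inE // => /eqP ->.
rewrite mcoeffX; case: forallP => [h|h]; case: eqP => [/mnmP e|ne] //=.
  by case: ne; apply/mnmP => i; rewrite !mnmE; apply/eqP.
by case: h => i; have := e i; rewrite !mnmE => ->.
Qed.

(** Compare the coefficients of the monomial with exponents [d] in [h_prod_schur]. On the product
    side, row [i] of a matrix is the monomial chosen in the factor [h_sym (c i)]. This is the
    enumerative form of the RSK correspondence. *)
Lemma kostka_margins n (c d : nat -> nat) : (\sum_(i < n) c i = n)%N ->
  (\sum_(la : intpart n) kostka la c * kostka la d)%N = #|margins n c d|.
Proof.
move=> sum_c; apply/eqP; rewrite -(eqr_nat rat); apply/eqP.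
have le_c (i : 'I_n) : (c i <= n)%N by rewrite -[leqRHS]sum_c (bigD1 i) //=
  leq_addr.
have := congr1 (fun f : fam1 => (f n)@_[multinom d i | i < n]) (h_prod_schur
  sum_c).
rewrite fam_sumE fam_prodE raddf_sum /=.
under [in RHS]eq_bigr => la _ do rewrite fam_mulrnE mcoeffMn mcoeff_schur
  -mulrnA mulnC.
rewrite natr_sum => <-.
under eq_bigr => i _ do rewrite (h_sym_ffun n (le_c i)).
rewrite bigA_distr_big_dep raddf_sum /= -sum1_card natr_sum big_mkcond
  [RHS]big_mkcond /=.
apply: eq_bigr => M _; rewrite [M \in margins _ _ _]inE.
rewrite [X in if X then _ else 0](_ : _ = [forall i, (\sum_j M i j)%N == c i]);
  last first.
  by apply: eq_forallb => i; rewrite ?inE.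
case: [forall i, _] => //=.
rewrite exchange_big /=.
have -> : \prod_(j < n) \prod_(i < n) 'X_j ^+ M i j =
   'X_[[multinom (\sum_i M i j)%N | j < n]] :> {mpoly rat[n]}.
  rewrite -prod_mvar; apply: eq_bigr => j _.
  by elim/big_rec2: _ => [|i y1 y2 _ ->]; rewrite ?expr0 // exprD.
rewrite mcoeffX; case: (boolP [forall j : 'I_n, (\sum_i M i j)%N == d j]) =>
  /forallP h; case: eqP => [/mnmP e|ne] //=.
  by case: ne; apply/mnmP => i; rewrite !mnmE; apply/eqP.
by case: h => i; have := e i; rewrite !mnmE => ->.
Qed.

(** * The algebra of symmetric functions *)

Lemma is_symfun0 : is_symfun 0.
Proof.
split=> [N|N|]; first exact: rpred0.
  exact: comp_mpoly0.
by exists 0%N => N; rewrite msize0.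
Qed.

Lemma is_symfun1 : is_symfun 1.
Proof.
split=> [N|N|]; first exact: rpred1.
  exact: comp_mpoly1.
by exists 1%N => N; rewrite msize1.
Qed.

Lemma is_symfunD f g : is_symfun f -> is_symfun g -> is_symfun (f + g).
Proof.
move=> [sf cf [df bf]] [sg cg [dg bg]]; split=> [N|N|].
- exact: (rpredD (sf N) (sg N)).
- by rewrite [LHS]comp_mpolyD cf cg.
- exists (maxn df dg) => N; apply: leq_trans (msizeD_le _ _) _.
  by rewrite geq_max !leq_max bf bg orbT.
Qed.

Lemma is_symfunM f g : is_symfun f -> is_symfun g -> is_symfun (f * g).
Proof.
move=> [sf cf [df bf]] [sg cg [dg bg]]; split=> [N|N|].
- exact: (rpredM (sf N) (sg N)).
- by rewrite [LHS]rmorphM /= cf cg.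
- exists (df + dg).+1 => N; apply: leq_trans (msizeM_le _ _) _.
  by rewrite ltnS leq_add.
Qed.

Lemma is_symfunZ (a : rat) f : is_symfun f -> is_symfun (a *: f).
Proof.
move=> [sf cf [df bf]]; split=> [N|N|].
- exact: (rpredZ a (sf N)).
- by rewrite [LHS]comp_mpolyZ cf.
- by exists df => N; apply: leq_trans (msizeZ_le _ _) _.
Qed.

Lemma is_symfun_sum (I : Type) (r : seq I) (P : pred I) (F : I -> fam1) :
  (forall i, P i -> is_symfun (F i)) -> is_symfun (\sum_(i <- r | P i) F i).
Proof.
by move=> symF; elim/big_ind: _ => //; [exact: is_symfun0 | exact: is_symfunD].
Qed.

Lemma is_symfun_prod (I : Type) (r : seq I) (P : pred I) (F : I -> fam1) :
  (forall i, P i -> is_symfun (F i)) -> is_symfun (\prod_(i <- r | P i) F i).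
Proof.
by move=> symF; elim/big_ind: _ => //; [exact: is_symfun1 | exact: is_symfunM].
Qed.

Lemma rmorph_hsum (R S : comNzRingType) (f : {rmorphism R -> S}) b (x : nat ->
  R) N m :
  f (hsum b x N m) = hsum b (f \o x) N m.
Proof.
have E i : map_poly f (\poly_(j < b.+1) (x i ^+ j)) = \poly_(j < b.+1) ((f \o
  x) i ^+ j).
  by apply/polyP => j; rewrite coef_map !coef_poly; case: ifP => _; [exact:
    rmorphXn | exact: rmorph0].
by rewrite /hsum -coef_map rmorph_prod /= (eq_bigr _ (fun (i : 'I_N) _ => E i)).
Qed.

Lemma eq_hsum (R : comNzRingType) b (x y : nat -> R) N m :
  (forall i, (i < N)%N -> x i = y i) -> hsum b x N m = hsum b y N m.
Proof.
move=> e; rewrite /hsum (eq_bigr (fun i : 'I_N => \poly_(j < b.+1) (y i ^+ j)))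
  //.
by move=> i _; rewrite e.
Qed.

Lemma is_symfun_h m : is_symfun (h_sym m).
Proof.
split=> [N|N|].
- by apply/issymP => s; apply/mpolyP => a; rewrite mcoeff_sym !mcoeff_h_sym
    mdeg_mperm.
- rewrite !(h_symE _ (leqnn m)) (rmorph_hsum (comp_mpoly _)) hsumS //.
  have vE (i : nat) : (i < N)%N -> (comp_mpoly [tuple (if unlift ord_max i is
    Some j
         then 'X_j else 0) | i < N.+1] \o mvar N.+1) i = mvar N i.
    move=> lt_i; have e : i = lift (@ord_max N) (Ordinal lt_i) by rewrite /=
      /bump leqNgt lt_i.
    rewrite {1}e -[LHS]/(comp_mpoly _ (mvar N.+1 (lift ord_max (Ordinal
      lt_i)))) mvarE comp_mpolyXU -tnth_nth tnth_mktuple liftK.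
    by rewrite -mvarE.
  have vN : (comp_mpoly [tuple (if unlift ord_max i is Some j
         then 'X_j else 0) | i < N.+1] \o mvar N.+1) N = 0.
    by rewrite /= -[N in mvar _ N]/(nat_of_ord (@ord_max N)) mvarE comp_mpolyXU
      -tnth_nth tnth_mktuple unlift_none.
  rewrite big_ord_recl big1 => [|i _]; last by rewrite vN expr0n mulr0.
  rewrite vN expr0 mulr1 addr0 subn0; exact: eq_hsum.
- exists m.+1 => N; rewrite msizeE; apply/bigmax_leqP_seq => a.
  by rewrite mcoeff_msupp mcoeff_h_sym; case: (mdeg a =P m) => [-> //|_];
    rewrite eqxx.
Qed.

(** * Dominance order and the Kostka matrix *)

Lemma card_lt_sum (X : finType) (P : pred X) (f : X -> nat) i :
  #|[set x | P x & (f x < i)%N]| = (\sum_(j < i) #|[set x | P x & f x == j]|)%N.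
Proof.
elim: i => [|i IH].
  by rewrite big_ord0; apply/eqP; rewrite cards_eq0; apply/eqP/setP => x;
    rewrite !inE andbF.
rewrite big_ord_recr /= -IH -cardsUI [_ :&: _](_ : _ = set0) ?cards0 ?addn0.
  by apply: eq_card => x; rewrite !inE ltnS leq_eqVlt -andb_orr orbC.
by apply/setP => x; rewrite !inE; apply/negP => /andP[/andP[_ lt] /andP[_ /eqP
  e]]; lia.
Qed.

Section Dominance.
Variable n : nat.
Implicit Types la mu nu : intpart n.

Lemma part_sum la : (\sum_(i < n) row_len (part la) i = n)%N.
Proof. by rewrite -areaE; case: la => p /= /andP[_ /eqP]. Qed.

Lemma card_row la (i : 'I_n) : #|[set c : cell la | row_of c == i]| = la i.
Proof.
rewrite -[RHS](@card_ord_lt n _ (leq_ord _)).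
rewrite -(card_in_imset (f := @col_of n la) (D := [set c | row_of c == i]));
  last first.
  move=> c c'; rewrite !inE => /eqP r /eqP r' e; apply: val_inj.
  by move: r r' e; rewrite /row_of /col_of; case: (val c) (val c') => [a b] [a'
    b'] /= -> -> ->.
apply: eq_card => j; rewrite inE; apply/imsetP/idP.
  by case=> c; rewrite inE => /eqP <- ->; exact: (valP c).
by move=> lt_j; exists (exist _ (i, j) lt_j); rewrite ?inE.
Qed.

Lemma cell_inj la (c c' : cell la) :
  row_of c = row_of c' -> col_of c = col_of c' -> c = c'.
Proof.
move=> r e; apply: val_inj; move: r e; rewrite /row_of /col_of.
by case: (val c) (val c') => [a b] [a' b'] /= -> ->.
Qed.

Lemma cell_above la (c : cell la) (r : 'I_n) : (r <= row_of c)%N ->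
  exists2 c' : cell la, row_of c' = r & col_of c' = col_of c.
Proof.
move=> le_r; have lt : (col_of c < la r)%N.
  exact: leq_trans (valP c) (part_noninc _ le_r).
by exists (exist _ (r, col_of c) lt).
Qed.

(** Dominance order, with an arbitrary content in the place of the smaller partition. *)
Definition dominates la (c : nat -> nat) : Prop := forall i, (i <= n)%N ->
  (\sum_(j < i) c j <= \sum_(j < i) row_len (part la) j)%N.

Section ColumnInjective.
Variables (la : intpart n) (f : cell la -> 'I_n).
Hypothesis col_inj : forall c c', col_of c = col_of c' -> f c = f c' -> c = c'.

(** Either the column reaches row [i], and it has [i] cells above that row while injectivity allows
    at most [i] entries below [i]; or all its cells lie above row [i]. *)
Lemma card_col_lt i (j : 'I_n) : (i <= n)%N ->
  (#|[set c | col_of c == j & (f c < i)%N]| <=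
   #|[set c : cell la | col_of c == j & (row_of c < i)%N]|)%N.
Proof.
move=> le_in.
have [c0 /andP[/eqP ej le_i]|no] := pickP [pred c0 : cell la | (col_of c0 == j)
  && (i <= row_of c0)%N].
  apply: (@leq_trans i).
    rewrite -[leqRHS](card_ord_lt le_in) -(card_in_imset (f := f)).
      by apply/subset_leq_card/subsetP => _ /imsetP[c + ->]; rewrite !inE =>
        /andP[].
    move=> c c'; rewrite !inE => /andP[/eqP e _] /andP[/eqP e' _]; apply:
      col_inj.
    by rewrite e e'.
  rewrite -[leqLHS](card_ord_lt le_in).
  apply: leq_trans (leq_imset_card (@row_of n la) _).
  apply/subset_leq_card/subsetP => r; rewrite inE => lt_r.
  have [|c' er ec] := @cell_above la c0 r; first exact: leq_trans (ltnW lt_r)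
    le_i.
  by apply/imsetP; exists c'; rewrite ?inE ?ec ?ej ?eqxx er.
apply/subset_leq_card/subsetP => c; rewrite !inE => /andP[/eqP ej _].
by rewrite ej eqxx ltnNge; have := no c; rewrite /= ej eqxx /= => ->.
Qed.

Lemma sum_card_col (P : pred (cell la)) :
  (\sum_(j < n) #|[set c | col_of c == j & P c]| = #|[set c | P c]|)%N.
Proof.
rewrite -[RHS]sum1_card (partition_big (@col_of n la) xpredT) //=.
by apply: eq_bigr => j _; rewrite -sum1_card; apply: eq_bigl => c; rewrite !inE
  andbC.
Qed.

Lemma card_lt_content (c : nat -> nat) i : (i <= n)%N ->
  (forall i : 'I_n, #|[set x | f x == i]| = c i) ->
  #|[set x | (f x < i)%N]| = (\sum_(j < i) c j)%N.
Proof.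
move=> le_in ct; rewrite (@card_lt_sum _ xpredT f i); apply: eq_bigr => j _.
by rewrite -(ct (widen_ord le_in j)).
Qed.

Lemma card_lt_row i : (i <= n)%N ->
  #|[set x : cell la | (row_of x < i)%N]| = (\sum_(j < i) row_len (part la)
    j)%N.
Proof.
move=> le_in; rewrite (@card_lt_sum _ xpredT (@row_of n la) i).
apply: eq_bigr => j _.
by rewrite -[nat_of_ord j]/(nat_of_ord (widen_ord le_in j)) row_lenE -card_row.
Qed.

Lemma content_dominates (c : nat -> nat) :
  (forall i : 'I_n, #|[set x | f x == i]| = c i) -> dominates la c.
Proof.
move=> ct i le_in; rewrite -(card_lt_content le_in ct) -(card_lt_row le_in).
rewrite -(sum_card_col (fun x => (f x < i)%N)) -(sum_card_col (fun x => (row_of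
  x < i)%N)).
by apply: leq_sum => j _; apply: card_col_lt.
Qed.

(** Equality case of dominance: when the content equals the shape, the inequalities of [card_col_lt]
    add up to an equality over the columns, so each of them is one. *)
Lemma content_shape_col (i j : 'I_n) :
  (forall i : 'I_n, #|[set x | f x == i]| = la i) ->
  #|[set c | col_of c == j & f c == i]| =
  #|[set c : cell la | col_of c == j & row_of c == i]|.
Proof.
move=> ct; have ct' (k : 'I_n) : #|[set x | f x == k]| = row_len (part la) k.
  by rewrite ct row_lenE.
have E k : (k <= n)%N -> #|[set c | col_of c == j & (f c < k)%N]| =
    #|[set c : cell la | col_of c == j & (row_of c < k)%N]|.
  move=> le_k; have le j' := card_col_lt j' le_k.
  have := card_lt_content le_k ct'; rewrite -(card_lt_row le_k).
  rewrite -(sum_card_col (fun x => (f x < k)%N)) -(sum_card_col (fun x =>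
    (row_of x < k)%N)).
  rewrite (bigD1 j) //= [RHS](bigD1 j) //= => e.
  have le_j := le j.
  by apply/eqP; rewrite eqn_leq le_j -(leq_add2r (\sum_(j' < n | j' != j)
    #|[set c : cell la | col_of c == j' & (row_of c < k)%N]|)%N) -e leq_add2l;
      apply: leq_sum => j' _; apply: le.
have := E i.+1 (ltn_ord i); rewrite !card_lt_sum !big_ord_recr /=.
by rewrite -!card_lt_sum E ?(ltnW (ltn_ord i)) // => /addnI.
Qed.

End ColumnInjective.

Lemma is_ssyt_col_inj la N (T : {ffun cell la -> 'I_N}) : is_ssyt T ->
  forall c c', col_of c = col_of c' -> T c = T c' -> c = c'.
Proof.
case/andP=> _ /forallP colT c c' ec eT; apply: cell_inj => //.
have lt x x' : col_of x = col_of x' -> (row_of x < row_of x')%N -> (T x < T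
  x')%N.
  by move=> e lt; move/forallP: (colT x) => /(_ x')/implyP; apply; rewrite e
    eqxx.
apply: val_inj; case: (ltngtP (row_of c) (row_of c')) => // h.
  by have := lt c c' ec h; rewrite eT ltnn.
by have := lt c' c (esym ec) h; rewrite eT ltnn.
Qed.

Lemma kostka_dominates la (c : nat -> nat) : kostka la c != 0%N -> dominates la
  c.
Proof.
rewrite -lt0n => /card_gt0P[T]; rewrite inE => /andP[sT /forallP ct].
by apply: (content_dominates (is_ssyt_col_inj sT)) => i; apply/eqP.
Qed.

Lemma is_ssyt_row_le la N (T : {ffun cell la -> 'I_N}) : is_ssyt T ->
  forall c, (row_of c <= T c)%N.
Proof.
case/andP=> _ /forallP colT c; move: {2}(nat_of_ord (row_of c)) (erefl
  (nat_of_ord (row_of c))) => r.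
elim: r c => [|r IH] c er; first by rewrite er.
have lt_r : (r < n)%N by have := ltn_ord (row_of c); lia.
have [|c' er' ec'] := @cell_above la c (Ordinal lt_r); first by rewrite er.
have := IH c'; rewrite er' => /(_ erefl) le_r.
have : (T c' < T c)%N.
  by move/forallP: (colT c') => /(_ c)/implyP; apply; rewrite ec' eqxx er er'
    /=.
by rewrite er /= in le_r *; apply: leq_ltn_trans.
Qed.

Lemma sum_fiber (X : finType) m (f : X -> 'I_m) :
  (\sum_x f x = \sum_(i < m) #|[set x | f x == i]| * i)%N.
Proof.
rewrite (partition_big f xpredT) //=; apply: eq_bigr => i _.
by rewrite -sum_nat_const; apply: eq_big => x; rewrite ?inE // => /eqP ->.
Qed.

(** Column strictness gives [row_of c <= T c]. With content [la] both sides have the same sum over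
    all cells, so the tableau of row indices is the only one. *)
Lemma kostka_diag la : kostka la (row_len (part la)) = 1%N.
Proof.
apply/eqP/cards1P; exists [ffun c => row_of c]; apply/setP => T; rewrite !inE.
apply/idP/eqP => [/andP[sT /forallP ct]|->].
  apply/ffunP => c; rewrite ffunE; apply/val_inj/eqP; rewrite /= eqn_leq
    is_ssyt_row_le // andbT.
  have e : (\sum_x T x = \sum_(x : cell la) row_of x)%N.
    rewrite !sum_fiber; apply: eq_bigr => i _; congr (_ * _)%N.
    by rewrite card_row -row_lenE; apply/eqP.
  rewrite -(leq_add2r (\sum_(x | x != c) row_of x)%N).
  have := e; rewrite (bigD1 c) //= [X in _ = X -> _](bigD1 c) //= => <-.
  by rewrite leq_add2l; apply: leq_sum => x _; apply: is_ssyt_row_le.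
apply/andP; split.
  apply/andP; split; apply/forallP => c; apply/forallP => c'; apply/implyP =>
    /andP[/eqP e lt].
    by rewrite !ffunE e.
  by rewrite !ffunE.
apply/forallP => i; rewrite row_lenE -card_row; apply/eqP.
by apply: eq_card => c; rewrite !inE ffunE.
Qed.

(** * Inverting the Kostka matrix *)

Lemma dominates_trans la mu c :
  dominates la (row_len (part mu)) -> dominates mu c -> dominates la c.
Proof. by move=> h1 h2 i le_i; apply: leq_trans (h2 i le_i) (h1 i le_i). Qed.

Lemma dominates_anti la mu :
  dominates la (row_len (part mu)) -> dominates mu (row_len (part la)) -> la =
    mu.
Proof.
move=> h1 h2; apply/val_inj/ffunP => i; apply: val_inj => /=.
have e k : (k <= n)%N ->
  (\sum_(j < k) row_len (part la) j = \sum_(j < k) row_len (part mu) j)%N.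
  by move=> le_k; apply/eqP; rewrite eqn_leq h1 ?h2.
have := e i.+1 (ltn_ord i); rewrite !big_ord_recr /= e ?(ltnW (ltn_ord i)) //.
by move/addnI; rewrite !row_lenE.
Qed.

(** A strictly monotone numerical rank for the dominance order, serving as induction measure. *)
Definition dom_rank la : nat :=
  (\sum_(i < n.+1) \sum_(j < i) row_len (part la) j)%N.

Lemma dominates_rank la mu : dominates la (row_len (part mu)) -> la != mu ->
  (dom_rank mu < dom_rank la)%N.
Proof.
move=> h ne; have le (i : 'I_n.+1) : (\sum_(j < i) row_len (part mu) j <=
   \sum_(j < i) row_len (part la) j)%N by apply: h; rewrite -ltnS.
rewrite ltn_neqAle leq_sum // andbT; apply: contra ne => /eqP e; apply/eqP.
apply: dominates_anti => // k le_k.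
rewrite -(leq_add2r (\sum_(i < n.+1 | i != inord k) \sum_(j < i) row_len (part
  mu) j)%N).
have := e; rewrite /dom_rank (bigD1 (inord k)) //= [X in _ = X](bigD1 (inord
  k)) //=.
rewrite inordK ?ltnS // => ->; rewrite leq_add2l.
by apply: leq_sum => i _; apply: le.
Qed.

Lemma dom_rank_le la : (dom_rank la <= n.+1 * n)%N.
Proof.
rewrite -[n.+1]card_ord -sum_nat_const; apply: leq_sum => i _.
rewrite -[leqRHS](part_sum la) -[leqRHS](big_mkord xpredT) -[leqLHS](big_mkord
  xpredT (fun j => row_len (part la) j)).
by rewrite [leqRHS](big_cat_nat (n := i)) ?leq_addr // -ltnS.
Qed.

(** Unitriangular elimination: [schur la] is [h_part la] minus the terms [K mu la] times [schur mu]
    for [mu != la], and row [mu] of [F] expands [schur mu] in the products [h_part nu]. *)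
Lemma kostka_inverse_step la (F : intpart n -> intpart n -> rat) :
  (forall mu, mu != la -> kostka mu (row_len (part la)) != 0%N ->
    [/\ forall ka, \sum_nu F mu nu * (kostka ka (row_len (part nu)))%:R = (ka
      == mu)%:R &
        forall nu, F mu nu != 0 -> dominates nu (row_len (part mu))]) ->
  exists a : intpart n -> rat,
  [/\ forall mu, \sum_nu a nu * (kostka mu (row_len (part nu)))%:R = (mu ==
    la)%:R,
      a la = 1 &
      forall nu, a nu != 0 -> dominates nu (row_len (part la))].
Proof.
move=> FP; pose K mu nu : rat := (kostka mu (row_len (part nu)))%:R.
exists (fun nu => (nu == la)%:R - \sum_(mu | mu != la) K mu la * F mu nu).
have FPmu mu : mu != la -> K mu la != 0 ->
    [/\ forall ka, \sum_nu F mu nu * K ka nu = (ka == mu)%:R &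
        forall nu, F mu nu != 0 -> dominates nu (row_len (part mu))].
  by move=> ne nz; apply: FP => //; move: nz; rewrite /K pnatr_eq0.
split.
- move=> ka; under eq_bigr => nu _ do rewrite mulrBl.
  rewrite sumrB (bigD1 la) //= eqxx mul1r big1 ?addr0; last first.
    by move=> nu /negbTE ->; rewrite mul0r.
  under eq_bigr => nu _ do rewrite mulr_suml.
  rewrite exchange_big /=.
  rewrite (eq_bigr (fun mu => K mu la * (ka == mu)%:R)); last first.
    move=> mu ne; under eq_bigr => nu _ do rewrite -mulrA.
    rewrite -mulr_sumr; have [->|nz] := eqVneq (K mu la) 0; first by rewrite
      !mul0r.
    by case: (FPmu mu ne nz) => ->.
  have [->|ne] := eqVneq ka la.
    rewrite kostka_diag big1 ?subr0 // => mu ne.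
    by rewrite eq_sym (negbTE ne) mulr0.
  rewrite (bigD1 ka) //= eqxx mulr1 big1 ?addr0 ?subrr // => mu /andP[_ ne'].
  by rewrite eq_sym (negbTE ne') mulr0.
- rewrite eqxx big1 ?subr0 // => mu ne.
  have [->|nz] := eqVneq (K mu la) 0; first by rewrite mul0r.
  have [_ Fdom] := FPmu mu ne nz.
  have [->|/Fdom h] := eqVneq (F mu la) 0; first by rewrite mulr0.
  have: dominates mu (row_len (part la)).
    by apply: kostka_dominates; move: nz; rewrite /K pnatr_eq0.
  by move/dominates_anti => /(_ h) e; rewrite e eqxx in ne.
- move=> nu; have [-> _ i _ //|ne] := eqVneq nu la; rewrite sub0r oppr_eq0 =>
    nz.
  have [mu nela nzt] : exists2 mu, mu != la & K mu la * F mu nu != 0.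
    case: (pickP (fun mu => (mu != la) && (K mu la * F mu nu != 0))) => [mu
      /andP[]|no]; first by exists mu.
    case/eqP: nz; apply: big1 => mu ne'; have := no mu; rewrite ne' /=.
    by move/negbFE/eqP.
  move: nzt; rewrite mulf_eq0 negb_or => /andP[nzK nzF].
  have [_ Fdom] := FPmu mu nela nzK; apply: dominates_trans (Fdom _ nzF) _.
  by apply: kostka_dominates; move: nzK; rewrite /K pnatr_eq0.
Qed.

(** The [a nu] are the coefficients of [schur la] in the products [h_part nu], obtained by induction
    downwards from the top of the dominance order. *)
Lemma kostka_inverse la : exists a : intpart n -> rat,
  [/\ forall mu, \sum_nu a nu * (kostka mu (row_len (part nu)))%:R = (mu ==
    la)%:R,
      a la = 1 &
      forall nu, a nu != 0 -> dominates nu (row_len (part la))].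
Proof.
move: {2}(_ - dom_rank la)%N (leqnn (n.+1 * n - dom_rank la)%N) => m.
elim: m la => [|m IH] la le_m.
  apply: (kostka_inverse_step (F := fun _ _ => 0)) => mu ne /kostka_dominates h.
  by have := dominates_rank h ne; have := dom_rank_le mu; lia.
have [F FP] : exists F : intpart n -> intpart n -> rat, forall mu,
    mu != la -> kostka mu (row_len (part la)) != 0%N ->
    [/\ forall ka, \sum_nu F mu nu * (kostka ka (row_len (part nu)))%:R = (ka
      == mu)%:R &
        forall nu, F mu nu != 0 -> dominates nu (row_len (part mu))].
  apply: (fin_all_exists (P := fun mu (f : intpart n -> rat) =>
    mu != la -> kostka mu (row_len (part la)) != 0%N ->
    [/\ forall ka, \sum_nu f nu * (kostka ka (row_len (part nu)))%:R = (ka ==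
      mu)%:R &
        forall nu, f nu != 0 -> dominates nu (row_len (part mu))])) => mu.
  have [->|ne] := eqVneq mu la; first by exists (fun _ => 0).
  have [e|nz] := eqVneq (kostka mu (row_len (part la))) 0%N.
    by exists (fun _ => 0).
  have [|a [h1 _ h3]] := IH mu; last by exists a.
  by have := dominates_rank (kostka_dominates nz) ne; have := dom_rank_le mu;
    lia.
exact: kostka_inverse_step FP.
Qed.

Definition h_part la : fam1 := \prod_(i < n) h_sym (row_len (part la) i).

(** By [kostka_inverse], a Schur function is a linear combination of products of [h_m]. *)
Lemma is_symfun_schur la : is_symfun (schur la).
Proof.
have [a [aK _ _]] := kostka_inverse la.
have -> : schur la = \sum_nu a nu *: h_part nu; last first.
  apply: is_symfun_sum => nu _; apply: is_symfunZ; apply: is_symfun_prod => i _.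
  exact: is_symfun_h.
under eq_bigr => nu _ do rewrite /h_part (h_prod_schur (part_sum nu))
  scaler_sumr.
rewrite exchange_big /= (bigD1 la) //= [X in _ + X]big1 => [|mu ne].
  have e1 : \sum_nu a nu * (kostka la (row_len (part nu)))%:R = 1 by rewrite aK
    eqxx.
  rewrite addr0 -[LHS]scale1r -e1 scaler_suml; apply: eq_bigr => nu _.
  by rewrite -scaler_nat scalerA.
under eq_bigr => nu _ do rewrite -scaler_nat scalerA.
by rewrite -scaler_suml aK (negbTE ne) scale0r.
Qed.

End Dominance.

(** * Standardization *)

Section KeyRank.
Variables (X : finType) (key : X -> nat).
Hypothesis key_inj : injective key.

Definition krank x : nat := #|[set y | (key y < key x)%N]|.

Lemma krank_lt_card x : (krank x < #|X|)%N.
Proof.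
rewrite -cardsT; apply: proper_card; apply/properP; split; first exact: subsetT.
by exists x; rewrite ?inE // ltnn.
Qed.

Lemma krank_lt x y : (krank x < krank y)%N = (key x < key y)%N.
Proof.
have mono a b : (key a < key b)%N -> (krank a < krank b)%N.
  move=> lt_ab; apply: proper_card; apply/properP; split.
    by apply/subsetP => z; rewrite !inE => /ltn_trans; apply.
  by exists a; rewrite !inE ?ltnn.
apply/idP/idP; last exact: mono.
case: (ltngtP (key x) (key y)) => // [/mono h1 h2|/key_inj -> ]; last by
  rewrite ltnn.
by have := ltn_trans h1 h2; rewrite ltnn.
Qed.

Lemma krank_inj : injective krank.
Proof.
move=> x y e; apply: key_inj; apply/eqP; rewrite eqn_leq.
by apply/andP; split; rewrite leqNgt -krank_lt e ltnn.
Qed.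

End KeyRank.

Lemma card_inj_lt (X : finType) (f : X -> nat) i :
  injective f -> (forall x, f x < #|X|)%N -> (i <= #|X|)%N ->
  #|[set x | (f x < i)%N]| = i.
Proof.
move=> inj_f lt_f le_i; pose g x := Ordinal (lt_f x).
have inj_g : injective g by move=> x y [/inj_f].
have bij_g := inj_card_bij inj_g _; rewrite card_ord in bij_g.
case: (bij_g (leqnn _)) => g' gK g'K.
rewrite -(card_imset _ inj_g) -[RHS](card_ord_lt le_i).
apply: eq_card => k; rewrite inE; apply/imsetP/idP => [[x]|lt_k].
  by rewrite inE => lt_x ->.
by exists (g' k); rewrite ?g'K // inE -[f _]/(nat_of_ord (g _)) g'K.
Qed.

Lemma inj_lt_surj (X : finType) (f : X -> nat) i :
  injective f -> (forall x, f x < #|X|)%N -> (i < #|X|)%N -> exists x, f x = i.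
Proof.
move=> inj_f lt_f lt_i; pose g x := Ordinal (lt_f x).
have inj_g : injective g by move=> x y [/inj_f].
have [|g' gK g'K] := inj_card_bij inj_g; first by rewrite card_ord.
by exists (g' (Ordinal lt_i)); rewrite -[f _]/(nat_of_ord (g _)) g'K.
Qed.

Lemma krank_eq (X : finType) (f key : X -> nat) :
  injective f -> (forall x, f x < #|X|)%N ->
  (forall x y, (f x < f y)%N = (key x < key y)%N) -> krank key =1 f.
Proof.
move=> inj_f lt_f e x; rewrite -[RHS](card_inj_lt inj_f lt_f (ltnW (lt_f x))).
by apply: eq_card => y; rewrite !inE e.
Qed.

(** * Blocks cut out by a set of positions *)

Section Blocks.
Variables (n : nat) (J : {set 'I_n}).

(* The blocks of [0, n) cut at the elements of J, labelled by their least     *)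
(* elements.                                                                  *)
Definition blk (x : nat) : nat := (\max_(j in J | (j <= x)%N) j)%N.

Lemma blk_le x : (blk x <= x)%N.
Proof. by apply/bigmax_leqP => j /andP[]. Qed.

Lemma blk_lt (j : 'I_n) x : j \in J -> (blk x < j)%N = (x < j)%N.
Proof.
move=> jJ; apply/idP/idP; last exact: leq_ltn_trans (blk_le x).
apply: contraTT; rewrite -!leqNgt => le_jx.
by rewrite /blk (bigD1 j) /= ?leq_maxl // jJ.
Qed.

Lemma blk_mono x y : (x <= y)%N -> (blk x <= blk y)%N.
Proof.
move=> le_xy; apply/bigmax_leqP => j /andP[jJ le_jx].
by rewrite /blk (bigD1 j) /= ?leq_maxl // jJ (leq_trans le_jx).
Qed.

Definition is_label (x : nat) := x = 0%N \/ exists2 j : 'I_n, j \in J & x = j.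

Lemma blk_label x : is_label (blk x).
Proof.
rewrite /blk; elim/big_ind: _ => [|a b la lb|j /andP[jJ _]]; first by left.
  by case: (leqP a b) => _.
by right; exists j.
Qed.

Lemma label_eq x y : is_label x -> is_label y ->
  (forall j : 'I_n, j \in J -> (x < j)%N = (y < j)%N) -> x = y.
Proof.
move=> lx ly e; apply/eqP; rewrite eqn_leq; apply/andP; split; rewrite leqNgt;
  apply/negP.
  case: lx => [-> //|[j jJ ex]] lt; have := e j jJ.
  by rewrite -ex lt ltnn.
case: ly => [-> //|[j jJ ey]] lt; by have := e j jJ; rewrite -ey lt ltnn.
Qed.

Lemma blk_eq x y : (x <= y)%N ->
  (forall j : 'I_n, j \in J -> ~~ (x < j <= y)%N) -> blk x = blk y.
Proof.
move=> le_xy no; apply: label_eq; try exact: blk_label.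
by move=> j jJ; rewrite !blk_lt //; have := no j jJ; lia.
Qed.

(** Block sizes indexed by the least element of the block, hence 0 wherever no block starts: the
    composition of [n] attached to [J], padded with zeros to length [n]. In products of [h_m] the
    padding contributes factors [h_0 = 1]. *)
Definition block_content (k : nat) : nat := #|[set x : 'I_n | blk x == k]|.

Definition block_map (X : finType) (f : X -> nat) :=
  (forall x, is_label (f x)) /\
  (forall j : 'I_n, j \in J -> #|[set x | (f x < j)%N]| = j).

Lemma block_map_blk : block_map (fun x : 'I_n => blk x).
Proof.
split=> [x|j jJ]; first exact: blk_label.
rewrite -[RHS](@card_ord_lt n) ?(ltnW (ltn_ord j)) //.
by apply: eq_card => x; rewrite !inE blk_lt.
Qed.

(** The values of [f] are 0 or elements of [J], so a positive threshold [i] may be raised to the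
    least element of [J] above it, where the count is prescribed. The formula does not mention [f]:
    all block maps have the same content. *)
Lemma block_map_card_lt (X : finType) (f : X -> nat) i : block_map f -> #|X| =
  n ->
  #|[set x | (f x < i)%N]| =
  if i == 0%N then 0%N else
  if [pick j in J | (i <= j)%N] is Some j0
  then [arg min_(j < j0 | (j \in J) && (i <= j)%N) (j : nat)] : nat else n.
Proof.
move=> [lf cf] cX; case: eqP => [->|/eqP i0].
  by apply/eqP; rewrite cards_eq0; apply/eqP/setP => x; rewrite !inE.
case: pickP => [j0 Pj0|no].
  case: arg_minnP => //= j /andP[jJ le_j] minj; rewrite -(cf j jJ).
  apply: eq_card => x; rewrite !inE; apply/idP/idP => [/leq_trans|lt_j]; first
    exact.
  case: (lf x) lt_j => [-> _|[k kJ ->]]; first by rewrite lt0n.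
  by apply: contraTT; rewrite -!leqNgt => le_k; apply: minj; rewrite kJ.
rewrite -cX -cardsT; apply: eq_card => x; rewrite !inE.
case: (lf x) => [->|[k kJ ->]]; first by rewrite lt0n.
by have := no k; rewrite /= kJ /= ltnNge => ->.
Qed.

Lemma block_map_content (X : finType) (f : X -> nat) : block_map f -> #|X| = n
  ->
  forall k, #|[set x | f x == k]| = block_content k.
Proof.
move=> bf cX k; have e i : #|[set x | (f x < i)%N]| = #|[set x : 'I_n | (blk x
  < i)%N]|.
  by rewrite (block_map_card_lt i bf cX) (block_map_card_lt i block_map_blk)
    ?card_ord.
have := e k.+1; rewrite (@card_lt_sum _ xpredT f) (@card_lt_sum _ xpredT (fun x
  : 'I_n => blk x)).
rewrite !big_ord_recr /= -(@card_lt_sum _ xpredT f) -(@card_lt_sum _ xpredT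
  (fun x : 'I_n => blk x)).
by rewrite e => /addnI.
Qed.

Lemma content_block_map (X : finType) (f : X -> 'I_n) :
  (forall k : 'I_n, #|[set x | f x == k]| = block_content k) ->
  block_map (fun x => f x : nat).
Proof.
move=> ct; split=> [x|j jJ].
  have: (0 < block_content (f x))%N by rewrite -ct; apply/card_gt0P; exists x;
    rewrite inE.
  by case/card_gt0P => y; rewrite inE => /eqP <-; apply: blk_label.
rewrite -[RHS](block_map_blk.2 j jJ) (@card_lt_sum _ xpredT).
rewrite (@card_lt_sum _ xpredT (fun x : 'I_n => blk x)).
by apply: eq_bigr => k _; rewrite -[RHS](ct (widen_ord (ltnW (ltn_ord j)) k)).
Qed.

Lemma block_content_sum : (\sum_(i < n) block_content i = n)%N.
Proof.
rewrite -(@card_lt_sum _ xpredT (fun x : 'I_n => blk x)) -[RHS]card_ord -cardsT.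
by apply: eq_card => x; rewrite !inE (leq_ltn_trans (blk_le x)).
Qed.

End Blocks.

(** * Standard tableaux with descents in a given set *)

Section Standardization.
Variables (n : nat) (J : {set 'I_n}) (la : intpart n).
Local Notation filling_T := {ffun cell la -> 'I_n.+1}.
Local Notation filling_S := {ffun cell la -> 'I_n}.

Lemma card_cell : #|[set: cell la]| = n.
Proof.
transitivity #|[set x : cell la | (row_of x < n)%N]|.
  by apply: eq_card => x; rewrite !inE ltn_ord.
by rewrite (card_lt_row la (leqnn n)) part_sum.
Qed.

Lemma is_sytP (T : filling_T) :
  reflect [/\ injective T, forall c, (0 < T c)%N,
    forall c c', row_of c = row_of c' -> (col_of c < col_of c')%N -> (T c < T
      c')%N &
    forall c c', col_of c = col_of c' -> (row_of c < row_of c')%N -> (T c < T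
      c')%N]
  (is_syt T).
Proof.
apply: (iffP and4P) => [[/injectiveP i /forallP p /forallP r /forallP k]|[i p r
  k]].
  split=> // c c' e lt.
    by move/forallP: (r c) => /(_ c')/implyP; apply; rewrite e eqxx.
  by move/forallP: (k c) => /(_ c')/implyP; apply; rewrite e eqxx.
split; [exact/injectiveP | exact/forallP | |].
  by apply/forallP => c; apply/forallP => c'; apply/implyP => /andP[/eqP e lt];
    apply: r.
by apply/forallP => c; apply/forallP => c'; apply/implyP => /andP[/eqP e lt];
  apply: k.
Qed.

Lemma is_ssytP N (S : {ffun cell la -> 'I_N}) :
  reflect [/\
    forall c c', row_of c = row_of c' -> (col_of c < col_of c')%N -> (S c <= S
      c')%N &
    forall c c', col_of c = col_of c' -> (row_of c < row_of c')%N -> (S c < S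
      c')%N]
  (is_ssyt S).
Proof.
apply: (iffP andP) => [[/forallP r /forallP k]|[r k]].
  split=> // c c' e lt.
    by move/forallP: (r c) => /(_ c')/implyP; apply; rewrite e eqxx.
  by move/forallP: (k c) => /(_ c')/implyP; apply; rewrite e eqxx.
split.
  by apply/forallP => c; apply/forallP => c'; apply/implyP => /andP[/eqP e lt];
    apply: r.
by apply/forallP => c; apply/forallP => c'; apply/implyP => /andP[/eqP e lt];
  apply: k.
Qed.

Section SYT.
Variable T : filling_T.
Hypothesis sytT : is_syt T.

Lemma syt_pred_inj : injective (fun c => (T c).-1).
Proof.
have [injT posT _ _] := elimT (is_sytP _) sytT; move=> c c' e;
  apply/injT/val_inj => /=.
by rewrite -(prednK (posT c)) -(prednK (posT c')) e.
Qed.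

Lemma syt_pred_lt c : ((T c).-1 < #|{: cell la}|)%N.
Proof.
have [_ posT _ _] := elimT (is_sytP _) sytT; rewrite -cardsT card_cell prednK
  // leq_ord //.
Qed.

Lemma syt_nw c c' : (row_of c' <= row_of c)%N -> (col_of c' <= col_of c)%N ->
  (T c' <= T c)%N.
Proof.
have [_ _ rT cT] := elimT (is_sytP _) sytT; move=> le_r le_c.
have [x xr xc] := cell_above le_r; apply: (@leq_trans (T x)).
  move: le_c; rewrite leq_eqVlt => /orP[/eqP e|lt]; last by apply/ltnW/rT;
    rewrite ?xr ?xc.
  by have -> // : c' = x; apply: cell_inj; rewrite ?xr ?xc //; apply: val_inj.
move: le_r; rewrite leq_eqVlt => /orP[/eqP e|lt]; last by apply/ltnW/cT;
  rewrite ?xr ?xc.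
by have -> // : x = c; apply: cell_inj; rewrite ?xr ?xc //; apply: val_inj.
Qed.

(** When [i] is not a descent, the entry [i + 1] lies weakly above [i]; iterate along the run. *)
Lemma syt_run c c' : (T c <= T c')%N ->
  (forall i : 'I_n, (T c <= i < T c')%N -> i \notin Des T) ->
  (row_of c' <= row_of c)%N.
Proof.
have [injT posT _ _] := elimT (is_sytP _) sytT.
move=> /subnKC; move: (_ - _)%N => d; elim: d c' => [|d IH] c' e no.
  by rewrite (injT c' c) //; apply: val_inj; rewrite /= -e addn0.
have [c'' ec''] : exists c'', (T c'').-1 = (T c' - 2)%N.
  apply: (inj_lt_surj syt_pred_inj syt_pred_lt).
  by apply: leq_ltn_trans (syt_pred_lt c'); lia.
have eT : T c' = (T c'').+1 :> nat by have := posT c; have := posT c''; lia.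
have := IH c''; rewrite -(_ : (T c + d)%N = T c'') => [/(_ erefl) le_r|]; last
  by lia.
apply: leq_trans (le_r _) => [|i lt_i]; last by apply: no; lia.
have lt_n : (T c'' < n)%N by have := ltn_ord (T c'); lia.
rewrite leqNgt; apply/negP => lt_row; have /negP := no (Ordinal lt_n)
  ltac:(rewrite /=; lia).
apply; rewrite inE; apply/existsP; exists c''; apply/existsP; exists c'.
by rewrite eqxx lt_row eT eqxx.
Qed.

End SYT.

(** Entry [e] sits at position [e - 1], so a cut at [j] separates the entries [j] and [j + 1], which
    are the ones a descent at [j] compares. *)
Definition syt_blocks (T : filling_T) : filling_S :=
  [ffun c => insubd (row_of c) (blk J (T c).-1)].

(** Lexicographic order by value, then by column, packed in one number since columns are less than
    [n]. *)
Definition std_key (S : filling_S) c : nat := (S c * n + col_of c)%N.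

Definition ssyt_std (S : filling_S) : filling_T :=
  [ffun c => inord (krank (std_key S) c).+1].

Lemma syt_blocksE T c : syt_blocks T c = blk J (T c).-1 :> nat.
Proof.
rewrite ffunE insubdK //; apply: leq_ltn_trans (blk_le _ _) _.
by have := ltn_ord (T c); have := ltn_ord (row_of c); lia.
Qed.

Lemma std_key_lt (S : filling_S) c c' : (std_key S c < std_key S c')%N =
  (S c < S c')%N || (S c == S c') && (col_of c < col_of c')%N.
Proof.
rewrite /std_key; have := ltn_ord (col_of c); have := ltn_ord (col_of c').
rewrite -val_eqE /=; move: (nat_of_ord (S c)) (nat_of_ord (S c')) => a b h1 h2.
by case: (ltngtP a b) => [lt|lt|->] /=; [|apply/negbTE|rewrite ltn_add2l //];
  nia.
Qed.

Lemma std_key_inj (S : filling_S) : is_ssyt S -> injective (std_key S).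
Proof.
move=> sS c c' e; have := std_key_lt S c c'; have := std_key_lt S c' c.
rewrite e ltnn; case: (ltngtP (S c) (S c')) => // /val_inj eS.
rewrite eS eqxx /=; case: (ltngtP (col_of c) (col_of c')) => // /val_inj ec _ _.
exact: is_ssyt_col_inj sS c c' ec eS.
Qed.

Lemma syt_blocksP T : is_syt T -> Des T \subset J ->
  is_ssyt (syt_blocks T) /\
  forall i : 'I_n, #|[set x | syt_blocks T x == i]| = block_content J i.
Proof.
move=> sT DesJ; have [injT posT rT cT] := elimT (is_sytP _) sT; split.
  apply/is_ssytP; split=> c c' e lt; rewrite !syt_blocksE.
    by apply: blk_mono; have := rT c c' e lt; lia.
  have lt_T := cT c c' e lt.
  rewrite ltn_neqAle blk_mono ?andbT; last by lia.
  apply/negP => /eqP eb; move: lt; rewrite ltnNge (syt_run sT) ?(ltnW lt_T) //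
    => i lt_i.
  apply/negP => /(subsetP DesJ) iJ.
  have := blk_lt (T c).-1 iJ; rewrite eb blk_lt //; have := posT c; have :=
    posT c'; lia.
have bT : block_map J (fun c => blk J (T c).-1).
  split=> [c|j jJ]; first exact: blk_label.
  rewrite -[RHS](card_inj_lt (syt_pred_inj sT) (syt_pred_lt sT)).
    by apply: eq_card => c; rewrite !inE blk_lt.
  by rewrite -cardsT card_cell ltnW.
move=> i; have cX : #|{: cell la}| = n by rewrite -cardsT card_cell.
rewrite -(block_map_content bT cX); apply: eq_card => c.
by rewrite !inE -val_eqE /= syt_blocksE.
Qed.

Section SSYT.
Variable S : filling_S.
Hypotheses (ssytS : is_ssyt S)
  (contS : forall i : 'I_n, #|[set x | S x == i]| = block_content J i).

Let kr := krank (std_key S).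

Lemma ssyt_stdE c : ssyt_std S c = (kr c).+1 :> nat.
Proof.
rewrite ffunE inordK // ltnS; have := krank_lt_card (std_key S) c.
by rewrite -cardsT card_cell.
Qed.

(** For a cut [j], exactly [j] cells have value below [j], and they come first in the key order.
    Hence rank and value lie on the same side of every cut, and two labels with that property are
    equal. *)
Lemma blk_krank c : blk J (kr c) = S c.
Proof.
have [lS cS] := content_block_map contS.
have inj_key := std_key_inj ssytS.
apply: label_eq; [exact: blk_label | exact: lS | move=> j jJ].
rewrite blk_lt //; apply/idP/idP => [|lt_j].
  apply: contraTT; rewrite -!leqNgt => le_j; rewrite -(cS j jJ); apply:
    subset_leq_card.
  by apply/subsetP => c'; rewrite !inE => lt_c'; rewrite std_key_lt (leq_trans
    lt_c').
rewrite -[X in (_ < X)%N](cS j jJ); apply: proper_card; apply/properP; split.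
  apply/subsetP => c'; rewrite !inE std_key_lt => /orP[|/andP[/eqP -> //]].
  by move/ltn_trans; apply.
by exists c; rewrite !inE ?ltnn.
Qed.

Lemma ssyt_stdP : is_syt (ssyt_std S) /\ Des (ssyt_std S) \subset J.
Proof.
have inj_key := std_key_inj ssytS; have [rS cS] := elimT (is_ssytP _) ssytS.
split.
  apply/is_sytP; split.
  - move=> c c' /(congr1 val); rewrite /= !ssyt_stdE => -[]; exact: krank_inj.
  - by move=> c; rewrite ssyt_stdE.
  - move=> c c' e lt; rewrite !ssyt_stdE ltnS /kr krank_lt // std_key_lt lt
      andbT.
    by have := rS c c' e lt; rewrite leq_eqVlt -val_eqE orbC.
  - by move=> c c' e lt; rewrite !ssyt_stdE ltnS /kr krank_lt // std_key_lt cS.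
apply/subsetP => i; rewrite inE => /existsP[c /existsP[c' /and3P[]]].
rewrite !ssyt_stdE => /eqP ei /eqP [ei'] lt_row; apply/negPn/negP => iJ.
(* With no cut at [i], the entries [i] and [i + 1] come from equal values, which are ranked by
   column. So [c'] is strictly below and to the right of [c], and the cell in the row of [c] and the
   column of [c'] contradicts semistandardness. *)
have eS : S c = S c'.
  apply: val_inj; rewrite /= -!blk_krank; apply: blk_eq; first by lia.
  move=> j jJ; apply/negP => lt; case/negP: iJ.
  by rewrite (_ : i = j) //; apply: val_inj => /=; lia.
have: (std_key S c < std_key S c')%N by rewrite -(krank_lt inj_key) -/kr; lia.
rewrite std_key_lt eS ltnn eqxx /= => lt_col.
have [x xr xc] := cell_above (ltnW lt_row).
have := cS x c' xc; rewrite xr => /(_ lt_row); rewrite -eS ltnNge => /negP;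
  apply.
by apply: rS; rewrite ?xr ?xc.
Qed.

Lemma syt_blocksK : syt_blocks (ssyt_std S) = S.
Proof.
by apply/ffunP => c; apply: val_inj; rewrite /= syt_blocksE ssyt_stdE /=
  blk_krank.
Qed.

End SSYT.

(** Inside a block the entries of [T] move weakly up by [syt_run], hence strictly to the right by
    [syt_nw]: they already follow the key order. *)
Lemma ssyt_stdK T : is_syt T -> Des T \subset J -> ssyt_std (syt_blocks T) = T.
Proof.
move=> sT DesJ; have [sS _] := syt_blocksP sT DesJ; have [injT posT rT cT] :=
  elimT (is_sytP _) sT.
have lt_key c c' : (T c < T c')%N -> (std_key (syt_blocks T) c < std_key
  (syt_blocks T) c')%N.
  move=> lt; rewrite std_key_lt -val_eqE /= !syt_blocksE.
  have: (blk J (T c).-1 <= blk J (T c').-1)%N by apply: blk_mono; lia.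
  rewrite leq_eqVlt => /orP[/eqP eb|-> //]; rewrite eb eqxx ltnn /= ltnNge;
    apply/negP => le_c.
  have le := ltnW lt; move: lt; rewrite ltnNge => /negP; apply; apply: syt_nw
    => //.
  apply: (syt_run sT) => // i lt_i; apply/negP => /(subsetP DesJ) iJ.
  have := blk_lt (T c).-1 iJ; rewrite eb blk_lt //; have := posT c; have :=
    posT c'; lia.
have kE := @krank_eq _ (fun c => (T c).-1) (std_key (syt_blocks T))
  (syt_pred_inj sT) (syt_pred_lt sT).
apply/ffunP => c; apply: val_inj; rewrite /= ssyt_stdE kE ?prednK // => x y.
have := posT x; have := posT y => py px.
apply/idP/idP => [lt|]; first by apply: lt_key; lia.
apply: contraTT; rewrite -!leqNgt => le.
have: (T y <= T x)%N by lia.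
by rewrite leq_eqVlt => /orP[/eqP/val_inj/injT -> //|/lt_key/ltnW].
Qed.

Lemma card_syt_Des_sub :
  #|[set T : filling_T | is_syt T & Des T \subset J]| = kostka la
    (block_content J).
Proof.
apply: (card_bij_in (f := syt_blocks) (g := ssyt_std)) => [T|S]; rewrite !inE.
  case/andP=> sT DesJ; have [sS cS] := syt_blocksP sT DesJ; split; last exact:
    ssyt_stdK.
  by rewrite sS; apply/forallP => i; rewrite cS.
case/andP=> sS /forallP cS; have cS' i := eqP (cS i).
by split; [apply/andP; apply: ssyt_stdP | apply: syt_blocksK].
Qed.

End Standardization.

(** * Specht modules *)

(** [P] is a projection onto [U], so a trace on the submodule becomes a trace on the ambient
    space. *)
Lemma mxtrace_submod_proj (F : fieldType) (gT : finGroupType) (G : {group gT}) d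
    (rG : mx_representation F G d) (U P : 'M_d) (modU : mxmodule rG U) x :
  x \in G -> (P <= U)%MS -> U *m P = U ->
  \tr (submod_repr modU x) = \tr (rG x *m P).
Proof.
move=> Gx sPU UP.
have fixU m (W : 'M_(m, d)) : (W <= U)%MS -> W *m P = W.
  by case/submxP => D ->; rewrite -mulmxA UP.
rewrite -[submod_repr _ x]/(in_submod U (val_submod 1%:M *m rG x)).
rewrite -(fixU _ (val_submod 1%:M *m rG x)); last first.
  exact: mxmodule_trans modU Gx (val_submodP _).
have e : P *m (in_submod U 1%:M *m val_submod 1%:M) = P.
  by rewrite mulmxA -in_submodE -val_submodE in_submodK.
rewrite in_submodE; move: (in_submod U 1%:M) (val_submod 1%:M) e => I V e.
by rewrite -!mulmxA mxtrace_mulC -!mulmxA e.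
Qed.

Section SpechtKernel.
Variables (n : nat) (la : intpart n).
Local Notation Omega := (row_map n).
Local Notation ract := (@row_map_act n).
Local Notation tabs := (tableaux la).
Implicit Types (T : filling la) (r : Omega) (s g : 'S_n).

(** Ordered set partitions with block sizes [c], encoded like tabloids; [c] may be any content. *)
Definition rows_of (c : nat -> nat) : {set Omega} :=
  [set r : row_map n | [forall i : 'I_n, #|[set k | r k == i]| == c i]].

Lemma rows_ofP (c : nat -> nat) r :
  reflect (forall i : 'I_n, #|[set k | r k == i]| = c i) (r \in rows_of c).
Proof. by rewrite inE; apply: 'forall_eqP. Qed.

Lemma tabloidsE : tabloids la = rows_of (row_len (part la)).
Proof. by apply/setP => r; rewrite !inE; apply: eq_forallb => i; rewrite
  row_lenE. Qed.

Lemma ractM r s g : ract r (s * g)%g = ract (ract r s) g.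
Proof. exact: (row_map_actM r). Qed.

Lemma ractK s : cancel (ract^~ s) (ract^~ s^-1%g).
Proof. by move=> r; rewrite -ractM mulgV; apply: row_map_act1. Qed.

Lemma ractKV s : cancel (ract^~ s^-1%g) (ract^~ s).
Proof. by move=> r; rewrite -ractM mulVg; apply: row_map_act1. Qed.

Lemma ract_inj s : injective (ract^~ s).
Proof. exact: can_inj (ractK s). Qed.

Lemma rows_of_act c r s : (ract r s \in rows_of c) = (r \in rows_of c).
Proof.
rewrite !inE; apply: eq_forallb => i; congr (_ == _).
rewrite -[RHS](card_imset _ (@perm_inj _ s)); apply: eq_card => k; rewrite inE
  ffunE.
by rewrite -[k in RHS](permKV s) mem_imset ?inE //; apply: perm_inj.
Qed.

Lemma tableau_bij T : T \in tabs -> exists2 T', cancel T T' & cancel T' T.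
Proof.
rewrite inE => /injectiveP injT.
by have [|T' TK T'K] := inj_card_bij injT; [rewrite card_ord -cardsT card_cell
  | exists T'].
Qed.

Lemma tableau_exists : exists T, T \in tabs.
Proof.
have e : #|{: cell la}| = n by rewrite -cardsT card_cell.
exists [ffun c => cast_ord e (enum_rank c)]; rewrite inE; apply/injectiveP => c
  c'.
by rewrite !ffunE => /cast_ord_inj/enum_rank_inj.
Qed.

Lemma tableaux_trans T1 T2 : T1 \in tabs -> T2 \in tabs ->
  exists g, T2 = filling_act T1 g.
Proof.
move=> /tableau_bij[T1' K1 K1'] /tableau_bij[T2' K2 K2'].
have inj_g : injective (fun k => T2 (T1' k)).
  by move=> a b /(can_inj K2)/(can_inj K1').
by exists (perm inj_g); apply/ffunP => c; rewrite ffunE permE K1.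
Qed.

Section ColumnAntisymmetry.
Variables (T : filling la) (T' : 'I_n -> cell la).
Hypotheses (TK : cancel T T') (T'K : cancel T' T).

Lemma col_stabP s :
  reflect (forall k, col_of (T' (s k)) = col_of (T' k)) (s \in col_stab T).
Proof.
rewrite inE; apply: (iffP idP) => [/forallP h k|h].
  have := h (T' k) => /forallP/(_ (T' (s k)))/implyP.
  by rewrite !T'K eqxx => /(_ isT)/eqP.
apply/forallP => c; apply/forallP => c'; apply/implyP => /eqP e.
by have := h (T c); rewrite e !TK => ->.
Qed.

Definition tabloid : Omega := [ffun k => row_of (T' k)].

Lemma polytabloid_antisym r s : s \in col_stab T ->
  polytabloid_coef T (ract r s) = (-1) ^+ s * polytabloid_coef T r.
Proof.
move=> sC; rewrite /polytabloid_coef (reindex_inj (mulIg s)) /= mulr_sumr.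
apply: eq_big => [u|u _]; last by rewrite odd_permM signr_addb mulrC.
congr (_ && _).
  apply/col_stabP/col_stabP => h k; have := h k; rewrite permM.
    by rewrite (col_stabP _ sC).
  by rewrite (col_stabP _ sC).
by apply: eq_forallb => c; rewrite !ffunE permM permK.
Qed.

Lemma polytabloid_diag : polytabloid_coef T tabloid = 1.
Proof.
rewrite /polytabloid_coef (big_pred1 1%g) ?odd_perm1 // => u.
apply/andP/eqP => [[/col_stabP uC /forallP h]|->].
  apply/permP => k; rewrite perm1; apply: (can_inj T'K); apply: cell_inj => //.
  by have := h (T' k); rewrite !ffunE T'K => /eqP.
split; first by apply/col_stabP => k; rewrite perm1.
by apply/forallP => c; rewrite !ffunE perm1 TK.
Qed.

Lemma card_tableau_fiber r (i : 'I_n) :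
  #|[set c | r (T c) == i]| = #|[set k | r k == i]|.
Proof.
rewrite -(card_imset _ (can_inj TK)); apply: eq_card => k; rewrite inE.
by rewrite -[k in LHS]T'K mem_imset ?inE ?T'K //; apply: can_inj TK.
Qed.

Lemma tabloid_in : tabloid \in tabloids la.
Proof.
rewrite tabloidsE; apply/rows_ofP => i; rewrite row_lenE -card_row
  -card_tableau_fiber.
by apply: eq_card => c; rewrite !inE ffunE TK.
Qed.

Lemma polytabloid_support r : polytabloid_coef T r != 0 -> r \in tabloids la.
Proof.
apply: contraNT => nr; rewrite /polytabloid_coef big_pred0 // => u.
apply/negP => /andP[_ /forallP h]; case/negP: nr; rewrite tabloidsE
  -(rows_of_act _ r u^-1%g).
rewrite -tabloidsE (_ : ract r u^-1%g = tabloid) ?tabloid_in //.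
by apply/ffunP => k; rewrite !ffunE invgK; have := h (T' k); rewrite !ffunE T'K
  => /eqP.
Qed.

Section Antisymmetric.
Variable u : Omega -> rat.
Hypothesis anti_u : forall r s, s \in col_stab T -> u (ract r s) = (-1) ^+ s *
  u r.

(** If [r] puts two entries of one column of [T] in the same row, their transposition is an odd
    column permutation fixing [r], so [u r = - u r]. *)
Lemma antisym_col_inj r : u r != 0 ->
  forall c c', col_of c = col_of c' -> r (T c) = r (T c') -> c = c'.
Proof.
move=> nz c c' ec er; apply/eqP; apply: contraNT nz => ne.
have sC : tperm (T c) (T c') \in col_stab T.
  apply/col_stabP => k; case: tpermP => [->|->|//]; by rewrite !TK.
have := anti_u r sC.
have -> : ract r (tperm (T c) (T c')) = r.
  by apply/ffunP => k; rewrite ffunE tpermV; case: tpermP => [->|->|//].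
rewrite odd_tperm (inj_eq (can_inj TK)) ne expr1 mulN1r => /eqP.
by rewrite -addr_eq0 -mulr2n mulrn_eq0.
Qed.

Lemma antisym_dominates d r : r \in rows_of d -> u r != 0 -> dominates la d.
Proof.
move=> /rows_ofP ct nz; apply: (@content_dominates _ _ (fun c => r (T c))).
  exact: antisym_col_inj nz.
by move=> i; rewrite card_tableau_fiber.
Qed.

End Antisymmetric.

(** By [content_shape_col], each column of [T] meets under [r] the same rows as in [T] itself, so a
    permutation inside the columns carries the tabloid of [T] to [r]. *)
Lemma col_inj_tabloid r : r \in tabloids la ->
  (forall c c', col_of c = col_of c' -> r (T c) = r (T c') -> c = c') ->
  exists2 s, s \in col_stab T & r = ract tabloid s.
Proof.
rewrite tabloidsE => /rows_ofP ct inj_r.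
have ct' (i : 'I_n) : #|[set c | r (T c) == i]| = la i.
  by rewrite card_tableau_fiber ct row_lenE.
have ex (c : cell la) : exists c', (col_of c' == col_of c) && (r (T c') ==
  row_of c).
  have := content_shape_col inj_r (row_of c) (col_of c) ct'.
  have: (0 < #|[set x : cell la | col_of x == col_of c & row_of x == row_of
    c]|)%N.
    by apply/card_gt0P; exists c; rewrite inE !eqxx.
  by move=> gt0 e; move: gt0; rewrite -e => /card_gt0P[c']; rewrite inE; exists
    c'.
pose phi c := xchoose (ex c).
have phiP c : col_of (phi c) = col_of c /\ r (T (phi c)) = row_of c.
  by have /andP[/eqP ? /eqP ?] := xchooseP (ex c).
have inj_s : injective (fun k => T (phi (T' k))).
  move=> a b /(can_inj TK) e; apply: (can_inj T'K).
  have [ca ra] := phiP (T' a); have [cb rb] := phiP (T' b).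
  by apply: cell_inj; [rewrite -ra -rb e | rewrite -ca -cb e].
exists (perm inj_s).
  by apply/col_stabP => k; rewrite permE TK; case: (phiP (T' k)).
apply: (@ract_inj (perm inj_s)^-1%g); rewrite /= ractK.
by apply/ffunP => k; rewrite !ffunE invgK permE; case: (phiP (T' k)).
Qed.

(** On the tabloids of shape [la], a column-antisymmetric function lives on the column orbit of the
    tabloid of [T], where signs determine it up to a scalar. This replaces irreducibility in what
    follows. *)
Lemma antisym_polytabloid u r :
  (forall r s, s \in col_stab T -> u (ract r s) = (-1) ^+ s * u r) ->
  r \in tabloids la -> u r = u tabloid * polytabloid_coef T r.
Proof.
move=> anti_u rt; have [e0|nz] := eqVneq (polytabloid_coef T r) 0.
  rewrite e0 mulr0; apply/eqP; apply: contra_eqT e0 => nz.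
  have [s sC ->] := col_inj_tabloid rt (antisym_col_inj anti_u nz).
  by rewrite polytabloid_antisym // polytabloid_diag mulr1 signr_eq0.
have [s sC ->] := col_inj_tabloid rt (antisym_col_inj polytabloid_antisym nz).
by rewrite polytabloid_antisym // polytabloid_diag mulr1 anti_u // mulrC.
Qed.

End ColumnAntisymmetry.

(** * Equivariant kernels on polytabloids *)

Definition equivariant (X : Omega -> Omega -> rat) :=
  forall r r' g, X (ract r g) (ract r' g) = X r r'.

Lemma polytabloid_act T r g :
  polytabloid_coef (filling_act T g) (ract r g) = polytabloid_coef T r.
Proof. exact: polytabloid_coef_inv. Qed.

Lemma kernel_antisym T X : T \in tabs -> equivariant X -> forall r s, s \in
  col_stab T ->
  \sum_r1 polytabloid_coef T r1 * X r1 (ract r s) =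
  (-1) ^+ s * \sum_r1 polytabloid_coef T r1 * X r1 r.
Proof.
move=> /tableau_bij[T' TK T'K] eqX r s sC.
rewrite (reindex_inj (@ract_inj s)) mulr_sumr /=; apply: eq_bigr => r1 _.
by rewrite eqX (polytabloid_antisym TK T'K) // mulrA.
Qed.

(** The image of a polytabloid under an equivariant kernel is again column-antisymmetric, and
    [antisym_dominates] restricts where it can be nonzero. *)
Lemma kernel_polytabloid_eq0 T X d r : T \in tabs -> equivariant X ->
  r \in rows_of d -> ~ dominates la d ->
  \sum_r1 polytabloid_coef T r1 * X r1 r = 0.
Proof.
move=> tT eqX rd nd; apply/eqP/negPn/negP => nz; apply: nd.
have [T' TK T'K] := tableau_bij tT.
exact: (antisym_dominates TK T'K (kernel_antisym tT eqX) rd nz).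
Qed.

Definition std_tableau : filling la := xchoose tableau_exists.

Lemma std_tableauP : std_tableau \in tabs.
Proof. exact: xchooseP. Qed.

(** An explicit Schur lemma. The image of a polytabloid is column-antisymmetric, hence a multiple of
    it. The multiplier is read off at the tabloid [r0] of [std_tableau], and is common to all
    tableaux because ['S_n] permutes them transitively. *)
Lemma kernel_eigen_exists : exists r0, 
  [/\ r0 \in tabloids la, polytabloid_coef std_tableau r0 = 1 &
  forall X, equivariant X -> forall T r, T \in tabs -> r \in tabloids la ->
  \sum_r1 polytabloid_coef T r1 * X r1 r =
  (\sum_r1 polytabloid_coef std_tableau r1 * X r1 r0) * polytabloid_coef T r].
Proof.
have [T' TK T'K] := tableau_bij std_tableauP.
exists (tabloid T'); split; [exact: tabloid_in TK T'K | exact: polytabloid_diag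
  | ].
move=> X eqX T r tT rt.
have [g ->] := tableaux_trans std_tableauP tT.
rewrite -[r](ractKV g) polytabloid_act (reindex_inj (@ract_inj g)) /=.
under eq_bigr => r1 _ do rewrite polytabloid_act eqX.
rewrite (antisym_polytabloid TK T'K (kernel_antisym std_tableauP eqX)) //.
by rewrite tabloidsE rows_of_act -tabloidsE.
Qed.

End SpechtKernel.

Lemma sum_delta_l (X : finType) (F : X -> rat) y :
  \sum_x F x * (x == y)%:R = F y.
Proof.
by rewrite (bigD1 y) //= eqxx mulr1 big1 ?addr0 // => x /negbTE ->; rewrite
  mulr0.
Qed.

Definition perm_char n (c : nat -> nat) (s : 'S_n) : rat :=
  #|[set r in rows_of n c | row_map_act r s == r]|%:R.

Lemma perm_charE n c (s : 'S_n) : perm_char c s =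
  \sum_(r : row_map n) (r \in rows_of n c)%:R * (row_map_act r s == r)%:R.
Proof.
rewrite /perm_char -sum1_card natr_sum big_mkcond; apply: eq_bigr => r _.
by rewrite inE -natrM mulnb; case: (_ && _).
Qed.

Lemma row_map_act_fixV n (r : row_map n) s :
  (row_map_act r s^-1%g == r) = (row_map_act r s == r).
Proof.
by rewrite -(inj_eq (@ract_inj n s)) ractKV eq_sym.
Qed.

Lemma perm_charV n c (s : 'S_n) : perm_char c s^-1%g = perm_char c s.
Proof. by rewrite !perm_charE; apply: eq_bigr => r _; rewrite row_map_act_fixV.
  Qed.

(** * Scalar products with the Specht character *)

Section SpechtCharacter.
Variables (n : nat) (la : intpart n).
Local Notation Omega := (row_map n).
Local Notation ract := (@row_map_act n).
Local Notation tabs := (tableaux la).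
Implicit Types (T : filling la) (r : Omega) (s g : 'S_n).

(** The operator [B^T B], where the rows of [B] are the polytabloids: symmetric, equivariant, and a
    nonzero multiple of the orthogonal projection onto the Specht module. *)
Definition specht_kernel r r' : rat :=
  \sum_(T in tabs) polytabloid_coef T r * polytabloid_coef T r'.
Local Notation E := specht_kernel.

Lemma specht_kernel_sym r r' : E r r' = E r' r.
Proof. by apply: eq_bigr => T _; rewrite mulrC. Qed.

Lemma specht_kernel_equivariant : equivariant E.
Proof.
move=> r r' g; rewrite /E (reindex_inj (act_inj (filling_action la) g)) /=.
apply: eq_big => [T|T _]; last by rewrite !polytabloid_act.
exact: (acts_in (tableaux_acts la)).
Qed.

Lemma specht_kernel_support r r' : r' \notin tabloids la -> E r r' = 0.
Proof.
move=> nr; apply: big1 => T tT; have [T' TK T'K] := tableau_bij tT.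
have [->|/(polytabloid_support TK T'K)] := eqVneq (polytabloid_coef T r') 0.
  by rewrite mulr0.
by rewrite (negbTE nr).
Qed.

(* The kernel of the (unnormalised) average over 'S_n of the elementary      *)
(* matrix with entry 1 at (r1, r2).                                           *)
Definition orbit_kernel r1 r2 a b : rat :=
  \sum_g (ract r1 g == a)%:R * (ract r2 g == b)%:R.

Lemma orbit_kernel_equivariant r1 r2 : equivariant (orbit_kernel r1 r2).
Proof.
move=> a b h; rewrite /orbit_kernel (reindex_inj (mulIg h)) /=.
by apply: eq_bigr => g _; rewrite !ractM !(inj_eq (@ract_inj n h)).
Qed.

Lemma sum_orbit_kernel F r1 r2 b :
  \sum_a F a * orbit_kernel r1 r2 a b =
  \sum_g F (ract r1 g) * (ract r2 g == b)%:R.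
Proof.
under eq_bigr => a _ do rewrite mulr_sumr.
rewrite exchange_big /=; apply: eq_bigr => g _.
transitivity (\sum_a (F a * (ract r2 g == b)%:R) * (a == ract r1 g)%:R).
  by apply: eq_bigr => a _; rewrite [a == _]eq_sym; ring.
by rewrite sum_delta_l.
Qed.

Section Eigen.
Variable r0 : Omega.
Local Notation e0 := (polytabloid_coef (std_tableau la)).
Definition eigval (X : Omega -> Omega -> rat) := \sum_r e0 r * X r r0.
Hypotheses (r0t : r0 \in tabloids la) (e0r0 : e0 r0 = 1)
  (eigX : forall X, equivariant X -> forall T r, T \in tabs -> r \in tabloids
    la ->
     \sum_r1 polytabloid_coef T r1 * X r1 r = eigval X * polytabloid_coef T r).
Let c0 := eigval E.

Lemma specht_kernel_eigen X r r' : equivariant X -> r' \in tabloids la ->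
  \sum_r1 E r r1 * X r1 r' = eigval X * E r r'.
Proof.
move=> eqX r't; under eq_bigr => r1 _ do rewrite mulr_suml.
rewrite exchange_big /= mulr_sumr; apply: eq_bigr => T tT.
under eq_bigr => r1 _ do rewrite -mulrA.
by rewrite -mulr_sumr eigX // mulrCA.
Qed.

Lemma specht_kernel_idem r r' : \sum_r1 E r r1 * E r1 r' = c0 * E r r'.
Proof.
have [r't|nr] := boolP (r' \in tabloids la).
  exact: specht_kernel_eigen specht_kernel_equivariant r't.
rewrite (specht_kernel_support r nr) mulr0 big1 // => r1 _.
by rewrite (specht_kernel_support r1 nr) mulr0.
Qed.

(** The quadratic form of [E] at [e0] equals [c0] times the squared norm [N] of [e0]. It is also a
    sum of squares, one of which is [N ^+ 2]. *)
Lemma eigval_neq0 : c0 != 0.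
Proof.
pose N := \sum_r e0 r ^+ 2.
have N_gt0 : 0 < N.
  rewrite /N (bigD1 r0) //= e0r0 expr1n ltr_pwDl // sumr_ge0 // => r _.
  exact: sqr_ge0.
have e : c0 * N = \sum_(T in tabs) (\sum_r e0 r * polytabloid_coef T r) ^+ 2.
  rewrite /N mulr_sumr.
  transitivity (\sum_r e0 r * \sum_r1 e0 r1 * E r1 r).
    apply: eq_bigr => r _; have [rt|nr] := boolP (r \in tabloids la).
      rewrite (eigX specht_kernel_equivariant (std_tableauP la) rt) -/c0.
      by rewrite expr2 mulrCA.
    have [T' TK T'K] := tableau_bij (std_tableauP la).
    have -> : e0 r = 0 by apply/eqP; apply: contraNT nr; apply:
      (polytabloid_support TK T'K).
    by rewrite expr0n mulr0 mul0r.
  under eq_bigr => r _ do rewrite mulr_sumr.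
  under eq_bigr => r _ do under eq_bigr => r1 _ do rewrite !mulr_sumr.
  under eq_bigr => r _ do rewrite exchange_big /=.
  rewrite exchange_big /=; apply: eq_bigr => T _.
  rewrite expr2 mulr_suml; apply: eq_bigr => r _; rewrite mulr_sumr.
  by apply: eq_bigr => r1 _; ring.
apply/eqP => c00; move: e; rewrite c00 mul0r => /esym/eqP.
rewrite gt_eqF // (bigD1 (std_tableau la)) ?std_tableauP //=.
have -> : \sum_r e0 r * e0 r = N by apply: eq_bigr => r _; rewrite expr2.
by rewrite ltr_pwDl ?exprn_gt0 // sumr_ge0 // => T _; apply: sqr_ge0.
Qed.

Lemma sum_tabloids (F : Omega -> rat) : (forall r, r \notin tabloids la -> F r
  = 0) ->
  \sum_(i < #|tabloids la|) F (enum_val i) = \sum_r F r.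
Proof.
move=> F0; rewrite -(big_enum_val F) /= big_mkcond /=.
by apply: eq_bigr => r _; case: ifP => // /negbT/F0 ->.
Qed.

Lemma specht_charE s : specht_char la s = c0^-1 * \sum_r E (ract r s) r.
Proof.
pose B := kernel_mx (@polytabloid_coef n la) tabs (tabloids la).
pose P := c0^-1 *: kernel_mx E (tabloids la) (tabloids la).
have EB : kernel_mx E (tabloids la) (tabloids la) = B^T *m B.
  apply/matrixP => i j; rewrite !mxE; under [RHS]eq_bigr => k _ do rewrite !mxE.
  by rewrite -(big_enum_val (fun T => polytabloid_coef T (enum_val i) *
    polytabloid_coef T (enum_val j))).
have BP : B *m P = B.
  rewrite -scalemxAr; apply/matrixP => i j; rewrite !mxE.
  under eq_bigr => k _ do rewrite !mxE.
  rewrite (@sum_tabloids (fun r => polytabloid_coef (enum_val i) r * E r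
    (enum_val j))).
    by rewrite (eigX specht_kernel_equivariant) ?enum_valP // mulrA mulVf
      ?eigval_neq0 // mul1r.
  by move=> r nr; rewrite specht_kernel_sym specht_kernel_support // mulr0.
rewrite /specht_char /character /specht_repr (@mxtrace_submod_proj _ _ _ _ _ _
  P) ?in_setT //.
- rewrite mxtrace_mulC -scalemxAl mxtraceZ mxtrace_mulC; congr (_ * _); rewrite
    /mxtrace.
  under eq_bigr => i _.
    rewrite !mxE; under eq_bigr => k _ do rewrite !mxE.
    rewrite (sum_orbit_delta (tabloids_acts la) (fun r => E r (enum_val i)))
      ?enum_valP //.
  over.
  rewrite (@sum_tabloids (fun r => E (ract r s) r)) // => r nr.
  exact: specht_kernel_support.
- by rewrite genmxE scalemx_sub // EB submxMl.
- have /submxP[D ->] : (<<B>> <= B)%MS by rewrite genmxE.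
  by rewrite -mulmxA BP.
Qed.

Lemma specht_charV s : specht_char la s^-1%g = specht_char la s.
Proof.
rewrite !specht_charE; congr (_ * _); rewrite (reindex_inj (@ract_inj n s)) /=.
by apply: eq_bigr => r _; rewrite ractK specht_kernel_sym.
Qed.

(** Schur orthogonality: summing the translates of an elementary matrix gives [orbit_kernel], which
    acts on the Specht module by the scalar [eigval]. Two kernels [Q] absorbed by [E] are of
    interest, the projection [c0^-1 * E] and the identity on tabloids. *)
Lemma specht_dot_aux (Q : Omega -> Omega -> rat) :
  (forall b r, b \notin tabloids la -> Q b r = 0) ->
  (forall r1 r2, \sum_b E r1 b * Q b r2 = E r1 r2) ->
  \sum_g (\sum_r1 E r1 (ract r1 g)) * (\sum_r2 Q (ract r2 g) r2) = #|{:
    'S_n}|%:R * c0.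
Proof.
move=> Q0 EQ.
transitivity (\sum_r1 \sum_r2 \sum_g E r1 (ract r1 g) * Q (ract r2 g) r2).
  under eq_bigr => g _ do rewrite mulr_suml.
  rewrite exchange_big /=; apply: eq_bigr => r1 _.
  by under eq_bigr => g _ do rewrite mulr_sumr; rewrite exchange_big.
transitivity (\sum_r1 \sum_r2 eigval (orbit_kernel r1 r2) * E r1 r2).
  apply: eq_bigr => r1 _; apply: eq_bigr => r2 _.
  rewrite -EQ mulr_sumr.
  transitivity (\sum_b (\sum_g E r1 (ract r1 g) * (ract r2 g == b)%:R) * Q b
    r2).
    under [RHS]eq_bigr => b _ do rewrite mulr_suml.
    rewrite exchange_big /=; apply: eq_bigr => g _.
    under eq_bigr => b _ do rewrite -mulrA [_ * Q b r2]mulrC mulrA eq_sym.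
    by rewrite (sum_delta_l (fun b => E r1 (ract r1 g) * Q b r2)).
  apply: eq_bigr => b _; rewrite -sum_orbit_kernel.
  have [bt|nb] := boolP (b \in tabloids la); last by rewrite Q0 // !mulr0.
  by rewrite (specht_kernel_eigen _ (orbit_kernel_equivariant r1 r2)) // mulrA.
rewrite /eigval.
under eq_bigr => r1 _ do under eq_bigr => r2 _ do rewrite mulr_suml.
under eq_bigr => r1 _ do rewrite exchange_big.
rewrite exchange_big /= mulr_sumr; apply: eq_bigr => r _.
transitivity (e0 r * \sum_r2 \sum_r1 E r1 r2 * orbit_kernel r1 r2 r r0).
  rewrite mulr_sumr exchange_big /=; apply: eq_bigr => r1 _; rewrite mulr_sumr.
  by apply: eq_bigr => r2 _; ring.
rewrite mulrCA; congr (_ * _); rewrite /orbit_kernel.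
transitivity (\sum_g \sum_r2 \sum_r1 E r1 r2 * ((ract r1 g == r)%:R * (ract r2
  g == r0)%:R)).
  rewrite [RHS]exchange_big; apply: eq_bigr => r2 _ /=; rewrite
    [RHS]exchange_big /=.
  by apply: eq_bigr => r1 _; rewrite mulr_sumr.
rewrite mulr_natl -sumr_const; apply: eq_bigr => g _.
transitivity (\sum_r2 E (ract r g^-1%g) r2 * (ract r2 g == r0)%:R).
  apply: eq_bigr => r2 _.
  under eq_bigr => r1 _ do rewrite mulrCA mulrA [_ * E r1 r2]mulrC -mulrA [X in
    _ * X]mulrC mulrA
     -[ract r1 g == r](inj_eq (@ract_inj n g^-1%g)) ractK.
  by rewrite (sum_delta_l (fun r1 => E r1 r2 * (ract r2 g == r0)%:R)).
under eq_bigr => r2 _ do rewrite -[ract r2 g == r0](inj_eq (@ract_inj n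
  g^-1%g)) ractK.
by rewrite sum_delta_l -(specht_kernel_equivariant _ _ g) !ractKV.
Qed.

Lemma char_dot_specht (Q : Omega -> Omega -> rat) :
  (forall b r, b \notin tabloids la -> Q b r = 0) ->
  (forall r1 r2, \sum_b E r1 b * Q b r2 = E r1 r2) ->
  char_dot (specht_char la) (fun g => \sum_r Q (ract r g^-1%g) r) = 1.
Proof.
move=> Q0 EQ; have nz : (#|{: 'S_n}|%:R : rat) != 0.
  by rewrite pnatr_eq0 -lt0n; apply/card_gt0P; exists 1%g.
rewrite /char_dot; under eq_bigr => g _ do rewrite specht_charE invgK -mulrA.
rewrite -mulr_sumr.
under eq_bigr => g _ do under eq_bigr => r _ do rewrite specht_kernel_sym.
by rewrite specht_dot_aux // mulrCA mulKf // mulVf // eigval_neq0.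
Qed.

Lemma specht_norm1 : char_dot (specht_char la) (specht_char la) = 1.
Proof.
rewrite -[RHS](@char_dot_specht (fun r r' => c0^-1 * E r r')) /char_dot.
- congr (_ * _); apply: eq_bigr => g _; congr (_ * _).
  by rewrite -mulr_sumr invgK specht_charV specht_charE.
- by move=> b r nb; rewrite specht_kernel_sym specht_kernel_support // mulr0.
move=> r1 r2; under eq_bigr => b _ do rewrite mulrCA.
by rewrite -mulr_sumr specht_kernel_idem mulrA mulVf ?eigval_neq0 // mul1r.
Qed.

Lemma specht_dot_diag :
  char_dot (specht_char la) (perm_char (row_len (part la))) = 1.
Proof.
rewrite -[RHS](@char_dot_specht (fun r r' => (r' \in tabloids la)%:R * (r ==
  r')%:R)) /char_dot.
- congr (_ * _); apply: eq_bigr => g _; congr (_ * _).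
  by rewrite perm_charE invgK; apply: eq_bigr => r _; rewrite -tabloidsE
    row_map_act_fixV.
- move=> b r nb; case: (b =P r) => [<-|]; last by rewrite mulr0.
  by rewrite (negbTE nb) mul0r.
move=> r1 r2; under eq_bigr => b _ do rewrite mulrA.
rewrite (sum_delta_l (fun b => E r1 b * (r2 \in tabloids la)%:R)).
by have [_|nr] := boolP (r2 \in tabloids la); rewrite ?mulr1 // mulr0
  specht_kernel_support.
Qed.

Lemma specht_dot_eq0 d : ~ dominates la d ->
  char_dot (specht_char la) (perm_char d) = 0.
Proof.
move=> nd; rewrite /char_dot.
transitivity (#|{: 'S_n}|%:R^-1 * \sum_r1 \sum_r2 c0^-1 * ((r2 \in rows_of n
  d)%:R *
   \sum_g E r1 (ract r1 g) * (ract r2 g == r2)%:R)).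
  congr (_ * _).
  under eq_bigr => g _ do rewrite specht_charE perm_charV perm_charE [c0^-1 *
    _]mulr_sumr mulr_suml.
  rewrite exchange_big /=; apply: eq_bigr => r1 _.
  under eq_bigr => g _ do rewrite mulr_sumr.
  rewrite exchange_big /=; apply: eq_bigr => r2 _.
  rewrite !mulr_sumr; apply: eq_bigr => g _; rewrite specht_kernel_sym; ring.
rewrite big1 ?mulr0 // => r1 _; apply: big1 => r2 _.
have [rd|] := boolP (r2 \in rows_of n d); last by rewrite mul0r mulr0.
rewrite -sum_orbit_kernel.
under eq_bigr => a _ do rewrite mulr_suml.
rewrite exchange_big /= big1 ?mulr0 // => T tT.
under eq_bigr => a _ do rewrite -mulrA.
rewrite -mulr_sumr (kernel_polytabloid_eq0 tT (orbit_kernel_equivariant r1 r2)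
  rd nd).
by rewrite mulr0.
Qed.

End Eigen.

Lemma specht_char_facts :
  [/\ forall s, specht_char la s^-1%g = specht_char la s,
      char_dot (specht_char la) (specht_char la) = 1,
      char_dot (specht_char la) (perm_char (row_len (part la))) = 1 &
      forall d, ~ dominates la d -> char_dot (specht_char la) (perm_char d) =
        0].
Proof.
have [r0 [r0t e0r0 eig]] := kernel_eigen_exists la.
by split; [exact: specht_charV eig | exact: specht_norm1 eig |
   exact: specht_dot_diag eig | exact: specht_dot_eq0 eig].
Qed.

End SpechtCharacter.

(** * Young's rule *)

Lemma card_imset_eq_ker (X Y Z : finType) (S : {set X}) (f : X -> Y) (g : X ->
  Z) :
  (forall x y, x \in S -> y \in S -> (f x = f y <-> g x = g y)) ->
  #|f @: S| = #|g @: S|.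
Proof.
move=> e; pose D := (fun x => (f x, g x)) @: S.
have -> : f @: S = fst @: D by rewrite /D -imset_comp; apply: eq_imset.
have -> : g @: S = snd @: D by rewrite /D -imset_comp; apply: eq_imset.
have inj1 : {in D &, injective fst}.
  move=> u v; rewrite /D => /imsetP[x xS ->] /imsetP[y yS ->] /= eq.
  by rewrite eq ((e x y xS yS).1 eq).
have inj2 : {in D &, injective snd}.
  move=> u v; rewrite /D => /imsetP[x xS ->] /imsetP[y yS ->] /= eq.
  by rewrite eq ((e x y xS yS).2 eq).
by rewrite (card_in_imset inj1) (card_in_imset inj2).
Qed.

(** * Pairs of tabloids and contingency tables *)

Section PairMaps.
Variable n : nat.
Local Notation pmap := {ffun 'I_n -> 'I_n * 'I_n}.
Implicit Types f : pmap.

Definition pmap_act f (s : 'S_n) : pmap := [ffun k => f (s^-1%g k)].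

Lemma pmap_act1 : pmap_act^~ 1%g =1 id.
Proof. by move=> f; apply/ffunP => k; rewrite ffunE invg1 perm1. Qed.

Lemma pmap_actM f : act_morph pmap_act f.
Proof. by move=> s u; apply/ffunP => k; rewrite !ffunE invMg permM. Qed.

Definition pmap_action := TotalAction pmap_act1 pmap_actM.

Lemma card_pmap_act f s y : #|[set k | pmap_act f s k == y]| = #|[set k | f k
  == y]|.
Proof.
rewrite -[RHS](card_imset _ (@perm_inj _ s)); apply: eq_card => k; rewrite inE
  ffunE.
by rewrite -[k in RHS](permKV s) mem_imset ?inE //; apply: perm_inj.
Qed.

Lemma count_tuple (A : eqType) (t : n.-tuple A) x :
  count_mem x t = #|[set k : 'I_n | tnth t k == x]|.
Proof.
rewrite -sum1_count big_tuple -sum1_card; apply: eq_bigl => k; by rewrite inE.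
Qed.

Lemma eq_fibers_act f f' :
  (forall y, #|[set k | f k == y]| = #|[set k | f' k == y]|) ->
  exists s : 'S_n, f' = pmap_act f s.
Proof.
move=> e; have: perm_eq [tuple f' k | k < n] [tuple f k | k < n].
  apply/allP => y _.
  rewrite -[_ y]/(count_mem y [tuple f' k | k < n] == count_mem y [tuple f k |
    k < n]).
  rewrite !count_tuple; apply/eqP.
  transitivity #|[set k | f' k == y]|; first by apply: eq_card => k; rewrite
    !inE tnth_mktuple.
  by rewrite -e; apply: eq_card => k; rewrite !inE tnth_mktuple.
case/tuple_permP => p ep; exists p^-1%g; apply/ffunP => k; rewrite ffunE invgK.
have := congr1 (fun s => nth (f' k) s k) ep; rewrite -!tnth_nth !tnth_mktuple;
  exact.
Qed.

Definition pmap_content f : {ffun 'I_n -> {ffun 'I_n -> 'I_n.+1}} :=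
  [ffun i => [ffun j => inord #|[set k | f k == (i, j)]|]].

Lemma pmap_contentE f i j : pmap_content f i j = #|[set k | f k == (i, j)]| :>
  nat.
Proof. by rewrite !ffunE inordK // ltnS -[leqRHS]card_ord max_card. Qed.

Definition pmap_rows (c d : nat -> nat) : {set pmap} :=
  [set f : pmap | ([ffun k => (f k).1] \in rows_of n c) && ([ffun k => (f k).2]
    \in rows_of n d)].

Lemma card_fst f i : #|[set k | (f k).1 == i]| = (\sum_j #|[set k | f k == (i,
  j)]|)%N.
Proof.
rewrite -sum1_card (partition_big (fun k => (f k).2) xpredT) //=.
apply: eq_bigr => j _; rewrite -sum1_card; apply: eq_bigl => k; rewrite !inE.
by case: (f k) => a b /=; rewrite xpair_eqE.
Qed.

Lemma card_snd f j : #|[set k | (f k).2 == j]| = (\sum_i #|[set k | f k == (i,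
  j)]|)%N.
Proof.
rewrite -sum1_card (partition_big (fun k => (f k).1) xpredT) //=.
apply: eq_bigr => i _; rewrite -sum1_card; apply: eq_bigl => k; rewrite !inE.
by case: (f k) => a b /=; rewrite xpair_eqE andbC.
Qed.

Lemma pmap_content_margins (c d : nat -> nat) f : (f \in pmap_rows c d) =
  (pmap_content f \in margins n c d).
Proof.
rewrite !inE; congr (_ && _); apply: eq_forallb => i.
  under [in RHS]eq_bigr => j _ do rewrite pmap_contentE.
  by rewrite -card_fst; congr (_ == _); apply: eq_card => k; rewrite !inE ffunE.
under [in RHS]eq_bigr => j _ do rewrite pmap_contentE.
by rewrite -card_snd; congr (_ == _); apply: eq_card => k; rewrite !inE ffunE.
Qed.

Lemma pmap_content_surj (c d : nat -> nat) M : (\sum_(i < n) c i = n)%N -> M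
  \in margins n c d ->
  exists f, pmap_content f = M.
Proof.
move=> sum_c; rewrite inE => /andP[/forallP rM _].
pose L := flatten [seq nseq (M p.1 p.2) p | p <- enum {: 'I_n * 'I_n}].
have cL p : count_mem p L = M p.1 p.2.
  rewrite /L count_flatten -map_comp sumnE big_map big_enum /=.
  under eq_bigr => q _ do rewrite /= count_nseq.
  rewrite (bigD1 p) //= eqxx mul1n big1 ?addn0 // => q /negbTE ne.
  by rewrite /= ne mul0n.
have sL : size L == n.
  rewrite /L size_flatten /shape -map_comp sumnE big_map big_enum /=.
  under eq_bigr => q _ do rewrite /= size_nseq.
  rewrite -(pair_bigA _ (fun i j => M i j : nat)) /=; apply/eqP; rewrite
    -[RHS]sum_c.
  by apply: eq_bigr => i _; apply/eqP.
exists [ffun k => tnth (Tuple sL) k]; apply/ffunP => i; apply/ffunP => j;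
  apply: val_inj.
rewrite /= pmap_contentE -[RHS](cL (i, j)) (count_tuple (Tuple sL)).
by apply: eq_card => k; rewrite !inE ffunE.
Qed.

Lemma pmap_rows_acts (c d : nat -> nat) : [acts [set: 'S_n], on pmap_rows c d |
  pmap_action].
Proof.
apply/actsP => s _ f; rewrite [LHS]inE [RHS]inE.
have -> : [ffun k => (pmap_action f s k).1] = row_map_act [ffun k => (f k).1] s.
  by apply/ffunP => k; rewrite !ffunE.
have -> : [ffun k => (pmap_action f s k).2] = row_map_act [ffun k => (f k).2] s.
  by apply/ffunP => k; rewrite !ffunE.
by rewrite !rows_of_act.
Qed.

(** A pair of tabloids is one map to pairs of rows. Two such maps are conjugate exactly when their
    fibres have equal sizes, so the orbits correspond to the tables of fibre sizes. *)
Lemma card_orbits_margins (c d : nat -> nat) : (\sum_(i < n) c i = n)%N ->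
  #|orbit pmap_action [set: 'S_n] @: pmap_rows c d| = #|margins n c d|.
Proof.
move=> sum_c; rewrite (@card_imset_eq_ker _ _ _ _ _ pmap_content).
  apply: eq_card => M; apply/imsetP/idP => [[f fS ->]|MM].
    by rewrite -pmap_content_margins.
  have [f ef] := pmap_content_surj sum_c MM.
  by exists f => //; rewrite pmap_content_margins ef.
move=> f f' _ _; split=> [e|e].
  have /orbitP[s _ <-] : f' \in orbit pmap_action [set: 'S_n] f by rewrite e
    orbit_refl.
  apply/ffunP => i; apply/ffunP => j; apply: val_inj.
  by rewrite /= !pmap_contentE card_pmap_act.
have [|s ->] := @eq_fibers_act f f'.
  by case=> i j; rewrite -!pmap_contentE e.
by apply/eqP; rewrite eq_sym; apply/eqP; apply: (orbit_act pmap_action);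
  rewrite inE.
Qed.

Lemma card_fix_pmap (c d : nat -> nat) (g : 'S_n) : #|('Fix_(pmap_rows c d |
  pmap_action)[g])%g| =
  (#|[set r in rows_of n c | row_map_act r g == r]| *
   #|[set r in rows_of n d | row_map_act r g == r]|)%N.
Proof.
rewrite -cardsX.
apply: (card_bij_in (f := fun f : pmap => ([ffun k => (f k).1] : row_map n,
  [ffun k => (f k).2] : row_map n))
   (g := fun rr : row_map n * row_map n => [ffun k => (rr.1 k, rr.2 k)] :
     pmap)).
- move=> f; rewrite !inE => /andP[/andP[h1 h2] /subsetP h3].
  have e : pmap_act f g = f by apply/eqP; have := h3 g (set11 g); rewrite inE.
  split; last by apply/ffunP => k; rewrite !ffunE /= -surjective_pairing.
  rewrite !h1 !h2 /=; apply/andP; split; apply/eqP/ffunP => k; rewrite !ffunE.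
    by rewrite -[in RHS]e ffunE.
  by rewrite -[in RHS]e ffunE.
- case=> r r'; rewrite !inE /= => /andP[/andP[h1 /eqP e1] /andP[h2 /eqP e2]].
  have E1 : [ffun k => ([ffun k0 => (r k0, r' k0)] k : 'I_n * 'I_n).1] = r.
    by apply/ffunP => k; rewrite !ffunE.
  have E2 : [ffun k => ([ffun k0 => (r k0, r' k0)] k : 'I_n * 'I_n).2] = r'.
    by apply/ffunP => k; rewrite !ffunE.
  split; last by rewrite E1 E2.
  rewrite E1 E2 h1 h2 /=; apply/subsetP => x; rewrite !inE => /eqP ->;
    apply/eqP.
  by apply/ffunP => k; rewrite !ffunE -[in RHS]e1 -[in RHS]e2 !ffunE.
Qed.

(** Burnside's lemma for pairs of tabloids: fixed points multiply to the product of the characters,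
    and the orbits are counted by [kostka_margins]. *)
Lemma perm_char_gram (c d : nat -> nat) : (\sum_(i < n) c i = n)%N ->
  char_dot (@perm_char n c) (perm_char d) =
  \sum_(la : intpart n) (kostka la c)%:R * (kostka la d)%:R.
Proof.
move=> sum_c; have := Frobenius_Cauchy (pmap_rows_acts c d).
rewrite card_orbits_margins // -kostka_margins // => /(congr1 (fun m => m%:R :
  rat)).
rewrite natrM !natr_sum => e.
under [in RHS]eq_bigr => la _ do rewrite -natrM.
have nz : (#|[set: 'S_n]|%:R : rat) != 0 by rewrite pnatr_eq0 -lt0n cardG_gt0.
rewrite /char_dot; apply: (mulIf nz); rewrite -e cardsT mulrAC mulVf -?cardsT
  // mul1r.
apply: eq_big => [g|g _]; first by rewrite inE.
by rewrite perm_charV card_fix_pmap natrM.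
Qed.

End PairMaps.

Section YoungRule.
Variable n : nat.
Implicit Types f g : 'S_n -> rat.

Lemma char_dotC f g : char_dot f g = char_dot g f.
Proof.
rewrite /char_dot; congr (_ * _); rewrite (reindex_inj invg_inj) /=.
by apply: eq_bigr => s _; rewrite invgK mulrC.
Qed.

Lemma char_dot_sumr (I : finType) f (a : I -> rat) (F : I -> 'S_n -> rat) :
  char_dot f (fun s => \sum_i a i * F i s) = \sum_i a i * char_dot f (F i).
Proof.
rewrite /char_dot; under eq_bigr => s _ do rewrite mulr_sumr.
rewrite exchange_big /= mulr_sumr; apply: eq_bigr => i _.
rewrite mulrCA; congr (_ * _); rewrite mulr_sumr; apply: eq_bigr => s _.
by rewrite mulrCA.
Qed.

(** The difference [f - g] has norm 0, and invariance under inversion makes that norm a sum of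
    squares. *)
Lemma char_dot_sub_eq0 f g : (forall s, f s^-1%g = f s) -> (forall s, g s^-1%g
  = g s) ->
  char_dot f f = 1 -> char_dot g g = 1 -> char_dot f g = 1 -> f =1 g.
Proof.
move=> fV gV ff gg fg.
have nz : (#|{: 'S_n}|%:R : rat) != 0.
  by rewrite pnatr_eq0 -lt0n; apply/card_gt0P; exists 1%g.
have e : \sum_s (f s - g s) ^+ 2 = 0.
  have := char_dotC f g; rewrite fg => gf.
  have: char_dot f f + char_dot g g - char_dot f g - char_dot g f = 0.
    by rewrite ff gg fg -gf; ring.
  rewrite /char_dot -mulrDr -!mulrBr => /eqP; rewrite mulf_eq0 invr_eq0 (negbTE
    nz) /= => /eqP e0.
  rewrite -[RHS]e0 -big_split /= -sumrB /= -sumrB /=; apply: eq_bigr => s _.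
  by rewrite fV gV; ring.
move=> s; apply/eqP; rewrite -subr_eq0 -sqrf_eq0.
by rewrite (psumr_eq0P (fun x _ => sqr_ge0 (f x - g x)) e).
Qed.

(* chi^la and the inverse Kostka combination of permutation characters have   *)
(* norm 1 and scalar product 1, hence coincide.                               *)
Lemma young_rule (la : intpart n) (c : nat -> nat) : (\sum_(i < n) c i = n)%N ->
  char_dot (@perm_char n c) (specht_char la) = (kostka la c)%:R.
Proof.
move=> sum_c; have [a [aK a1 adom]] := kostka_inverse la.
have [chiV chi1 chipi chi0] := specht_char_facts la.
pose psi (s : 'S_n) := \sum_nu a nu * perm_char (row_len (part nu)) s.
have pic_psi (d : nat -> nat) : (\sum_(i < n) d i = n)%N -> char_dot
  (@perm_char n d) psi = (kostka la d)%:R.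
  move=> sum_d; rewrite char_dot_sumr.
  under eq_bigr => nu _ do rewrite perm_char_gram // mulr_sumr.
  rewrite exchange_big /= (bigD1 la) //= [X in _ + X]big1 => [|mu ne].
    under eq_bigr => nu _ do rewrite mulrCA.
    by rewrite -mulr_sumr aK eqxx mulr1 addr0.
  under eq_bigr => nu _ do rewrite mulrCA.
  by rewrite -mulr_sumr aK (negbTE ne) mulr0.
suff e : specht_char la =1 psi.
  rewrite -pic_psi // /char_dot; congr (_ * _); apply: eq_bigr => s _.
  by rewrite e.
apply: char_dot_sub_eq0 => //.
- by move=> s; apply: eq_bigr => nu _; rewrite perm_charV.
- rewrite char_dot_sumr; under eq_bigr => nu _ do rewrite char_dotC pic_psi
    ?part_sum //.
  by rewrite aK eqxx.
(* Only [nu = la] contributes: [a nu != 0] makes [nu] dominate [la], and a nonzero scalar product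
   makes [la] dominate [nu]. *)
- rewrite char_dot_sumr (bigD1 la) //= chipi a1 mulr1 big1 ?addr0 // => nu ne.
  have [->|nz] := eqVneq (a nu) 0; first by rewrite mul0r.
  rewrite chi0 ?mulr0 // => h; case/eqP: ne; apply: dominates_anti => //.
  exact: adom.
Qed.

End YoungRule.

(** * Acyclicity below the top dimension *)

Section Acyclicity.
Variables (disp : Order.disp_t) (P : finPOrderType disp) (Q : {set P}).
Implicit Types c d e : {set P}.
Local Notation bc := (@boundary_coef disp P).

Definition face_sign c (x : P) : rat := (-1) ^+ #|[set y in c | (y < x)%O]|.

Lemma boundary_coefD1 c x : x \in c -> bc c (c :\ x) = face_sign c x.
Proof.
move=> xc; rewrite /boundary_coef (big_pred1 x) // => y /=.
apply/andP/eqP => [[yc /eqP e]|->]; last by rewrite xc eqxx.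
by apply/eqP; move: (setD11 y c); rewrite e !inE yc andbT => /negbFE.
Qed.

Lemma boundary_coefP c c' : bc c c' != 0 -> exists2 x, x \in c & c' = c :\ x.
Proof.
move=> nz; case: (pickP (fun x => (x \in c) && (c :\ x == c'))) => [x /andP[xc
  /eqP e]|no].
  by exists x.
by rewrite /boundary_coef big_pred0 ?eqxx in nz.
Qed.

Lemma face_sign_neq0 c x : face_sign c x != 0.
Proof. by rewrite signr_eq0. Qed.

Lemma face_sign_sqr c x : face_sign c x * face_sign c x = 1.
Proof. by rewrite -expr2 sqrr_sign. Qed.

Lemma is_chain_sub c c' : c' \subset c -> is_chain Q c -> is_chain Q c'.
Proof.
move=> sub /andP[cQ /'forall_in_'forall_in_idP ch]; apply/andP; split.
  exact: subset_trans cQ.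
by apply/'forall_in_'forall_in_idP => x xc y yc; apply: ch; apply: (subsetP
  sub).
Qed.

Lemma is_chain_comparable c x y : is_chain Q c -> x \in c -> y \in c -> (x >=<
  y)%O.
Proof. by case/andP=> _ /'forall_in_'forall_in_idP ch xc yc; apply: ch. Qed.

(** For [x < y], deleting [x] lowers the position of [y] by one, whereas deleting [y] leaves the
    position of [x] unchanged. *)
Lemma face_sign_swap c x y : is_chain Q c -> x \in c -> y \in c -> x != y ->
  face_sign c x * face_sign (c :\ x) y = - (face_sign c y * face_sign (c :\ y)
    x).
Proof.
move=> ch; wlog lt_xy : x y / (x < y)%O => [W xc yc ne|xc yc _].
  have := is_chain_comparable ch xc yc; rewrite comparable_sym.
  case: comparableP => // [lt|lt|e] _; last by rewrite e eqxx in ne.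
    by rewrite (W y x lt yc xc) ?opprK // eq_sym.
  exact: W.
have -> : face_sign (c :\ y) x = face_sign c x.
  rewrite /face_sign; congr (_ ^+ _); apply: eq_card => z; rewrite !inE.
  case: (z =P y) => [->|] //=; by rewrite andbC lt_gtF.
have -> : face_sign c y = - face_sign (c :\ x) y.
  rewrite /face_sign (cardsD1 x) inE xc lt_xy /= exprS mulN1r; congr (- (_ ^+
    _)).
  by apply: eq_card => z; rewrite !inE andbA.
by rewrite mulNr opprK mulrC.
Qed.

Lemma boundary_coef_comp d e : is_chain Q d -> \sum_c bc d c * bc c e = 0.
Proof.
move=> ch.
pose F x y : rat := if [&& x \in d, y \in d, x != y & d :\ x :\ y == e]
   then face_sign d x * face_sign (d :\ x) y else 0.
have eF : \sum_c bc d c * bc c e = \sum_x \sum_y F x y.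
  transitivity (\sum_(x in d) face_sign d x * bc (d :\ x) e).
    under eq_bigr => c _ do rewrite /(bc d c) mulr_suml.
    rewrite (exchange_big_dep (mem d)) /=; last by move=> c x _ /andP[].
    apply: eq_bigr => x xd; rewrite (big_pred1 (d :\ x)) // => c /=.
    by rewrite xd eq_sym.
  rewrite big_mkcond; apply: eq_bigr => x _; case: ifP => [xd|xd]; last first.
    by rewrite big1 // => y _; rewrite /F xd.
  rewrite /boundary_coef mulr_sumr big_mkcond; apply: eq_bigr => y _.
  rewrite /F xd in_setD1 /= [y == x]eq_sym andbA [_ && (x != y)]andbC.
  by case: ifP.
have swapF x y : F x y = - F y x.
  rewrite /F; case: (boolP (x \in d)) => xd; case: (boolP (y \in d)) => yd;
    rewrite ?oppr0 //=.
  rewrite [y == x]eq_sym; case: (x =P y) => [_|/eqP ne] /=; first by rewrite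
    oppr0.
  have -> : d :\ y :\ x = d :\ x :\ y by rewrite setDDl setUC -setDDl.
  by case: ifP => _; rewrite ?oppr0 // (face_sign_swap ch xd yd ne).
have : \sum_x \sum_y F x y = - \sum_x \sum_y F x y.
  rewrite {1}exchange_big /= -sumrN; apply: eq_bigr => x _; rewrite -sumrN.
  by apply: eq_bigr => y _; rewrite swapF.
by rewrite -eF => /eqP; rewrite -addr_eq0 -mulr2n mulrn_eq0 => /eqP.
Qed.

Lemma facesP c m : reflect (is_chain Q c /\ #|c| = m) (c \in faces Q m).
Proof. by rewrite inE; apply: (iffP andP) => -[-> /eqP]. Qed.

Lemma face_delete c m x : c \in faces Q m.+1 -> x \in c -> c :\ x \in faces Q m.
Proof.
move=> /facesP[ch sz] xc; apply/facesP; split.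
  by apply: is_chain_sub ch; apply: subsetDl.
by apply: succn_inj; rewrite -sz (cardsD1 x c) xc.
Qed.

Lemma boundary_comp m : boundary Q m.+1 *m boundary Q m = 0.
Proof.
apply/matrixP => i j; rewrite !mxE.
under eq_bigr => k _ do rewrite !mxE.
rewrite -(big_enum_val (fun c => bc (enum_val i) c * bc c (enum_val j))) /=.
have fi := enum_valP i; have [ch _] := facesP _ _ fi.
rewrite -[RHS](boundary_coef_comp (enum_val j) ch) big_mkcond /=; apply:
  eq_bigr => c _.
case: ifP => // /negbT nc; have [->|/boundary_coefP[x xc e]] := eqVneq (bc
  (enum_val i) c) 0.
  by rewrite mul0r.
by case/negP: nc; rewrite e face_delete.
Qed.

Variables (m : nat) (W : finType) (Inv : {set P} -> {set W}) (v : {set W} -> P).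
Hypothesis Inv_mono : forall c d, c \subset d -> Inv c \subset Inv d.
Hypothesis face_add : forall c, c \in faces Q m -> v (Inv c) \notin c ->
  is_chain Q (v (Inv c) |: c) /\ Inv (v (Inv c) |: c) = Inv c.
Hypothesis face_del : forall c, c \in faces Q m -> v (Inv c) \in c ->
  Inv (c :\ v (Inv c)) = Inv c.

(** A discrete Morse matching: toggling the vertex [v (Inv c)] pairs faces with equal statistic
    [Inv]. Subtracting boundaries of cones [v (Inv c) |: c] removes from the cycle all faces whose
    statistic has the largest admissible size, and induction handles the rest. *)
Lemma cycle_boundary l (z : {set P} -> rat) :
  (forall c, z c != 0 -> c \in faces Q m /\ (#|Inv c| < l)%N) ->
  (forall e, \sum_c z c * bc c e = 0) ->
  exists2 y : {set P} -> rat, (forall d, y d != 0 -> d \in faces Q m.+1) &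
    forall c, z c = \sum_d y d * bc d c.
Proof.
elim: l z => [|l IH] z supp cyc.
  exists (fun=> 0) => [d|c]; first by rewrite eqxx.
  rewrite big1 => [|d _]; last by rewrite mul0r.
  by apply/eqP; apply: contraT => /supp[].
pose D c := v (Inv c) |: c.
(* The coefficient makes the boundary of the cone cancel [z c] at [c], the sign of [c] in that
   boundary being its own inverse. *)
pose q c : rat := if v (Inv c) \in c then 0 else z c * bc (D c) c.
pose z' c := z c - \sum_c1 q c1 * bc (D c1) c.
have qP c1 : q c1 != 0 -> [/\ v (Inv c1) \notin c1, c1 \in faces Q m, (#|Inv
  c1| < l.+1)%N,
    is_chain Q (D c1) & Inv (D c1) = Inv c1].
  rewrite /q; case: ifP => [_|/negbT nv]; first by rewrite eqxx.
  rewrite mulf_eq0 negb_or => /andP[/supp[fc lt] _].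
  by have [? ?] := face_add fc nv; split.
have DD c1 c : q c1 != 0 -> bc (D c1) c != 0 ->
    [/\ c \in faces Q m, Inv c \subset Inv c1 & exists2 x, x \in D c1 & c = D
      c1 :\ x].
  move=> /qP[nv /facesP[_ sz] _ chD eI] /boundary_coefP[x xD ->]; split; last
    by exists x.
    by apply: (face_delete _ xD); apply/facesP; split=> //; rewrite cardsU1 nv
      sz.
  by rewrite -eI Inv_mono // subsetDl.
have supp' c : z' c != 0 -> c \in faces Q m /\ (#|Inv c| < l.+1)%N.
  have [z0|/supp //] := eqVneq (z c) 0; rewrite /z' z0 sub0r oppr_eq0 => nz.
  have [c1 nz1] : exists c1, q c1 * bc (D c1) c != 0.
    apply/existsP; apply: contraNT nz; rewrite negb_exists => /forallP h.
    by apply/eqP/big1 => c1 _; apply/eqP; have := h c1; rewrite negbK.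
  move: nz1; rewrite mulf_eq0 negb_or => /andP[nq nb].
  have [fc sub _] := DD c1 c nq nb; have [_ _ lt _ _] := qP c1 nq.
  by split=> //; apply: leq_ltn_trans (subset_leq_card sub) lt.
have cyc' e : \sum_c z' c * bc c e = 0.
  rewrite /z'; under eq_bigr => c _ do rewrite mulrBl mulr_suml.
  rewrite sumrB cyc sub0r exchange_big /= big1 ?oppr0 // => c1 _.
  under eq_bigr => c _ do rewrite -mulrA.
  rewrite -mulr_sumr; have [->|/qP[_ _ _ chD _]] := eqVneq (q c1) 0; first by
    rewrite mul0r.
  by rewrite boundary_coef_comp // mulr0.
(* Only the cone over [c] itself has [c] in its boundary: maximality of the size forces
   [Inv c1 = Inv c], and every face of [D c1] other than [c1] contains the cone vertex. *)
have zC c : c \in faces Q m -> #|Inv c| = l -> v (Inv c) \notin c -> z' c = 0.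
  move=> fc ec nv; rewrite /z' (bigD1 c) //= big1 ?addr0.
    have vD : v (Inv c) \in D c by rewrite !inE eqxx.
    have e : c = D c :\ v (Inv c).
      by apply/setP => x; rewrite !inE; case: eqP => [->|] //=; rewrite (negbTE
        nv).
    have e2 : bc (D c) c = face_sign (D c) (v (Inv c)).
      by rewrite -(boundary_coefD1 vD) -e.
    by rewrite /q (negbTE nv) -mulrA e2 face_sign_sqr mulr1 subrr.
  move=> c1 ne; apply/eqP; rewrite mulf_eq0; case: eqP => //= /eqP nq.
  apply: contraNT ne => nb; have [_ sub [x xD e]] := DD c1 c nq nb.
  have [nv1 _ lt _ _] := qP c1 nq.
  have eI : Inv c = Inv c1.
    by apply/eqP; rewrite eqEcard sub ec -ltnS.
  have xv : x = v (Inv c1).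
    apply/eqP; apply: contraNT nv => ne; rewrite eI e !inE eqxx andbT eq_sym //.
  apply/eqP/setP => y; rewrite e xv !inE; case: (y =P _) => [->|] //=.
  by rewrite (negbTE nv1).
(* Read the cycle condition at [c0]. Any face over [c0] in the support of [z'] has the same
   statistic by maximality, so it contains the cone vertex by [zC] and is [c]. *)
have zD c : c \in faces Q m -> #|Inv c| = l -> z' c = 0.
  move=> fc ec; case: (boolP (v (Inv c) \in c)) => [vc|]; last exact: zC.
  have eI := face_del fc vc; set c0 := c :\ v (Inv c) in eI *.
  have := cyc' c0; rewrite (bigD1 c) //= big1 ?addr0.
    by move/eqP; rewrite mulf_eq0 boundary_coefD1 // (negbTE (face_sign_neq0 _
      _)) orbF => /eqP.
  move=> c1 ne; apply/eqP; rewrite mulf_eq0; case: eqP => //= /eqP nz.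
  apply: contraNT ne => /boundary_coefP[x xc1 e].
  have [fc1 lt] := supp' c1 nz.
  have eI1 : Inv c1 = Inv c.
    apply/eqP; rewrite eq_sym eqEcard ec -ltnS lt andbT -eI e; apply: Inv_mono.
    exact: subsetDl.
  have v1 : v (Inv c) \in c1.
    by apply: contraNT nz => nv; rewrite zC ?eI1.
  have xv : x = v (Inv c).
    apply/eqP; apply: contraT => ne.
    have: v (Inv c) \in c0 by rewrite e !inE v1 andbT eq_sym.
    by rewrite !inE eqxx.
  apply/eqP; rewrite -(setD1K xc1) -e /c0 -xv in vc *.
  by rewrite xv setD1K // -xv.
have [||y fy ey] := IH z'.
- move=> c nz; have [fc lt] := supp' c nz; split=> //.
  by rewrite ltn_neqAle -ltnS lt andbT; apply: contraNneq nz => /(zD c fc) ->.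
- exact: cyc'.
exists (fun d => y d + \sum_(c1 | D c1 == d) q c1) => [d|c].
  have [->|/fy //] := eqVneq (y d) 0; rewrite add0r => nz.
  have [c1 /andP[/eqP e nz1]] : exists c1, (D c1 == d) && (q c1 != 0).
    apply/existsP; apply: contraNT nz; rewrite negb_exists => /forallP h.
    by apply/eqP/big1 => c1 e; apply/eqP; have := h c1; rewrite e negbK.
  have [nv /facesP[_ sz] _ ch _] := qP c1 nz1.
  by apply/facesP; rewrite -e; split=> //; rewrite cardsU1 nv sz.
under eq_bigr => d _ do rewrite mulrDl.
rewrite big_split /= -ey /z'.
have -> : \sum_d (\sum_(c1 | D c1 == d) q c1) * bc d c = \sum_c1 q c1 * bc (D
  c1) c.
  rewrite [RHS](partition_big D xpredT) //=; apply: eq_bigr => d _.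
  by rewrite mulr_suml; apply: eq_bigr => c1 /eqP ->.
by rewrite subrK.
Qed.

Lemma kermx_boundary : (kermx (boundary Q m) <= boundary Q m.+1)%MS.
Proof.
apply/row_subP => i; set u := row i _.
have ub : u *m boundary Q m = 0 by apply/sub_kermxP; apply: row_sub.
pose z c : rat := \sum_k u 0 k * (enum_val k == c)%:R.
have zE k : z (enum_val k) = u 0 k.
  rewrite /z (bigD1 k) //= eqxx mulr1 big1 ?addr0 // => k' ne.
  by rewrite (inj_eq enum_val_inj) (negbTE ne) mulr0.
have supp c : z c != 0 -> c \in faces Q m.
  apply: contraNT => nc; rewrite /z big1 // => k _.
  by case: eqP => [e|]; rewrite ?mulr0 //; rewrite -e enum_valP in nc.
have sumz (F : {set P} -> rat) : \sum_c z c * F c = \sum_k u 0 k * F (enum_val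
  k).
  under [RHS]eq_bigr => k _ do rewrite -zE.
  rewrite -(big_enum_val (fun c => z c * F c)) /= [RHS]big_mkcond; apply:
    eq_bigr => c _.
  by case: ifP => // /negbT nc; rewrite (_ : z c = 0) ?mul0r //; apply/eqP;
    apply: contraNT nc; apply: supp.
have cyc e : \sum_c z c * bc c e = 0.
  have [fe|ne] := boolP (e \in faces Q m.-1).
    have h : (u *m boundary Q m) 0 (enum_rank_in fe e) = 0 by rewrite ub mxE.
    rewrite mxE in h; rewrite sumz -[RHS]h; apply: eq_bigr => k _; congr (_ *
      _).
    by rewrite [RHS]mxE enum_rankK_in.
  apply: big1 => c _; apply/eqP; rewrite mulf_eq0; case: eqP => //= /eqP /supp
    fc.
  apply: contraNT ne => /boundary_coefP[x xc ->].
  (* For [m = 0] the target is again the set of empty faces, and an empty face has no vertex to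
     delete. *)
  case: (m) fc => [/facesP[_ /eqP]|m' fc]; last exact: face_delete.
  by rewrite cards_eq0 => /eqP c0; rewrite c0 inE in xc.
have [|y fy ey] := @cycle_boundary (#|W|.+1) z _ cyc.
  by move=> c /supp fc; split; rewrite // ltnS max_card.
have -> : u = (\row_k y (enum_val k)) *m boundary Q m.+1; last exact: submxMl.
apply/rowP => j; rewrite -zE ey mxE; under [RHS]eq_bigr => k _ do rewrite !mxE.
rewrite -(big_enum_val (fun d => y d * bc d (enum_val j))) /= [RHS]big_mkcond.
apply: eq_bigr => d _; case: ifP => // /negbT nd.
by rewrite (_ : y d = 0) ?mul0r //; apply/eqP; apply: contraNT nd; apply: fy.
Qed.

End Acyclicity.

(** * Traces on cycles and homology *)

Section Traces.
Variables (F : fieldType) (gT : finGroupType) (G : {group gT}).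

Lemma mxtrace_submod_basis d (rG : mx_representation F G d) (U : 'M_d)
    (modU : mxmodule rG U) x k (B : 'M_(k, d)) (A : 'M_k) :
  x \in G -> row_free B -> (B :=: U)%MS -> B *m rG x = A *m B ->
  \tr (submod_repr modU x) = \tr A.
Proof.
move=> Gx freeB eqBU BA; pose C := in_submod U B; pose S := submod_repr modU x.
have sBU : (B <= U)%MS by rewrite eqBU.
have AC : A *m C = C *m S.
  by rewrite -in_submodJ // BA /C in_submodE [RHS]in_submodE mulmxA.
have rC : \rank C = k.
  apply/eqP; change (row_free C); apply: inj_row_free => w wC.
  have: w *m B = 0.
    by rewrite -(in_submodK sBU) val_submodE mulmxA -/C wC mul0mx.
  by move/eqP; rewrite mulmx_free_eq0 // => /eqP.
have rU : \rank U = k by rewrite -eqBU; apply/eqP.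
have /row_freeP[C' CC'] : row_free C by rewrite /row_free rC.
have /row_fullP[D DC] : row_full C by rewrite /row_full rC rU.
have C'C : C' *m C = 1%:M.
  by have -> : C' = D; rewrite // -[C']mul1mx -DC -mulmxA CC' mulmx1.
rewrite -/S -[A]mulmx1 -CC' mulmxA AC -mulmxA [RHS]mxtrace_mulC -mulmxA.
by rewrite C'C mulmx1.
Qed.

(** Rank-nullity for traces: a basis of the quotient by the kernel, lifted and mapped by [D], is a
    basis of the image. *)
Lemma mxtrace_ker_im d1 d2 (r1 : mx_representation F G d1)
    (r2 : mx_representation F G d2) (D : 'M_(d1, d2)) (U : 'M_d2)
    (modK : mxmodule r1 (kermx D)) (modU : mxmodule r2 U) x :
  x \in G -> (U :=: D)%MS -> r1 x *m D = D *m r2 x ->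
  \tr (r1 x) = \tr (submod_repr modK x) + \tr (submod_repr modU x).
Proof.
move=> Gx eqUD comm; rewrite -(mxtrace_sub_fact_mod modK x); congr (_ + _).
pose V : 'M_(_, d1) := val_factmod (U := kermx D) 1%:M.
symmetry; apply: (@mxtrace_submod_basis _ _ _ _ _ _ (V *m D)) => //.
- apply: inj_row_free => w; rewrite mulmxA => /sub_kermxP.
  rewrite -val_factmodE => sub.
  have := in_factmod_eq0 (kermx D) (val_factmod w); rewrite sub val_factmodK =>
    /eqP; exact.
- have sub1 : (V *m D <= U)%MS by rewrite eqUD submxMl.
  apply/eqmxP; rewrite sub1 /= eqUD.
  have e := add_sub_fact_mod (kermx D) (1%:M : 'M_d1).
  have eD : D = val_factmod (in_factmod (kermx D) 1%:M) *m D.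
    rewrite -[LHS]mul1mx -{1}e mulmxDl (_ : val_submod _ *m D = 0) ?add0r //.
    by apply/sub_kermxP; apply: val_submodP.
  by rewrite [X in (X <= _)%MS]eD val_factmodE -mulmxA submxMl.
- rewrite -mulmxA -comm mulmxA -[factmod_repr modK x]/(in_factmod (kermx D) (V
    *m r1 x)).
  rewrite mulmxA -val_factmodE -[in LHS](add_sub_fact_mod (kermx D) (V *m r1
    x)) mulmxDl.
  by rewrite (_ : val_submod _ *m D = 0) ?add0r //; apply/sub_kermxP; apply:
    val_submodP.
Qed.

Lemma mxtrace_section0 d (rG : mx_representation F G d) (U V : 'M_d)
    (modU : mxmodule rG U) (modV : mxmodule rG V) x :
  x \in G -> U = 0 -> \tr (section_repr modU modV x) = \tr (submod_repr modV x).
Proof.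
move=> Gx U0; pose R : 'M_(_, d) := val_submod (U := V) 1%:M.
have RE m (w : 'M_(m, _)) : w *m in_factmod U R = in_factmod U (w *m R).
  by rewrite in_factmodE [RHS]in_factmodE mulmxA.
apply: (@mxtrace_submod_basis _ _ _ _ _ _ (in_factmod U R)) => //.
- apply: inj_row_free => w; rewrite RE => /eqP; rewrite in_factmod_eq0 U0
    submx0 => /eqP.
  by rewrite /R -val_submodE => /eqP; rewrite val_submod_eq0 => /eqP.
- apply: eqmx_trans (eqmx_sym (genmxE _)).
  by rewrite in_factmodE [in_factmod U V]in_factmodE; apply: eqmxMr; apply:
    val_submod1.
- rewrite -in_factmodJ // RE; congr (in_factmod U _).
  by rewrite /R -(val_submodJ modV) // mul1mx -val_submodE.
Qed.

End Traces.

(** * The Hopf trace formula *)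

Section HomologyTrace.
Variables (disp : Order.disp_t) (P : finPOrderType disp).
Variables (gT : finGroupType) (to : {action gT &-> P}) (Q : {set P}).
Hypothesis to_mono : forall g, {mono to^~ g : x y / (x <= y)%O}.
Hypothesis actsQ : [acts [set: gT], on Q | to].

Definition faces_char m : gT -> rat := character (perm_module (faces_acts
  to_mono actsQ m)).

Definition cycles_char m : gT -> rat :=
  character (submod_repr (kernel_module (faces_acts to_mono actsQ m)
     (faces_acts to_mono actsQ m.-1) (boundary_coef_inv to_mono))).

(** Exactness identifies the image of [boundary Q m.+1] with the cycles one dimension below;
    [mxtrace_ker_im] then splits the character of the faces. *)
Lemma faces_charS m g : (kermx (boundary Q m) <= boundary Q m.+1)%MS ->
  faces_char m.+1 g = cycles_char m.+1 g + cycles_char m g.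
Proof.
move=> exact_m; apply: (mxtrace_ker_im (D := boundary Q m.+1)).
- exact: in_setT.
- apply/eqmxP; rewrite exact_m /=; apply/sub_kermxP; exact: boundary_comp.
- exact: (kernel_mx_comm _ _ (boundary_coef_inv to_mono)).
Qed.

Lemma faces_char0 g : faces_char 0 g = cycles_char 0 g.
Proof.
have b0 : boundary Q 0 = 0.
  apply/matrixP => i j; rewrite !mxE /boundary_coef big_pred0 // => x.
  have /facesP[_ /eqP] := enum_valP i; rewrite cards_eq0 => /eqP ->.
  by rewrite inE.
rewrite /faces_char /cycles_char /character.
symmetry; apply: (@mxtrace_submod_basis _ _ _ _ _ _ _ _ _ 1%:M).
- exact: in_setT.
- by rewrite row_free_unit unitmx1.
- apply/eqmxP; rewrite submx1 andbT; apply/sub_kermxP.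
  by rewrite -[kernel_mx _ _ _]/(boundary Q 0) b0 mulmx0.
- by rewrite mul1mx mulmx1.
Qed.

Lemma homology_char_top m g : faces Q m.+1 = set0 ->
  homology_char to_mono actsQ m g = cycles_char m g.
Proof.
move=> f0; apply: mxtrace_section0; first exact: in_setT.
apply/eqP; rewrite -submx0 genmxE; apply/row_subP => i.
by exfalso; move: (enum_val i) (enum_valP i) => c; rewrite f0 inE.
Qed.

Lemma cycles_char_sum m g :
  (forall k, (k < m)%N -> (kermx (boundary Q k) <= boundary Q k.+1)%MS) ->
  cycles_char m g = \sum_(k < m.+1) (-1) ^+ (m - k) * faces_char k g.
Proof.
elim: m => [|m IH] ex; first by rewrite big_ord1 subnn mul1r faces_char0.
rewrite big_ord_recr /= subnn mul1r faces_charS ?ex //.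
rewrite (IH (fun k lt => ex k (ltnW lt))) addrC -addrA -big_split /= big1
  ?addr0 // => k _.
have le_k : (k <= m)%N by rewrite -ltnS.
by rewrite subSn // exprS mulN1r mulNr subrr.
Qed.

End HomologyTrace.

(** * Chains of equicardinal tuples of sets *)

Lemma perm_module_char (gT : finGroupType) (X : finType) (to : {action gT &->
  X})
    (S : {set X}) (actsS : [acts [set: gT], on S | to]) g :
  character (perm_module actsS) g = #|[set x in S | to x g == x]|%:R.
Proof.
rewrite /character /mxtrace; under eq_bigr => i _ do rewrite mxE.
rewrite -(big_enum_val (fun x => (to x g == x)%:R)) /= -sum1_card natr_sum.
rewrite big_mkcond [RHS]big_mkcond; apply: eq_bigr => x _; rewrite inE.
by case: (x \in S); case: eqP.
Qed.

Lemma krank_down (X : finType) (key : X -> nat) (D : {set X}) : injective key ->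
  (forall x y, x \in D -> (key y <= key x)%N -> y \in D) ->
  forall x, (x \in D) = (krank key x < #|D|)%N.
Proof.
move=> inj_key down x; apply/idP/idP => [xD|].
  apply: proper_card; apply/properP; split.
    by apply/subsetP => y; rewrite inE => /ltnW; apply: down.
  by exists x; rewrite ?inE ?ltnn.
apply: contraTT => nx; rewrite -leqNgt; apply/subset_leq_card/subsetP => y yD.
by rewrite inE ltnNge; apply: contra nx; apply: down.
Qed.

Section BooleanPowerChains.
Variables (t n : nat).
Hypothesis t_gt0 : (0 < t)%N.
Local Notation P := (bool_pow t n).
Implicit Types (A B : P) (C : {set P}) (J I : {set 'I_n}).

Lemma bp_rankE A i : bp_rank A = #|A i|.
Proof.
apply/eqP; rewrite eqn_leq (leq_bigmax i) andbT; apply/bigmax_leqP => j _.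
by rewrite (bp_card A j i).
Qed.

Let i0 : 'I_t := Ordinal t_gt0.

Lemma bp_rank_le_n A : (bp_rank A <= n)%N.
Proof. by rewrite (bp_rankE A i0) -[leqRHS]card_ord max_card. Qed.

Lemma bp_leP A B : reflect (forall i, A i \subset B i) (A <= B)%O.
Proof. exact: forallP. Qed.

Lemma bp_le_eq A B : (A <= B)%O -> (bp_rank B <= bp_rank A)%N -> A = B.
Proof.
move=> /bp_leP le le_rk; apply/val_inj/ffunP => i; apply/eqP.
by rewrite eqEcard le -!bp_rankE.
Qed.

Lemma bp_rank_bot : bp_rank (\bot%O : P) = 0%N.
Proof. by rewrite (bp_rankE _ i0) ffunE cards0. Qed.

Lemma bp_rank_top : bp_rank (\top%O : P) = n.
Proof. by rewrite (bp_rankE _ i0) ffunE cardsT card_ord. Qed.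

Lemma comparable_rank_le A B : (A >=< B)%O -> (bp_rank A <= bp_rank B)%N -> (A
  <= B)%O.
Proof.
by case/orP=> // le_BA le_rk; rewrite (bp_le_eq le_BA le_rk).
Qed.

Section Proper.
Variable J : {set 'I_n}.
Hypothesis J_gt0 : forall j : 'I_n, j \in J -> (0 < j)%N.
Local Notation Q := (bp_proper t J).

Lemma bp_properP A : reflect (exists2 j : 'I_n, j \in J & bp_rank A = j) (A \in
  Q).
Proof.
rewrite !inE; apply: (iffP andP) => [[]|[j jJ e]].
  rewrite negb_or => /andP[nb nt]; rewrite (negbTE nb) (negbTE nt) !orbF.
  by case/existsP => j /andP[jJ /eqP e]; exists j.
split; last by apply/orP; left; apply/existsP; exists j; rewrite jJ e eqxx.
rewrite negb_or; apply/andP; split; apply/eqP => eA.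
  by have := J_gt0 jJ; rewrite -e eA bp_rank_bot.
by have := ltn_ord j; rewrite -e eA bp_rank_top ltnn.
Qed.

Lemma bp_chain_rank_le C A B : is_chain Q C -> A \in C -> B \in C ->
  (bp_rank A <= bp_rank B)%N -> (A <= B)%O.
Proof.
by move=> ch cA cB; apply: comparable_rank_le; apply: is_chain_comparable ch cA
  cB.
Qed.

Lemma bp_chain_rank_inj C A B : is_chain Q C -> A \in C -> B \in C ->
  bp_rank A = bp_rank B -> A = B.
Proof.
move=> ch cA cB e; apply: bp_le_eq; last by rewrite e.
by apply: (bp_chain_rank_le ch cA cB); rewrite e.
Qed.

Section Chain.
Variable C : {set P}.
Definition out_count i (x : 'I_n) : nat := #|[set A in C | x \notin A i]|.

(** Sorts by the time of entry into coordinate [i] along the chain, then increasingly inside each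
    block of the resulting ordered set partition. *)
Definition chain_key i x : nat := (out_count i x * n + x)%N.

Lemma chain_key_lt i x y : (chain_key i x < chain_key i y)%N =
  (out_count i x < out_count i y)%N || (out_count i x == out_count i y) && (x <
    y)%N.
Proof.
rewrite /chain_key; have := ltn_ord x; have := ltn_ord y.
move: (out_count i x) (out_count i y) => a b h1 h2.
by case: (ltngtP a b) => [lt|lt|->] /=; [|apply/negbTE|rewrite ltn_add2l //];
  nia.
Qed.

Lemma chain_key_inj i : injective (chain_key i).
Proof.
move=> x y e; have := chain_key_lt i x y; have := chain_key_lt i y x.
rewrite e ltnn; case: (ltngtP (out_count i x) (out_count i y)) => //= _.
by case: (ltngtP x y) => // /val_inj.
Qed.

Definition pos i x := krank (chain_key i) x.

Lemma pos_lt i x y : (pos i x < pos i y)%N = (chain_key i x < chain_key i y)%N.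
Proof. exact/krank_lt/chain_key_inj. Qed.

Lemma pos_inj i : injective (pos i).
Proof. exact/krank_inj/chain_key_inj. Qed.

Lemma pos_lt_n i x : (pos i x < #|'I_n|)%N.
Proof. exact: krank_lt_card. Qed.

Hypothesis chC : is_chain Q C.

Lemma chain_proper A : A \in C -> A \in Q.
Proof. by case/andP: chC => /subsetP sub _; apply: sub. Qed.

Lemma out_count_lt i x y : reflect (exists A, [/\ A \in C, x \in A i & y \notin
  A i])
  (out_count i x < out_count i y)%N.
Proof.
apply: (iffP idP) => [lt|[A [cA xA yA]]].
  have: ~~ ([set A in C | y \notin A i] \subset [set A in C | x \notin A i]).
    by apply: contraTN lt => /subset_leq_card; rewrite -leqNgt.
  case/subsetPn => A; rewrite !inE => /andP[cA yA]; rewrite cA /= negbK => xA.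
  by exists A.
apply: proper_card; apply/properP; split; last by exists A; rewrite !inE ?cA
  ?xA.
apply/subsetP => B; rewrite !inE => /andP[cB xB]; rewrite cB /=.
have /orP[|/bp_leP/(_ i)/subsetP sub] := is_chain_comparable chC cA cB.
  by move/bp_leP/(_ i)/subsetP/(_ x xA); rewrite (negbTE xB).
by apply: contra yA; apply: sub.
Qed.

Lemma chain_pos A i x : A \in C -> (x \in A i) = (pos i x < bp_rank A)%N.
Proof.
move=> cA; rewrite (bp_rankE A i); apply: krank_down; first exact:
  chain_key_inj.
move=> {}x y xA; apply: contraTT => yA; rewrite -ltnNge chain_key_lt.
by apply/orP; left; apply/out_count_lt; exists A.
Qed.

End Chain.

(** * Inversion sets of chains and cone points *)

Definition inversions C : {set 'I_t * ('I_n * 'I_n)} :=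
  [set p : 'I_t * ('I_n * 'I_n) | (p.2.1 < p.2.2)%N &&
     [exists A in C, (p.2.2 \in A p.1) && (p.2.1 \notin A p.1)]].

Lemma inversionsP C (i : 'I_t) (x y : 'I_n) : reflect ((x < y)%N /\ exists A,
  [/\ A \in C, y \in A i & x \notin A i])
  ((i, (x, y)) \in inversions C).
Proof.
rewrite inE /=; apply: (iffP andP) => [[lt /existsP[A /and3P[cA h1 h2]]]|[lt [A
  [cA h1 h2]]]].
  by split=> //; exists A.
by split=> //; apply/existsP; exists A; rewrite cA h1 h2.
Qed.

Lemma inversions_mono C C' : C \subset C' -> inversions C \subset inversions C'.
Proof.
move=> /subsetP sub; apply/subsetP => -[i [x y]] /inversionsP[lt [A [cA h1
  h2]]].
by apply/inversionsP; split=> //; exists A; split=> //; apply: sub.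
Qed.

Definition before (E : {set 'I_t * ('I_n * 'I_n)}) i (y x : 'I_n) : bool :=
  (y < x)%N && ((i, (y, x)) \notin E) || (x < y)%N && ((i, (x, y)) \in E).

Definition inv_pos E i x : nat := #|[set y | before E i y x]|.

(** Inversions determine the linear order completely. Segments and cone points can thus be functions
    of the inversion set alone, as the matching requires. *)
Lemma inv_posE C i x : is_chain Q C -> inv_pos (inversions C) i x = pos C i x.
Proof.
move=> ch; apply: eq_card => y; rewrite !inE chain_key_lt /before.
have invE (a b : 'I_n) : (a < b)%N -> ((i, (a, b)) \in inversions C) =
  (out_count C i b < out_count C i a)%N.
  move=> lt; apply/idP/idP => [/inversionsP[_ h]|/(out_count_lt ch) h].
    exact/(out_count_lt ch).
  by apply/inversionsP; split.
case: (ltngtP y x) => [lt|lt|/val_inj ->] /=.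
- by rewrite orbF invE // -leqNgt leq_eqVlt orbC andbT.
- by rewrite invE // andbF orbF.
- by rewrite ltnn eqxx.
Qed.

(* The initial segment of length j of the linear extension encoded by E.      *)
Definition segment E j : P :=
  insubd (bp_cst t set0) [ffun i => [set x : 'I_n | (inv_pos E i x < j)%N]].

Definition no_descent E (j : nat) : bool :=
  [forall i : 'I_t, forall x : 'I_n, forall y : 'I_n,
    (inv_pos E i x == j.-1) && (inv_pos E i y == j) ==> (x < y)%N].

(** Any rank of [J] that is a descent in no coordinate will do; [cone_pointP] shows that below the
    top dimension one exists and the default is not reached. *)
Definition cone_point E : P :=
  if [pick j in J | no_descent E j] is Some j then segment E j else \bot%O.

Section Segments.
Variable C : {set P}.
Hypothesis chC : is_chain Q C.
Local Notation E := (inversions C).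

Lemma segmentE j i : (j <= n)%N -> segment E j i = [set x | (pos C i x < j)%N].
Proof.
move=> le_j; rewrite /segment val_insubd.
have e k : [set x | (inv_pos E k x < j)%N] = [set x | (pos C k x < j)%N].
  by apply/setP => x; rewrite !inE inv_posE.
rewrite ifT; first by rewrite ffunE e.
apply/forallP => k; apply/forallP => l; rewrite !ffunE !e !card_inj_lt
  ?card_ord //;
  by [exact: pos_inj | move=> x; have := @pos_lt_n C k x; rewrite card_ord |
      move=> x; have := @pos_lt_n C l x; rewrite card_ord].
Qed.

Lemma in_segment j i x : (j <= n)%N -> (x \in segment E j i) = (pos C i x <
  j)%N.
Proof. by move=> le_j; rewrite segmentE // inE. Qed.

Lemma segment_rank j : (j <= n)%N -> bp_rank (segment E j) = j.
Proof.
move=> le_j; rewrite (bp_rankE _ i0) segmentE // card_inj_lt ?card_ord //.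
  exact: pos_inj.
by move=> x; have := @pos_lt_n C i0 x; rewrite card_ord.
Qed.

Lemma chain_segment A : A \in C -> A = segment E (bp_rank A).
Proof.
move=> cA; apply/val_inj/ffunP => i; apply/setP => x.
by rewrite in_segment ?bp_rank_le_n // (chain_pos chC).
Qed.

Lemma segment_le j k : (j <= k)%N -> (k <= n)%N -> (segment E j <= segment E
  k)%O.
Proof.
move=> le_jk le_k; apply/bp_leP => i; apply/subsetP => x.
by rewrite !in_segment ?(leq_trans le_jk) // => /leq_trans; apply.
Qed.

Lemma segment_comparable j A : (j <= n)%N -> A \in C -> (segment E j >=< A)%O.
Proof.
move=> le_j cA; rewrite (chain_segment cA); have := bp_rank_le_n A.
case: (leqP j (bp_rank A)) => [le|/ltnW le] le_n; apply/orP; [left|right];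
  exact: segment_le.
Qed.

Lemma segment_chain (j : 'I_n) : j \in J -> is_chain Q (segment E j |: C).
Proof.
move=> jJ; have le_j := ltnW (ltn_ord j); apply/andP; split.
  apply/subsetP => A /setU1P[->|/(chain_proper chC) //].
  by apply/bp_properP; exists j; rewrite ?segment_rank.
apply/'forall_in_'forall_in_idP => A /setU1P[->|cA] B /setU1P[->|cB].
- exact: comparablexx.
- exact: segment_comparable.
- by rewrite comparable_sym segment_comparable.
- exact: is_chain_comparable chC cA cB.
Qed.

(** If an initial segment contains [y] but not [x], then [y] precedes [x] in the order of [C]; for
    [x < y] this is already an inversion of [C], since ties are broken increasingly. *)
Lemma segment_inversions (j : 'I_n) : inversions (segment E j |: C) = E.
Proof.
have le_j := ltnW (ltn_ord j).
apply/eqP; rewrite eqEsubset; apply/andP; split; last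
  exact/inversions_mono/subsetUr.
apply/subsetP => -[i [x y]] /inversionsP[lt [A [/setU1P[eA|cA] yA xA]]];
  apply/inversionsP; split=> //; last by exists A.
apply/(out_count_lt chC); rewrite eA !in_segment // -leqNgt in yA xA.
have: (pos C i y < pos C i x)%N by apply: leq_trans xA.
by rewrite pos_lt chain_key_lt [(y < x)%N]ltnNge (ltnW lt) andbF orbF.
Qed.

Lemma missing_rank : (#|C| < #|J|)%N ->
  exists2 j : 'I_n, j \in J & forall A, A \in C -> bp_rank A <> j.
Proof.
move=> lt.
have: ~~ ([set widen_ord (leqnSn n) j | j in J] \subset [set (inord (bp_rank A)
  : 'I_n.+1) | A in C]).
  apply: contraTN lt => /subset_leq_card; rewrite card_imset; last first.
    by move=> a b /(congr1 val) /= /val_inj.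
  by move=> le; rewrite -leqNgt (leq_trans le) // leq_imset_card.
case/subsetPn => _ /imsetP[j jJ ->] nj; exists j => // A cA e; case/negP: nj.
apply/imsetP; exists A => //; apply: val_inj; rewrite /= inordK ?e //.
exact: leqW.
Qed.

(** With no vertex of rank [j], the positions [j - 1] and [j] belong to one block in every
    coordinate, and blocks are sorted increasingly. *)
Lemma missing_no_descent (j : 'I_n) : j \in J ->
  (forall A, A \in C -> bp_rank A <> j) -> no_descent E j.
Proof.
move=> jJ no; have j_gt0 := J_gt0 jJ.
apply/forallP => i; apply/forallP => x; apply/forallP => y; apply/implyP.
rewrite !inv_posE // => /andP[/eqP ex /eqP ey].
have: (pos C i x < pos C i y)%N by rewrite ex ey prednK.
rewrite pos_lt chain_key_lt => /orP[/(out_count_lt chC)[A [cA xA yA]]|/andP[]]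
  //.
case: (no A cA); rewrite (chain_pos chC i _ cA) ex in xA.
rewrite (chain_pos chC i _ cA) ey -leqNgt in yA.
by apply/eqP; rewrite eqn_leq yA -(prednK j_gt0).
Qed.

Lemma cone_pointP : (#|C| < #|J|)%N ->
  exists j : 'I_n, [/\ j \in J, no_descent E j & cone_point E = segment E j].
Proof.
move=> /missing_rank[j jJ no]; rewrite /cone_point; case: pickP => [k /andP[kJ
  nd]|h].
  by exists k.
by have := h j; rewrite /= jJ (missing_no_descent jJ no).
Qed.

(** Deleting the vertex merges two adjacent blocks in each coordinate. Both increase, and no descent
    at [j] means that the last element [a] of the first is less than the first element [b] of the
    second. A lost inversion would give [y <= a < b <= x], against [x < y]. *)
Lemma segment_del (j : 'I_n) : j \in J -> no_descent E j -> segment E j \in C ->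
  inversions (C :\ segment E j) = E.
Proof.
move=> jJ nd; set v := segment E j => vC; have j_gt0 := J_gt0 jJ.
have le_j := ltnW (ltn_ord j).
apply/eqP; rewrite eqEsubset inversions_mono ?subsetDl //=.
apply/subsetP => -[i [x y]] /inversionsP[lt [A [cA yA xA]]].
have [eA|nA] := eqVneq A v; last first.
  by apply/inversionsP; split=> //; exists A; rewrite !inE nA.
rewrite eA !in_segment // -leqNgt in yA xA.
apply/negPn/negP => /inversionsP ninv.
have nosep B : B \in C -> B != v -> (y \in B i) -> (x \in B i).
  move=> cB nB yB; apply/negPn/negP => xB; apply: ninv; split=> //.
  by exists B; rewrite !inE nB.
have lt_n k : (k < n)%N -> exists z, pos C i z = k.
  move=> lt_k; apply: inj_lt_surj; rewrite ?card_ord //; first exact: pos_inj.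
  by move=> z; have := @pos_lt_n C i z; rewrite card_ord.
have [a ea] := lt_n j.-1 (leq_ltn_trans (leq_pred j) (ltn_ord j)).
have [b eb] := lt_n j (ltn_ord j).
have lt_ab : (a < b)%N.
  have /forallP/(_ i)/forallP/(_ a)/forallP/(_ b)/implyP := nd.
  by rewrite !inv_posE // ea eb !eqxx; apply.
have le_ya : (y <= a)%N.
  have [->//|nya] := eqVneq y a.
  have: (pos C i y < pos C i a)%N.
    rewrite ltn_neqAle (inj_eq (@pos_inj C i)) nya ea /= -ltnS prednK //.
  rewrite pos_lt chain_key_lt => /orP[/(out_count_lt chC)[B [cB yB aB]]|/andP[_
    /ltnW //]].
  have nB : B != v.
    by apply: contraNneq aB => ->; rewrite in_segment // ea prednK.
  have := nosep B cB nB yB; rewrite (chain_pos chC i _ cB).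
  rewrite (chain_pos chC i _ cB) ea -leqNgt in aB; lia.
have le_bx : (b <= x)%N.
  have [->//|nbx] := eqVneq b x.
  have: (pos C i b < pos C i x)%N.
    by rewrite ltn_neqAle (inj_eq (@pos_inj C i)) nbx eb.
  rewrite pos_lt chain_key_lt => /orP[/(out_count_lt chC)[B [cB bB xB]]|/andP[_
    /ltnW //]].
  have nB : B != v.
    by apply: contraTneq bB => ->; rewrite in_segment // eb ltnn.
  case/negP: xB; apply: nosep => //; rewrite (chain_pos chC i _ cB).
  by rewrite (chain_pos chC i _ cB) eb in bB; apply: ltn_trans yA bB.
lia.
Qed.

End Segments.

Lemma bp_exact m : (m < #|J|)%N -> (kermx (boundary Q m) <= boundary Q m.+1)%MS.
Proof.
move=> lt_m; apply: (kermx_boundary (Inv := inversions) (v := cone_point)).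
- exact: inversions_mono.
- move=> C /facesP[ch sz] _; rewrite -sz in lt_m.
  have [j [jJ _ ->]] := cone_pointP ch lt_m.
  by rewrite segment_inversions //; split=> //; apply: segment_chain.
- move=> C /facesP[ch sz]; rewrite -sz in lt_m.
  have [j [jJ nd ->]] := cone_pointP ch lt_m.
  exact: segment_del.
Qed.

Lemma bp_face_card_le C m : C \in faces Q m -> (m <= #|J|)%N.
Proof.
move=> /facesP[ch <-].
have injC : {in C &, injective (fun A => inord (bp_rank A) : 'I_n.+1)}.
  move=> A B cA cB /(congr1 val); rewrite /= !inordK ?ltnS ?bp_rank_le_n // =>
    e.
  exact: bp_chain_rank_inj ch cA cB e.
rewrite -(card_in_imset injC).
rewrite -(card_imset J (f := widen_ord (leqnSn n))); last by move=> a b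
  /(congr1 val) /= /val_inj.
apply/subset_leq_card/subsetP => _ /imsetP[A cA ->].
have /bp_properP[j jJ e] := chain_proper ch cA.
by apply/imsetP; exists j => //; apply: val_inj; rewrite /= inordK e // leqW.
Qed.

(** * Faces with a given rank set as tuples of tabloids *)

Definition rank_set C : {set 'I_n} := [set j : 'I_n | [exists A in C, bp_rank A
  == j]].

Lemma rank_setP C (j : 'I_n) :
  reflect (exists2 A, A \in C & bp_rank A = j) (j \in rank_set C).
Proof.
rewrite inE; apply: (iffP existsP) => [[A /andP[cA /eqP e]]|[A cA e]]; first by
  exists A.
by exists A; rewrite cA e eqxx.
Qed.

Lemma rank_set_face C m : C \in faces Q m ->
  (rank_set C \subset J) && (#|rank_set C| == m).
Proof.
move=> /facesP[ch sz]; apply/andP; split.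
  apply/subsetP => j /rank_setP[A cA e]; have /bp_properP[k kJ e'] :=
    chain_proper ch cA.
  by have -> : j = k by apply: val_inj; rewrite /= -e -e'.
rewrite -sz -(card_imset (rank_set C) (f := widen_ord (leqnSn n))); last first.
  by move=> a b /(congr1 val) /= /val_inj.
have injC : {in C &, injective (fun A => inord (bp_rank A) : 'I_n.+1)}.
  move=> A B cA cB /(congr1 val); rewrite /= !inordK ?ltnS ?bp_rank_le_n // =>
    e.
  exact: bp_chain_rank_inj ch cA cB e.
rewrite -(card_in_imset injC); apply/eqP/eq_card => k; apply/imsetP/imsetP.
  case=> j /rank_setP[A cA e] ->; exists A => //; apply: val_inj.
  by rewrite /= inordK ?e // leqW.
case=> A cA ->; have /bp_properP[j jJ e] := chain_proper ch cA.
exists j; first by apply/rank_setP; exists A.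
by apply: val_inj; rewrite /= inordK e // leqW.
Qed.

(** Each block is named by its least position, as in [blk]: the largest rank of a vertex missing
    [x], the empty maximum giving 0 for the first block. *)
Definition row_labels C : {ffun 'I_t -> row_map n} :=
  [ffun i => [ffun x => insubd x (\max_(A in C | x \notin A i) bp_rank A)%N]].

Lemma row_labelsE C i x : is_chain Q C ->
  row_labels C i x = (\max_(A in C | x \notin A i) bp_rank A)%N :> nat.
Proof.
move=> ch; rewrite !ffunE val_insubd ifT //.
have n_gt0 : (0 < n)%N by apply: leq_ltn_trans (ltn_ord x).
apply: (@leq_ltn_trans n.-1); last by rewrite prednK.
apply/bigmax_leqP => A /andP[cA _].
have /bp_properP[j _ ->] := chain_proper ch cA.
by rewrite -ltnS prednK.
Qed.

Lemma row_labels_lt C A i x : is_chain Q C -> A \in C ->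
  (row_labels C i x < bp_rank A)%N = (x \in A i).
Proof.
move=> ch cA; rewrite row_labelsE //; apply/idP/idP => [|xA].
  apply: contraTT => xA; rewrite -leqNgt (bigD1 A) /= ?leq_maxl //.
  by rewrite cA.
have [j jJ e] := bp_properP _ (chain_proper ch cA).
(* Positive ranks matter here: the label 0 of the first block must be below [bp_rank A]. *)
have rk_gt0 : (0 < bp_rank A)%N by rewrite e J_gt0.
rewrite -(prednK rk_gt0) ltnS; apply/bigmax_leqP => B /andP[cB xB].
rewrite -ltnS prednK // ltnNge; apply: contra xB => le.
by have /bp_leP/(_ i)/subsetP := bp_chain_rank_le ch cA cB le; apply.
Qed.

Lemma row_labels_act C (g : bp_group t n) i x : is_chain Q C ->
  row_labels ((bp_action t n)^* C g)%act i x = row_labels C i ((g i)^-1%g x).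
Proof.
move=> ch; have ch' : is_chain Q ((bp_action t n)^* C g)%act.
  by rewrite (is_chain_act (@bp_action_mono t n) (bp_proper_acts t J)).
apply: val_inj; rewrite /= !row_labelsE //.
rewrite big_imset_cond /=; last by move=> A B _ _; apply: (act_inj (bp_action t
  n) g).
apply: eq_big => [A|A _]; last exact: bp_rank_act.
congr (_ && ~~ _); rewrite /= ffunE.
by rewrite -[x in LHS](permKV (g i)) mem_imset //; apply: perm_inj.
Qed.

Section RankSet.
Variable I : {set 'I_n}.
Hypothesis sIJ : I \subset J.
Local Notation rowsI := (rows_of n (block_content I)).

Definition level (r : {ffun 'I_t -> row_map n}) (j : nat) : P :=
  insubd (bp_cst t set0) [ffun i => [set x : 'I_n | (r i x < j)%N]].

Definition level_chain r : {set P} := [set level r j | j : 'I_n in I].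

Section Levels.
Variable r : {ffun 'I_t -> row_map n}.
Hypothesis rI : forall i, r i \in rowsI.

Lemma rows_block_map i : block_map I (fun x => r i x : nat).
Proof. by apply: content_block_map; apply/rows_ofP. Qed.

Lemma in_level (j : 'I_n) i x : j \in I -> (x \in level r j i) = (r i x < j)%N.
Proof.
move=> jI; rewrite /level val_insubd ifT; first by rewrite ffunE inE.
apply/forallP => k; apply/forallP => l; rewrite !ffunE.
by rewrite (rows_block_map k).2 // (rows_block_map l).2.
Qed.

Lemma level_rank (j : 'I_n) : j \in I -> bp_rank (level r j) = j.
Proof.
move=> jI; rewrite (bp_rankE _ i0) -[RHS](rows_block_map i0).2 //.
by apply: eq_card => x; rewrite in_level // inE.
Qed.

Lemma level_chainP : is_chain Q (level_chain r).
Proof.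
apply/andP; split.
  apply/subsetP => _ /imsetP[j jI ->]; apply/bp_properP; exists j.
    exact: (subsetP sIJ).
  exact: level_rank.
apply/'forall_in_'forall_in_idP => _ /imsetP[j jI ->] _ /imsetP[k kI ->].
have le (a b : 'I_n) : a \in I -> b \in I -> (a <= b)%N -> (level r a <= level
  r b)%O.
  move=> aI bI le_ab; apply/bp_leP => i; apply/subsetP => x; rewrite !in_level
    //.
  by move/leq_trans; apply.
by apply/orP; case: (leqP j k) => [|/ltnW] h; [left|right]; apply: le.
Qed.

Lemma level_chain_rank : rank_set (level_chain r) = I.
Proof.
apply/setP => j; apply/rank_setP/idP => [[_ /imsetP[k kI ->]]|jI].
  by rewrite level_rank // => /val_inj <-.
by exists (level r j); rewrite ?level_rank //; apply: imset_f.
Qed.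

Lemma level_chain_labels : row_labels (level_chain r) = r.
Proof.
apply/ffunP => i; apply/ffunP => x; apply: val_inj => /=.
have ch := level_chainP.
apply: (@label_eq n I); last first.
- move=> j jI; rewrite -{1}(level_rank jI) row_labels_lt ?in_level //.
  exact: imset_f.
- exact: (rows_block_map i).1.
rewrite row_labelsE //; elim/big_ind: _ => [|a b la lb|A /andP[/imsetP[j jI ->]
  _]].
- by left.
- by case: (leqP a b).
- by right; exists j; rewrite ?level_rank.
Qed.

Lemma level_chain_act (g : bp_group t n) :
  (forall i, row_map_act (r i) (g i) = r i) ->
  ((bp_action t n)^* (level_chain r) g)%act = level_chain r.
Proof.
move=> fix_r; have e (j : 'I_n) : j \in I -> bp_action t n (level r j) g =
  level r j.
  move=> jI; apply/val_inj/ffunP => i; apply/setP => x; rewrite /= ffunE.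
  rewrite -[x in LHS](permKV (g i)) mem_imset; last exact: perm_inj.
  by rewrite !in_level // -{2}(fix_r i) ffunE.
rewrite /= /setact /level_chain -imset_comp; apply: eq_in_imset => j jI /=.
exact: e.
Qed.

End Levels.

Lemma row_labels_rows C i : is_chain Q C -> rank_set C = I -> row_labels C i
  \in rowsI.
Proof.
move=> ch rC; have bl : block_map I (fun x => row_labels C i x : nat).
  split=> [x|j]; last first.
    rewrite -rC => /rank_setP[A cA <-]; rewrite [RHS](bp_rankE A i).
    by apply: eq_card => x; rewrite inE row_labels_lt.
  rewrite row_labelsE //; elim/big_ind: _ => [|a b la lb|A /andP[cA _]].
  - by left.
  - by case: (leqP a b).
  have /bp_properP[j jJ e] := chain_proper ch cA.
  by right; exists j => //; rewrite -rC; apply/rank_setP; exists A.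
apply/rows_ofP => k; rewrite -(block_map_content bl) ?card_ord //.
Qed.

Lemma row_labels_level C : is_chain Q C -> rank_set C = I ->
  level_chain (row_labels C) = C.
Proof.
move=> ch rC; have rI i := row_labels_rows i ch rC.
have e A (j : 'I_n) : A \in C -> bp_rank A = j -> j \in I -> level (row_labels
  C) j = A.
  move=> cA ej jI; apply/val_inj/ffunP => i; apply/setP => x.
  by rewrite in_level // -ej row_labels_lt.
apply/setP => A; apply/imsetP/idP => [[j jI ->]|cA].
  by have := jI; rewrite -rC => /rank_setP[B cB eB]; rewrite (e B).
have /bp_properP[j jJ ej] := chain_proper ch cA.
have jI : j \in I by rewrite -rC; apply/rank_setP; exists A.
by exists j => //; rewrite (e A).
Qed.

(** [row_labels] and [level_chain] are mutually inverse and compatible with the actions, and a tuple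
    of tabloids is fixed by [g] exactly when each coordinate is fixed by its own component. *)
Lemma card_fixed_rank_set m (g : bp_group t n) : #|I| = m ->
  #|[set C in faces Q m | (((bp_action t n)^* C g)%act == C) & rank_set C ==
    I]| =
  (\prod_(i < t) #|[set r in rowsI | row_map_act r (g i) == r]|)%N.
Proof.
move=> sz; pose F i := [set r in rowsI | row_map_act r (g i) == r].
transitivity #|[set r : {ffun 'I_t -> row_map n} | [forall i, r i \in F i]]|;
  last first.
  rewrite -sum1_card; transitivity (\sum_(r in family (fun i => mem (F i)))
    1)%N.
    by apply: eq_bigl => r; rewrite inE.
  under [RHS]eq_bigr => i _ do rewrite -sum1_card.
  by rewrite bigA_distr_big_dep; apply: eq_bigr => r _; rewrite big1.
apply: (card_bij_in (f := row_labels) (g := level_chain)) => [C|r].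
  rewrite [C \in _]inE => /and3P[fC /eqP eC /eqP rC]; have /facesP[ch szC] :=
    fC.
  split; last exact: row_labels_level.
  rewrite inE; apply/forallP => i; rewrite inE row_labels_rows //=;
    apply/eqP/ffunP => x.
  by rewrite ffunE -row_labels_act // eC.
rewrite inE => /forallP h; have rI i : r i \in rowsI by have := h i; rewrite
  inE => /andP[].
have fr i : row_map_act (r i) (g i) = r i by have := h i; rewrite inE =>
  /andP[_ /eqP].
split; last exact: level_chain_labels.
rewrite in_set level_chain_act // eqxx level_chain_rank // eqxx !andbT;
  apply/facesP.
have ch := level_chainP rI; split=> //.
have fch : level_chain r \in faces Q #|level_chain r| by apply/facesP.
by have /andP[_ /eqP <-] := rank_set_face fch; rewrite level_chain_rank.
Qed.

End RankSet.

Lemma bp_faces_char m (g : bp_group t n) :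
  faces_char (@bp_action_mono t n) (bp_proper_acts t J) m g =
  \sum_(I : {set 'I_n} | (I \subset J) && (#|I| == m))
    \prod_(i < t) perm_char (block_content I) (g i).
Proof.
rewrite /faces_char perm_module_char -sum1_card natr_sum.
rewrite (partition_big rank_set (fun I => (I \subset J) && (#|I| == m))) /=;
  last first.
  by move=> C; rewrite inE => /andP[fC _]; apply: rank_set_face fC.
apply: eq_bigr => I /andP[sIJ /eqP sz].
rewrite /perm_char -natr_prod -(card_fixed_rank_set sIJ g sz) -sum1_card
  natr_sum.
by apply: eq_bigl => C; rewrite !inE andbA.
Qed.

End Proper.
End BooleanPowerChains.

(** * Product Frobenius characteristics *)

Section MaximalChains.
Variables (t n : nat) (J : {set 'I_n}).
Hypotheses (t_gt0 : (0 < t)%N) (J_gt0 : forall j : 'I_n, j \in J -> (0 < j)%N).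
Local Notation P := (bool_pow t n).
Local Notation Q := (bp_proper t J).
Local Notation ends := [set \bot%O; \top%O : P].
Implicit Types (A B : P) (C : {set P}).

Lemma bp_selE : bp_sel t J = Q :|: ends.
Proof.
rewrite setUC; apply/esym/setP => A; rewrite !inE.
by case: (A == \bot%O); case: (A == \top%O); rewrite ?orbT ?orbF.
Qed.

Lemma ends_comparable A B : A \in ends -> (A >=< B)%O.
Proof.
case/set2P=> ->; rewrite /Order.comparable; first by rewrite le0x.
by rewrite lex1 orbT.
Qed.

Lemma add_ends_chain C : is_chain Q C -> is_chain (bp_sel t J) (C :|: ends).
Proof.
case/andP=> sub /'forall_in_'forall_in_idP ch; apply/andP; split.
  by rewrite bp_selE setSU.
apply/'forall_in_'forall_in_idP => A /setUP[cA|eA] B /setUP[cB|eB].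
- exact: ch.
- by rewrite comparable_sym ends_comparable.
- exact: ends_comparable.
- exact: ends_comparable.
Qed.

Lemma del_ends_chain C : is_chain (bp_sel t J) C -> is_chain Q (C :\: ends).
Proof.
case/andP=> sub /'forall_in_'forall_in_idP ch; apply/andP; split; first exact:
  setSD.
by apply/'forall_in_'forall_in_idP => A /setDP[cA _] B /setDP[cB _]; apply: ch.
Qed.

Lemma face_ends C m : C \in faces Q m -> (C :|: ends) :\: ends = C.
Proof.
move=> /facesP[/andP[/subsetP sub _] _]; rewrite setDUl setDv setU0.
by apply/setP => A; rewrite in_setD andb_idl // => /sub /setDP[].
Qed.

Lemma face_add_ends C : C \in faces Q #|J| -> C :|: ends \in max_chains (bp_sel
  t J).
Proof.
move=> fC; have /facesP[ch sz] := fC.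
rewrite inE; apply/maxsetP; split=> [|D chD sub]; first exact: add_ends_chain.
apply/eqP; rewrite eqEsubset sub andbT; apply/subsetP => A AD; rewrite in_setU.
case: (boolP (A \in ends)) => [|ne]; rewrite ?orbT // orbF.
have AQ : A \in Q by rewrite in_setD ne; case/andP: chD => /subsetP sD _;
  apply: sD.
have /(bp_properP t_gt0 J_gt0)[j jJ e] := AQ.
have rJ : rank_set C = J.
  by apply/eqP; have /andP[sr /eqP er] := rank_set_face t_gt0 J_gt0 fC; rewrite
    eqEcard sr er leqnn.
have := jJ; rewrite -rJ => /rank_setP[B cB eB].
have BD : B \in D by apply: (subsetP sub); rewrite in_setU cB.
have cmp := is_chain_comparable chD AD BD.
have le : (A <= B)%O by apply: comparable_rank_le => //; rewrite e eB.
by rewrite (bp_le_eq le) // e eB.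
Qed.

(** If a rank of [J] were missing, the segment of that length would extend the chain, against
    maximality. *)
Lemma max_chain_del_ends C : C \in max_chains (bp_sel t J) ->
  C :\: ends \in faces Q #|J| /\ (C :\: ends) :|: ends = C.
Proof.
rewrite inE => /maxsetP[ch maxC].
have chD := del_ends_chain ch.
have eC : (C :\: ends) :|: ends = C.
  apply: maxC; first exact: add_ends_chain.
  by apply/subsetP => A cA; rewrite in_setU in_setD cA andbT; case: (A \in
    ends).
split=> //; apply/facesP; split=> //; apply/eqP; rewrite eqn_leq; apply/andP;
  split.
  by apply: (bp_face_card_le t_gt0 J_gt0 (C := C :\: ends)); apply/facesP.
rewrite leqNgt; apply/negP => lt.
have [j jJ no] := missing_rank lt.
have le_j := ltnW (ltn_ord j).
set S := segment (inversions (C :\: ends)) j.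
have chS := segment_chain t_gt0 J_gt0 chD jJ; rewrite -/S in chS.
have := add_ends_chain chS; rewrite -setUA eC => chSC.
have eSC : S |: C = C by apply: maxC => //; apply: subsetUr.
have rS : bp_rank S = j by apply: (segment_rank t_gt0 chD).
have SC : S \in C by move: (setU11 S C); rewrite eSC.
apply: (no S) rS; rewrite in_setD SC andbT.
have: S \in Q by case/andP: chS => /subsetP sub _; apply: sub; apply: setU11.
by case/setDP.
Qed.

Lemma in_setact (D : {set P}) g x :
  (x \in ((bp_action t n)^* D g)%act) = (bp_action t n x g^-1%g \in D).
Proof.
by rewrite -[x in LHS](actKV (bp_action t n) g) (mem_imset _ _ (act_inj
  (bp_action t n) g)).
Qed.

Lemma ends_act A g : (bp_action t n A g \in ends) = (A \in ends).
Proof. by rewrite !in_set2 bp_act_eq_bot bp_act_eq_top. Qed.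

Lemma bp_max_chains_char g :
  max_chains_char (@bp_action_mono t n) (bp_sel_acts t J) g =
  \prod_(i < t) perm_char (block_content J) (g i).
Proof.
transitivity (faces_char (@bp_action_mono t n) (bp_proper_acts t J) #|J| g);
  last first.
  rewrite (bp_faces_char t_gt0 J_gt0) (big_pred1 J) // => I.
  apply/andP/eqP => [[sub /eqP e]|->]; last by [].
  by apply/eqP; rewrite eqEcard sub e leqnn.
rewrite /max_chains_char /faces_char !perm_module_char; congr (_%:R).
apply: (card_bij_in (f := fun C => C :\: ends) (g := fun C => C :|: ends)) => C.
  rewrite in_set => /andP[mC /eqP fixC]; have [fC eC] := max_chain_del_ends mC.
  split=> //; rewrite in_set fC; apply/eqP/setP => x.
  by rewrite in_setact !in_setD ends_act -in_setact fixC.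
rewrite in_set => /andP[fC /eqP fixC]; split; last exact: face_ends fC.
rewrite in_set face_add_ends //; apply/eqP/setP => x.
by rewrite in_setact in_setU ends_act [RHS]in_setU -in_setact fixC.
Qed.

(** There are no faces above the top dimension, so homology there is the module of cycles; the
    alternating sum over dimensions is regrouped by rank sets. *)
Lemma bp_homology_char g :
  homology_char (@bp_action_mono t n) (bp_proper_acts t J) #|J| g =
  \sum_(I : {set 'I_n} | I \subset J) (-1) ^+ (#|J| - #|I|) *
     \prod_(i < t) perm_char (block_content I) (g i).
Proof.
rewrite homology_char_top; last first.
  apply/setP => C; rewrite in_set0; apply/negP => /(bp_face_card_le t_gt0
    J_gt0).
  by rewrite ltnn.
rewrite cycles_char_sum; last by move=> k; apply: (bp_exact t_gt0 J_gt0).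
under eq_bigr => k _ do rewrite (bp_faces_char t_gt0 J_gt0) mulr_sumr.
rewrite (partition_big (fun I : {set 'I_n} => inord #|I| : 'I_#|J|.+1) xpredT)
  //=.
apply: eq_bigr => k _; apply: eq_big => [I|I /andP[_ /eqP ->] //].
case sub: (I \subset J) => //=; rewrite -val_eqE /= inordK // ltnS.
exact: subset_leq_card.
Qed.

End MaximalChains.

(** For [D] properly inside [J], toggling a fixed element of [J] outside [D] is a sign-reversing
    involution. *)
Lemma sum_sign_subsets (X : finType) (D J : {set X}) :
  \sum_(I : {set X} | (D \subset I) && (I \subset J)) (-1) ^+ (#|J| - #|I|) =
  (D == J)%:R :> rat.
Proof.
have [->|ne] := eqVneq D J.
  rewrite (big_pred1 J) ?subnn // => I; by rewrite andbC -eqEsubset.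
have [sub|nsub] := boolP (D \subset J); last first.
  rewrite big_pred0 // => I; apply/negP => /andP[DI IJ].
  by case/negP: nsub; apply: subset_trans DI IJ.
have [x xJ xD] : exists2 x, x \in J & x \notin D.
  by apply/subsetPn; apply: contra ne => sub'; rewrite eqEsubset sub.
pose tog (I : {set X}) := if x \in I then I :\ x else x |: I.
have togK : involutive tog.
  move=> I; rewrite /tog; case: (boolP (x \in I)) => xI.
    by rewrite setD11 setD1K.
  by rewrite setU11 setU1K.
have : \sum_(I : {set X} | (D \subset I) && (I \subset J)) (-1) ^+ (#|J| -
  #|I|) =
  - \sum_(I : {set X} | (D \subset I) && (I \subset J)) (-1) ^+ (#|J| - #|I|)
      :> rat.
  rewrite {1}(reindex_inj (inv_inj togK)) /= -sumrN; apply: eq_big => [I|I].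
    rewrite /tog; case: (boolP (x \in I)) => xI.
      rewrite subsetD1 xD andbT; congr (_ && _).
      by rewrite -{2}(setD1K xI) subUset sub1set xJ.
    rewrite subUset sub1set xJ /=; congr (_ && _).
    apply/idP/idP => [/subsetP h|/subset_trans]; last by apply; apply: subsetUr.
    apply/subsetP => y yD; have := h y yD; rewrite in_setU1; case: eqP => // e.
    by rewrite -e yD in xD.
  rewrite /tog; case: (boolP (x \in I)) => xI /andP[_ sIJ].
    have sI : I \subset J by rewrite -(setD1K xI) subUset sub1set xJ.
    have e := cardsD1 x I; rewrite xI add1n in e; have le := subset_leq_card sI.
    have -> : (#|J| - #|I :\ x| = (#|J| - #|I|).+1)%N by lia.
    by rewrite exprS mulN1r.
  have e := cardsU1 x I; rewrite xI add1n in e; have le := subset_leq_card sIJ.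
  have -> : (#|J| - #|I| = (#|J| - #|x |: I|).+1)%N by lia.
  by rewrite exprS mulN1r opprK.
by move/eqP; rewrite -addr_eq0 -mulr2n mulrn_eq0 => /eqP.
Qed.

(** * Factorization over the coordinates *)

Section ProductFrobenius.
Variables t n : nat.

Lemma sum_bp_group (F : 'I_t -> 'S_n -> rat) :
  \sum_(g : bp_group t n) \prod_j F j (g j) = \prod_j \sum_s F j s.
Proof.
rewrite bigA_distr_bigA (reindex (fun f : {ffun 'I_t -> 'S_n} => f : bp_group t
  n)) //.
by exists (fun f : bp_group t n => f : {ffun 'I_t -> 'S_n}).
Qed.

Lemma card_bp_group : #|{: bp_group t n}|%:R = \prod_(j < t) #|{: 'S_n}|%:R :>
  rat.
Proof.
transitivity (\sum_(g : bp_group t n) \prod_(j < t) (1 : rat)).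
  by rewrite -sumr_const; apply: eq_bigr => g _; rewrite big1.
rewrite (sum_bp_group (fun _ _ => 1)); apply: eq_bigr => j _.
by rewrite sumr_const.
Qed.

Lemma char_dot_prod (F G : 'I_t -> 'S_n -> rat) :
  char_dot (fun g : bp_group t n => \prod_j F j (g j)) (fun g => \prod_j G j (g
    j)) =
  \prod_j char_dot (F j) (G j).
Proof.
rewrite /char_dot big_split /= prodfV -card_bp_group; congr (_ * _).
rewrite -(sum_bp_group (fun j s => F j s * G j s^-1%g)); apply: eq_bigr => g _.
rewrite -big_split; apply: eq_bigr => j _ /=.
by rewrite invg_ffun.
Qed.

Lemma in_varsD j : {morph @in_vars t j : f g / f + g}.
Proof. by move=> f g; apply: boolp.functional_extensionality_dep => N; apply:
  comp_mpolyD. Qed.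

Lemma in_vars0 j : @in_vars t j 0 = 0.
Proof. by apply: boolp.functional_extensionality_dep => N; apply: comp_mpoly0.
  Qed.

Lemma in_varsM j : {morph @in_vars t j : f g / f * g}.
Proof. by move=> f g; apply: boolp.functional_extensionality_dep => N; apply:
  rmorphM. Qed.

Lemma in_vars1 j : @in_vars t j 1 = 1.
Proof. by apply: boolp.functional_extensionality_dep => N; apply: comp_mpoly1.
  Qed.

Lemma in_varsZ j (a : rat) f : @in_vars t j (a *: f) = a *: in_vars j f.
Proof. by apply: boolp.functional_extensionality_dep => N; apply: comp_mpolyZ.
  Qed.

(** Scalar products factor over the coordinates, so the sum over tuples of partitions is a product
    of single sums, each the Schur expansion of the same product of [h_m]. *)
Lemma prod_frob_perm_char (c : nat -> nat) : (\sum_(i < n) c i = n)%N ->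
  prod_frob (fun g : bp_group t n => \prod_j perm_char c (g j)) =
  \prod_(i < n) \prod_(j < t) in_vars j (h_sym (c i)).
Proof.
move=> sum_c; rewrite exchange_big /=.
transitivity (\prod_(j < t) \sum_(la : intpart n) in_vars j ((kostka la c)%:R
  *: schur la)).
  rewrite bigA_distr_bigA; apply: eq_bigr => mu _.
  rewrite (char_dot_prod (fun _ => perm_char c) (fun j => specht_char (mu j)))
    -scaler_prod.
  by apply: eq_bigr => j _; rewrite young_rule // in_varsZ.
apply: eq_bigr => j _.
rewrite -(big_morph (@in_vars t j) (@in_varsD j) (in_vars0 j)).
rewrite -(big_morph (@in_vars t j) (@in_varsM j) (in_vars1 j)) h_prod_schur //.
by congr in_vars; apply: eq_bigr => la _; rewrite scaler_nat.
Qed.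

Lemma eq_prod_frob (chi psi : bp_group t n -> rat) :
  chi =1 psi -> prod_frob chi = prod_frob psi.
Proof.
move=> e; apply: eq_bigr => mu _; congr (_ *: _).
by rewrite /char_dot; congr (_ * _); apply: eq_bigr => g _; rewrite e.
Qed.

Lemma prod_frob_sum (I : finType) (S : pred I) (a : I -> rat) (F : I ->
  bp_group t n -> rat) :
  prod_frob (fun g => \sum_(i | S i) a i * F i g) = \sum_(i | S i) a i *:
    prod_frob (F i).
Proof.
rewrite /prod_frob; under [RHS]eq_bigr => i _ do rewrite scaler_sumr.
rewrite [RHS]exchange_big; apply: eq_bigr => mu _ /=.
under [RHS]eq_bigr => i _ do rewrite scalerA.
rewrite -scaler_suml; congr (_ *: _); rewrite /char_dot.
under eq_bigr => g _ do rewrite mulr_suml.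
rewrite exchange_big /= mulr_sumr; apply: eq_bigr => i _.
rewrite [RHS]mulrCA; congr (_ * _); rewrite mulr_sumr.
by apply: eq_bigr => g _; rewrite mulrA.
Qed.

End ProductFrobenius.

(** * Evaluation of [Phi] on products of complete functions *)

Section PhiFacts.
Variables (t : nat) (Phi : fam1 -> famt t).
Hypothesis PhiP : is_Phi Phi.

Lemma Phi_sum (I : finType) (F : I -> fam1) : (forall i, is_symfun (F i)) ->
  Phi (\sum_i F i) = \sum_i Phi (F i).
Proof.
have [P1 PD PM PZ Ph] := PhiP; move=> symF.
have P0 : Phi 0 = 0.
  by have := PZ 0 1 is_symfun1; rewrite !scale0r.
(* [Phi] is additive only on symmetric functions, so membership is carried along the induction. *)
have [] : is_symfun (\sum_i F i) /\ Phi (\sum_i F i) = \sum_i Phi (F i); last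
  by [].
elim/big_rec2: _ => [|i y x _ [sy ey]]; first by split=> //; apply: is_symfun0.
by split; [apply: is_symfunD | rewrite PD // ey].
Qed.

Lemma Phi_prod (I : finType) (F : I -> fam1) : (forall i, is_symfun (F i)) ->
  Phi (\prod_i F i) = \prod_i Phi (F i).
Proof.
have [P1 PD PM PZ Ph] := PhiP; move=> symF.
have [] : is_symfun (\prod_i F i) /\ Phi (\prod_i F i) = \prod_i Phi (F i);
  last by [].
elim/big_rec2: _ => [|i y x _ [sy ey]]; first by split=> //; apply: is_symfun1.
by split; [apply: is_symfunM | rewrite PM // ey].
Qed.

Lemma Phi_mulrn f m : is_symfun f -> Phi (f *+ m) = Phi f *+ m.
Proof. by have [_ _ _ PZ _] := PhiP; move=> sf; rewrite -!scaler_nat PZ. Qed.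

(** Both sides are [Phi] of the product of the [h_m] over the block sizes of [I]: once through the
    values of [Phi] at the [h_m], once through the Schur expansion, whose Kostka numbers count
    standard tableaux by [card_syt_Des_sub]. *)
Lemma prod_frob_blocks n (I : {set 'I_n}) :
  prod_frob (fun g : bp_group t n => \prod_j perm_char (block_content I) (g j))
    =
  \sum_(la : intpart n) Phi (schur la) *+
    #|[set T : {ffun cell la -> 'I_n.+1} | is_syt T & Des T \subset I]|.
Proof.
have sum_c := block_content_sum I; have [_ _ _ _ Ph] := PhiP.
rewrite prod_frob_perm_char //; under eq_bigr => i _ do rewrite -Ph.
rewrite -Phi_prod; last by move=> i; apply: is_symfun_h.
rewrite h_prod_schur // Phi_sum; last first.
  by move=> la; rewrite -scaler_nat; apply/is_symfunZ/is_symfun_schur.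
apply: eq_bigr => la _; rewrite Phi_mulrn ?card_syt_Des_sub //.
exact: is_symfun_schur.
Qed.

End PhiFacts.

Lemma card_syt_Des_eq n (J : {set 'I_n}) (la : intpart n) :
  \sum_(I : {set 'I_n} | I \subset J) (-1) ^+ (#|J| - #|I|) *
     #|[set T : {ffun cell la -> 'I_n.+1} | is_syt T & Des T \subset I]|%:R =
  #|[set T : {ffun cell la -> 'I_n.+1} | is_syt T & Des T == J]|%:R :> rat.
Proof.
transitivity (\sum_(T : {ffun cell la -> 'I_n.+1} | is_syt T) ((Des T == J)%:R
  : rat)).
  transitivity (\sum_(I : {set 'I_n} | I \subset J)
     \sum_(T : {ffun cell la -> 'I_n.+1} | is_syt T && (Des T \subset I)) ((-1)
       ^+ (#|J| - #|I|) : rat)).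
    apply: eq_bigr => I _.
    have -> : #|[set T : {ffun cell la -> 'I_n.+1} | is_syt T & Des T \subset
      I]| =
        (\sum_(T : {ffun cell la -> 'I_n.+1} | is_syt T && (Des T \subset I))
          1)%N.
      by rewrite -sum1_card; apply: eq_bigl => T; rewrite inE.
    by rewrite natr_sum mulr_sumr; apply: eq_bigr => T _; rewrite mulr1.
  rewrite (exchange_big_dep (fun T : {ffun cell la -> 'I_n.+1} => is_syt T))
    /=; last by move=> I T _ /andP[].
  apply: eq_bigr => T sT; rewrite -sum_sign_subsets; apply: eq_bigl => I.
  by rewrite sT andbC.
rewrite -sum1_card natr_sum big_mkcond [RHS]big_mkcond; apply: eq_bigr => T _.
by rewrite inE; case: (is_syt T); case: (Des T == J).
Qed.

Theorem theorem5p5 (t n : nat) (J : {set 'I_n}) (Phi : fam1 -> famt t) :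
  (0 < t)%N -> (0 < n)%N ->
  (forall j : 'I_n, j \in J -> (0 < j)%N) ->
  is_Phi Phi ->
  alpha t J =
    \sum_(la : intpart n)
      Phi (schur la) *+
      #|[set T : {ffun cell la -> 'I_n.+1} | is_syt T & Des T \subset J]|
  /\
  beta t J =
    \sum_(la : intpart n)
      Phi (schur la) *+
      #|[set T : {ffun cell la -> 'I_n.+1} | is_syt T & Des T == J]|.
Proof.
move=> t_gt0 n_gt0 J_gt0 PhiP; split.
  rewrite -(prod_frob_blocks PhiP); apply: eq_prod_frob => g.
  exact: bp_max_chains_char.
rewrite /beta (eq_prod_frob (bp_homology_char t_gt0 J_gt0)) prod_frob_sum.
under eq_bigr => I _ do rewrite (prod_frob_blocks PhiP) scaler_sumr.
rewrite exchange_big /=; apply: eq_bigr => la _.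
under eq_bigr => I _ do rewrite -scaler_nat scalerA.
by rewrite -scaler_suml card_syt_Des_eq scaler_nat.
Qed.
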